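(* Let $X$ be a schematic finite space. For any open subset $j\colon U\hookrightarrow X$ and any quasi-coherent module $\mathcal N$ on $U$, $\mathbb Rj_*\mathcal N$ is quasi-coherent (i.e. $R^ij_*\mathcal N$ is quasi-coherent for every $i\ge0$). In particular, any quasi-coherent module on $U$ is the restriction to $U$ of a quasi-coherent module on $X$.
   Context: All rings are commutative with unit. A ringed finite space is a ringed space $(X,\mathcal O)$ with $X$ a finite topological space. For $p\in X$, $U_p$ is the smallest open subset containing $p$; $p\le q$ means $q\in U_p$. The stalk is $\mathcal O_p=\mathcal O(U_p)$, with restriction morphisms $\mathcal O_p\to\mathcal O_q$ for $p\le q$. A finite space is a ringed finite space all of whose restriction morphisms are flat. An $\mathcal O$-module is quasi-coherent if it is locally a cokernel of a morphism between free modules of arbitrary rank. All spaces and morphisms are over a fixed commutative base ring $k$ (i.e. over the one-point ringed space $( *,k)$; $k=\mathbb Z$ imposes no restriction, and the notion below does not depend on $k$). $X\times X=X\times_kX$ is the product topological space with $\mathcal O_{(x,y)}=\mathcal O_x\otimes_k\mathcal O_y$. A finite space $X$ is schematic if $R^i\delta_*\mathcal O_X$ is quasi-coherent for all $i\ge0$, where $\delta\colon X\to X\times X$ is the diagonal morphism. An open subset $U$ carries the sheaf $\mathcal O_{|U}$. *)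

(* Defs.v *)
From HB Require Import structures.
From mathcomp Require Import all_boot all_algebra generic_quotient finmap.
From mathcomp Require Import boolp classical_sets functions cardinality topology.

Set Implicit Arguments.
Unset Strict Implicit.
Unset Printing Implicit Defensive.

Import GRing.Theory.
Local Open Scope classical_set_scope.
Local Open Scope ring_scope.
Local Open Scope quotient_scope.

(* Rings are comPzRingType: commutative with unit, the zero ring being allowed
   (stalks of a ringed space, and tensor products of rings, may vanish). *)

(* The R-module obtained from an S-module V by restriction of scalars along f. *)
Definition rscal (R S : comPzRingType) (f : {rmorphism R -> S})
  (V : lmodType S) : Type := V.

Section RestrictionOfScalars.
Variables (R S : comPzRingType) (f : {rmorphism R -> S}) (V : lmodType S).

HB.instance Definition _ := GRing.Zmodule.on (rscal f V).

Let rscale (a : R) (v : rscal f V) : rscal f V := f a *: (v : V).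

Fact rscaleA a b v : rscale a (rscale b v) = rscale (a * b) v.
Proof. by rewrite /rscale scalerA rmorphM. Qed.
Fact rscale1 : left_id 1 rscale.
Proof. by move=> v; rewrite /rscale rmorph1 scale1r. Qed.
Fact rscaleDr : right_distributive rscale +%R.
Proof. by move=> a u v; rewrite /rscale scalerDr. Qed.
Fact rscaleDl v : {morph rscale^~ v : a b / a + b}.
Proof. by move=> a b; rewrite /rscale rmorphD scalerDl. Qed.

HB.instance Definition _ := GRing.Zmodule_isLmodule.Build R (rscal f V)
  rscaleA rscale1 rscaleDr rscaleDl.

Lemma rscalE (a : R) (v : V) : a *: (v : rscal f V) = f a *: v :> V.
Proof. by []. Qed.

End RestrictionOfScalars.

Section Submodules.
Variables (R : comPzRingType) (V : lmodType R).

Record submod := Submod {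
  submod_set : set V;
  submod0 : submod_set 0;
  submodL : forall a u v,
    submod_set u -> submod_set v -> submod_set (a *: u + v) }.

Definition submod_pred (S : submod) (v : V) : bool := `[< submod_set S v >].

Fact submod_pred_closed S : GRing.subsemimod_closed (submod_pred S).
Proof.
split; first split.
- exact/asboolP/submod0.
- move=> u v /asboolP Su /asboolP Sv; apply/asboolP.
  by rewrite -[u]scale1r; apply: submodL.
- move=> a u /asboolP Su; apply/asboolP.
  by rewrite -[_ *: _]addr0; apply: submodL => //; apply: submod0.
Qed.

HB.instance Definition _ S :=
  GRing.isSubmodClosed.Build R V (submod_pred S) (submod_pred_closed S).

Definition submod_type (S : submod) : Type := {v : V | submod_pred S v}.

HB.instance Definition _ S := SubChoice.on (submod_type S).
HB.instance Definition _ S := [SubChoice_isSubLmodule of submod_type S by <:].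

End Submodules.

(* M (x)_k N : formal finite sums of pure tensors, i.e. finite lists of pairs,
   modulo the usual relations. *)
Section TensorProduct.
Variables (k : comPzRingType) (M N : lmodType k).
Implicit Types (m : M) (n : N) (s t : seq (M * N)).

Inductive tensor_rel : seq (M * N) -> seq (M * N) -> Prop :=
| tensor_refl s : tensor_rel s s
| tensor_sym s t : tensor_rel s t -> tensor_rel t s
| tensor_trans s t u : tensor_rel s t -> tensor_rel t u -> tensor_rel s u
| tensor_cat s s' t t' :
    tensor_rel s s' -> tensor_rel t t' -> tensor_rel (s ++ t) (s' ++ t')
| tensor_swap x y : tensor_rel [:: x; y] [:: y; x]
| tensor_zero n : tensor_rel [:: (0, n)] [::]
| tensor_addl m m' n : tensor_rel [:: (m + m', n)] [:: (m, n); (m', n)]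
| tensor_addr m n n' : tensor_rel [:: (m, n + n')] [:: (m, n); (m, n')]
| tensor_scale (a : k) m n : tensor_rel [:: (a *: m, n)] [:: (m, a *: n)].

Let relb s t := `[< tensor_rel s t >].

Fact tensor_relb_refl : reflexive relb.
Proof. by move=> s; apply/asboolP/tensor_refl. Qed.
Fact tensor_relb_sym : symmetric relb.
Proof. by move=> s t; apply/asboolP/asboolP => /tensor_sym. Qed.
Fact tensor_relb_trans : transitive relb.
Proof.
by move=> t s u /asboolP st /asboolP tu; apply/asboolP/(tensor_trans st tu).
Qed.

Canonical tensor_equiv :=
  EquivRel relb tensor_relb_refl tensor_relb_sym tensor_relb_trans.

Definition tensor : Type := {eq_quot tensor_equiv}.

HB.instance Definition _ := Choice.on tensor.

Definition tclass s : tensor := \pi_{eq_quot tensor_equiv} s.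
Definition trepr (x : tensor) : seq (M * N) :=
  repr (x : {eq_quot tensor_equiv}).
Definition pure m n : tensor := tclass [:: (m, n)].

Lemma treprK x : tclass (trepr x) = x.
Proof. exact: reprK. Qed.

Lemma tclassP s t : tclass s = tclass t <-> tensor_rel s t.
Proof.
split; first by move=> /eqmodP /asboolP.
by move=> st; apply/eqmodP/asboolP.
Qed.

Lemma tensor_catC s t : tensor_rel (s ++ t) (t ++ s).
Proof.
have sw x u : tensor_rel (x :: u) (u ++ [:: x]).
  elim: u => [|y u IH]; first exact: tensor_refl.
  apply: (@tensor_trans _ (y :: x :: u)).
    exact: (tensor_cat (tensor_swap x y) (tensor_refl u)).
  exact: (tensor_cat (tensor_refl [:: y]) IH).
elim: s t => [|x s IH] t; first by rewrite cats0; apply: tensor_refl.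
apply: (@tensor_trans _ ((s ++ t) ++ [:: x])); first exact: sw.
rewrite -catA; apply: (tensor_trans (IH _)); rewrite -catA /=.
exact: tensor_refl.
Qed.

Definition tensor_add (x y : tensor) : tensor := tclass (trepr x ++ trepr y).
Definition tensor_opp (x : tensor) : tensor :=
  tclass [seq (- p.1, p.2) | p <- trepr x].

Lemma tensor_addE s t : tensor_add (tclass s) (tclass t) = tclass (s ++ t).
Proof. by apply/tclassP/tensor_cat; apply/tclassP; rewrite treprK. Qed.

Fact tensor_addA : associative tensor_add.
Proof.
by move=> x y z; rewrite -[x]treprK -[y]treprK -[z]treprK !tensor_addE catA.
Qed.
Fact tensor_addC : commutative tensor_add.
Proof.
move=> x y; rewrite -[x]treprK -[y]treprK !tensor_addE.
exact/tclassP/tensor_catC.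
Qed.
Fact tensor_add0 : left_id (tclass [::]) tensor_add.
Proof. by move=> x; rewrite -[x]treprK tensor_addE. Qed.
Fact tensor_addN : left_inverse (tclass [::]) tensor_opp tensor_add.
Proof.
move=> x; rewrite -[X in tensor_add _ X]treprK /tensor_opp tensor_addE.
apply/tclassP; elim: (trepr x) => [|[m n] s IH] /=; first exact: tensor_refl.
set s' := map _ s in IH *.
apply: (@tensor_trans _ ([:: (- m, n); (m, n)] ++ s' ++ s)).
  rewrite /= -cat1s -[(m, n) :: s' ++ s]cat1s.
  apply: (tensor_cat (tensor_refl [:: (- m, n)])).
  rewrite -[(m, n) :: s]cat1s !catA.
  exact: (tensor_cat (tensor_catC _ _) (tensor_refl s)).
rewrite -[[::]]/([::] ++ [::]); apply: tensor_cat IH.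
apply: (tensor_trans (tensor_sym (tensor_addl _ _ _))).
by rewrite addNr; apply: tensor_zero.
Qed.

HB.instance Definition _ := GRing.isZmodule.Build tensor
  tensor_addA tensor_addC tensor_add0 tensor_addN.

Lemma tclass_cat s t : tclass (s ++ t) = tclass s + tclass t.
Proof. by rewrite -tensor_addE. Qed.

Lemma tclass_sum s : tclass s = \sum_(p <- s) pure p.1 p.2.
Proof.
elim: s => [|[m n] s IH]; first by rewrite big_nil.
by rewrite big_cons -IH -cat1s tclass_cat.
Qed.

Lemma pureDl m m' n : pure (m + m') n = pure m n + pure m' n.
Proof. by rewrite -tclass_cat; apply/tclassP/tensor_addl. Qed.
Lemma pureDr m n n' : pure m (n + n') = pure m n + pure m n'.
Proof. by rewrite -tclass_cat; apply/tclassP/tensor_addr. Qed.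
Lemma pureZ a m n : pure (a *: m) n = pure m (a *: n).
Proof. exact/tclassP/tensor_scale. Qed.

Lemma tensor_ind (P : tensor -> Prop) :
  P 0 -> (forall m n x, P x -> P (pure m n + x)) -> forall x, P x.
Proof.
move=> P0 PS x; rewrite -[x]treprK tclass_sum.
by elim: (trepr x) => [|p s IH]; rewrite ?big_nil ?big_cons //; apply: PS.
Qed.

Record balanced (G : zmodType) (h : M -> N -> G) : Prop := Balanced {
  balDl : forall m m' n, h (m + m') n = h m n + h m' n;
  balDr : forall m n n', h m (n + n') = h m n + h m n';
  balZ : forall a m n, h (a *: m) n = h m (a *: n) }.

Lemma pure_balanced : balanced pure.
Proof. by split; [exact: pureDl | exact: pureDr | exact: pureZ]. Qed.

Definition tlift (G : zmodType) (h : M -> N -> G) (x : tensor) : G :=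
  \sum_(p <- trepr x) h p.1 p.2.

Section Lift.
Variables (G : zmodType) (h : M -> N -> G) (hb : balanced h).

Lemma tlift_tclass s : tlift h (tclass s) = \sum_(p <- s) h p.1 p.2.
Proof.
suff H s1 s2 : tensor_rel s1 s2 ->
    \sum_(p <- s1) h p.1 p.2 = \sum_(p <- s2) h p.1 p.2.
  by apply: H; apply/tclassP; rewrite treprK.
elim=> {s s1 s2}.
- by [].
- by move=> s t _ ->.
- by move=> s t u _ -> _ ->.
- by move=> s s' t t' _ e1 _ e2; rewrite !big_cat /= e1 e2.
- by move=> x y; rewrite !big_cons big_nil !addr0 addrC.
- move=> n; rewrite big_cons !big_nil addr0 /=.
  by apply: (addrI (h 0 n)); rewrite -(balDl hb) !addr0.
- by move=> m m' n; rewrite !big_cons big_nil !addr0 (balDl hb).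
- by move=> m n n'; rewrite !big_cons big_nil !addr0 (balDr hb).
- by move=> a m n; rewrite !big_cons big_nil !addr0 (balZ hb).
Qed.

Lemma tlift_pure m n : tlift h (pure m n) = h m n.
Proof. by rewrite tlift_tclass big_seq1. Qed.

Lemma tlift0 : tlift h 0 = 0.
Proof. by rewrite [0]/(tclass [::]) tlift_tclass big_nil. Qed.

Lemma tliftD : {morph tlift h : x y / x + y}.
Proof.
move=> x y; rewrite -[x]treprK -[y]treprK -tclass_cat !tlift_tclass.
by rewrite big_cat.
Qed.

End Lift.

End TensorProduct.

Section TensorMap.
Variables (k : comPzRingType) (M N M' N' : lmodType k).
Variables (f : {linear M -> M'}) (g : {linear N -> N'}).

Definition tmap : tensor M N -> tensor M' N' :=
  tlift (fun m n => pure (f m) (g n)).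

Lemma tmap_balanced : balanced (fun m n => pure (f m) (g n)).
Proof.
split=> [m m' n|m n n'|a m n].
- by rewrite linearD pureDl.
- by rewrite linearD pureDr.
- by rewrite !linearZ pureZ.
Qed.

End TensorMap.

(* S (x)_R - preserves injections. *)
Definition flat (R S : comPzRingType) (f : {rmorphism R -> S}) : Prop :=
  forall (A B : lmodType R) (u : {linear A -> B}), injective u ->
    injective (@tmap R (rscal f S^o) A (rscal f S^o) B idfun u).

(* A (x)_k B as a ring, for k-algebras f : k -> A and g : k -> B. *)
Section TensorRing.
Variables (k A B : comPzRingType).

Definition tring (f : {rmorphism k -> A}) (g : {rmorphism k -> B}) : Type :=
  tensor (rscal f A^o) (rscal g B^o).

Variables (f : {rmorphism k -> A}) (g : {rmorphism k -> B}).
Notation T := (tring f g).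
HB.instance Definition _ := GRing.Zmodule.on T.

Definition tpure (a : A) (b : B) : T :=
  @pure k (rscal f A^o) (rscal g B^o) a b.

Lemma tpureDl a a' b : tpure (a + a') b = tpure a b + tpure a' b.
Proof. exact: pureDl. Qed.
Lemma tpureDr a b b' : tpure a (b + b') = tpure a b + tpure a b'.
Proof. exact: pureDr. Qed.
Lemma tpureZ c a b : tpure (f c * a) b = tpure a (g c * b).
Proof. exact: (@pureZ k (rscal f A^o) (rscal g B^o) c a b). Qed.

Lemma tring_ind (P : T -> Prop) :
  P 0 -> (forall a b x, P x -> P (tpure a b + x)) -> forall x, P x.
Proof.
by move=> P0 PS; apply: (@tensor_ind k (rscal f A^o) (rscal g B^o) P P0 PS).
Qed.

Let mulp (a : A) (b : B) (y : T) : T :=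
  @tlift k (rscal f A^o) (rscal g B^o) T
    (fun a' b' => tpure (a * a') (b * b')) y.

Let mulp_bal a b : @balanced k (rscal f A^o) (rscal g B^o) T
  (fun a' b' => tpure (a * a') (b * b')).
Proof.
split=> [m m' n|m n n'|c m n].
- by rewrite -tpureDl -mulrDr.
- by rewrite -tpureDr -mulrDr.
- rewrite !rscalE.
  rewrite -[RHS]/(tpure (a * m) (b * (g c * n))).
  rewrite -[LHS]/(tpure (a * (f c * m)) (b * n)).
  by rewrite [a * _]mulrCA [b * (g c * n)]mulrCA tpureZ.
Qed.

Let mulpD a b : {morph mulp a b : x y / x + y}.
Proof. exact: (tliftD (mulp_bal a b)). Qed.
Let mulp0 a b : mulp a b 0 = 0.
Proof. exact: (tlift0 (mulp_bal a b)). Qed.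
Let mulp_pure a b a' b' : mulp a b (tpure a' b') = tpure (a * a') (b * b').
Proof. exact: (tlift_pure (mulp_bal a b)). Qed.

Definition tring_mul (x y : T) : T :=
  @tlift k (rscal f A^o) (rscal g B^o) T (fun a b => mulp a b y) x.

Let mul_bal y : @balanced k (rscal f A^o) (rscal g B^o) T
  (fun a b => mulp a b y).
Proof.
split=> [m m' n|m n n'|c m n]; elim/tring_ind: y => [|a b y IH].
- by rewrite !mulp0 addr0.
- rewrite !mulpD IH !mulp_pure addrACA -tpureDl -mulrDl //.
- by rewrite !mulp0 addr0.
- by rewrite !mulpD IH !mulp_pure addrACA -tpureDr -mulrDl.
- by rewrite !mulp0.
- rewrite !mulpD IH !mulp_pure; congr (_ + _).
  rewrite -[LHS]/(tpure (f c * m * a) (n * b)).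
  rewrite -[RHS]/(tpure (m * a) (g c * n * b)).
  by rewrite -!mulrA tpureZ.
Qed.

Let mulDl : left_distributive tring_mul +%R.
Proof. by move=> x y z; apply: (tliftD (mul_bal z)). Qed.
Let mul0 y : tring_mul 0 y = 0.
Proof. exact: (tlift0 (mul_bal y)). Qed.
Let mul_pureE a b y : tring_mul (tpure a b) y = mulp a b y.
Proof. exact: (tlift_pure (mul_bal y)). Qed.

Lemma tring_mul_pure a b a' b' :
  tring_mul (tpure a b) (tpure a' b') = tpure (a * a') (b * b').
Proof. by rewrite mul_pureE mulp_pure. Qed.

Let mulDr : right_distributive tring_mul +%R.
Proof.
move=> x y z; elim/tring_ind: x => [|a b x IH]; first by rewrite !mul0 addr0.
by rewrite !mulDl IH !mul_pureE mulpD addrACA.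
Qed.
Let mulr0' x : tring_mul x 0 = 0.
Proof.
elim/tring_ind: x => [|a b x IH]; first by rewrite mul0.
by rewrite mulDl IH mul_pureE mulp0 addr0.
Qed.

Fact tring_mulC : commutative tring_mul.
Proof.
move=> x y; elim/tring_ind: x => [|a b x IH]; first by rewrite mul0 mulr0'.
rewrite mulDl mulDr IH; congr (_ + _).
elim/tring_ind: y {IH} => [|a' b' y IH]; first by rewrite mul0 mulr0'.
by rewrite mulDl mulDr IH !tring_mul_pure [a * _]mulrC [b * _]mulrC.
Qed.

Fact tring_mulA : associative tring_mul.
Proof.
move=> x y z; elim/tring_ind: x => [|a b x IH]; first by rewrite !mul0.
rewrite !mulDl IH; congr (_ + _).
elim/tring_ind: y {IH} => [|a' b' y IH]; first by rewrite mul0 !mulr0' mul0.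
rewrite !mulDl !mulDr mulDl IH; congr (_ + _).
elim/tring_ind: z {IH} => [|a2 b2 z IH]; first by rewrite !mulr0'.
by rewrite !mulDr IH !tring_mul_pure !mulrA.
Qed.

Fact tring_mul1 : left_id (tpure 1 1) tring_mul.
Proof.
move=> x; elim/tring_ind: x => [|a b x IH]; first by rewrite mulr0'.
by rewrite mulDr IH tring_mul_pure !mul1r.
Qed.

HB.instance Definition _ := GRing.Zmodule_isComPzRing.Build T
  tring_mulA tring_mulC tring_mul1 mulDl.

Lemma tpureM a b a' b' : tpure a b * tpure a' b' = tpure (a * a') (b * b').
Proof. exact: tring_mul_pure. Qed.

(* The ring morphism out of A (x)_k B given by two k-algebra morphisms. *)
Section Pairing.
Variables (C : comPzRingType).
Variables (u : {rmorphism A -> C}) (v : {rmorphism B -> C}).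

Definition tpairing (uv : forall c, u (f c) = v (g c)) (x : T) : C :=
  @tlift k (rscal f A^o) (rscal g B^o) C (fun a b => u a * v b) x.

Hypothesis uv : forall c, u (f c) = v (g c).

Let pairing_bal : @balanced k (rscal f A^o) (rscal g B^o) C
  (fun a b => u a * v b).
Proof.
split=> [m m' n|m n n'|c m n].
- by rewrite rmorphD mulrDl.
- by rewrite rmorphD mulrDr.
- by rewrite !rscalE !rmorphM /= uv mulrCA mulrA.
Qed.

Lemma tpairing_pure a b : tpairing uv (tpure a b) = u a * v b.
Proof. exact: (tlift_pure pairing_bal). Qed.

Let pairD : {morph tpairing uv : x y / x + y}.
Proof. exact: (tliftD pairing_bal). Qed.
Let pair0 : tpairing uv 0 = 0.
Proof. exact: (tlift0 pairing_bal). Qed.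

Fact tpairing_zmod : zmod_morphism (tpairing uv).
Proof.
by move=> x y; apply: (addIr (tpairing uv y)); rewrite -pairD !subrK.
Qed.

Fact tpairing_monoid : monoid_morphism (tpairing uv).
Proof.
split=> [|x y]; first by rewrite tpairing_pure !rmorph1 mulr1.
elim/tring_ind: x => [|a b x IH]; first by rewrite mul0r pair0 mul0r.
rewrite mulrDl !pairD IH mulrDl; congr (_ + _).
elim/tring_ind: y {IH} => [|a' b' y IH]; first by rewrite mulr0 pair0 mulr0.
rewrite mulrDr !pairD IH mulrDr tpureM !tpairing_pure !rmorphM /=.
by rewrite mulrACA.
Qed.

HB.instance Definition _ :=
  GRing.isZmodMorphism.Build T C (tpairing uv) tpairing_zmod.
HB.instance Definition _ :=
  GRing.isMonoidMorphism.Build T C (tpairing uv) tpairing_monoid.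

End Pairing.

Fact tinl_zmod : zmod_morphism (tpure^~ 1).
Proof.
by move=> a a'; apply: (addIr (tpure a' 1)); rewrite -tpureDl !subrK.
Qed.
Fact tinl_monoid : monoid_morphism (tpure^~ 1).
Proof. by split=> // a a'; rewrite tpureM mulr1. Qed.

Definition tinl (a : A) : T := tpure a 1.
HB.instance Definition _ := GRing.isZmodMorphism.Build A T tinl tinl_zmod.
HB.instance Definition _ := GRing.isMonoidMorphism.Build A T tinl tinl_monoid.

Fact tinr_zmod : zmod_morphism (tpure 1).
Proof.
by move=> b b'; apply: (addIr (tpure 1 b')); rewrite -tpureDr !subrK.
Qed.
Fact tinr_monoid : monoid_morphism (tpure 1).
Proof. by split=> // b b'; rewrite tpureM mulr1. Qed.

Definition tinr (b : B) : T := tpure 1 b.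
HB.instance Definition _ := GRing.isZmodMorphism.Build B T tinr tinr_zmod.
HB.instance Definition _ := GRing.isMonoidMorphism.Build B T tinr tinr_monoid.

Lemma tinl_tinr c : tinl (f c) = tinr (g c).
Proof. by rewrite /tinl -[f c]mulr1 tpureZ mulr1. Qed.

End TensorRing.

Section OpenSets.
Variable X : topologicalType.

Structure opn := Opn { oset :> set X; oset_open : open oset }.

Definition opnT : opn := Opn openT.

(* U_x, the smallest open set containing x when X is finite. *)
Definition umin_set (x : X) : set X :=
  \bigcap_(U in [set U | open U /\ U x]) U.

Lemma umin_set_refl x : umin_set x x.
Proof. by move=> U []. Qed.

Lemma umin_set_sub x (U : set X) : open U -> U x -> umin_set x `<=` U.
Proof. by move=> oU Ux y; apply. Qed.

Lemma umin_set_open x : finite_set [set: X] -> open (umin_set x).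
Proof.
move=> finX; rewrite openE => y xy.
have [E XE] := finite_fsetP.1 finX.
pose P z := [set w : X | ~ umin_set x z -> w <> z].
have : nbhs y (\bigcap_(z in [set` E]) P z).
  apply: filter_bigI => z _.
  have [xz|/existsNP[U /not_implyP[[oU Ux] nUz]]] := pselect (umin_set x z).
    by apply: nearW => w.
  have Uy : nbhs y U by apply: open_nbhs_nbhs; split=> //; apply: xy.
  by apply: filterS Uy => w Uw _ wz; apply: nUz; rewrite -wz.
rewrite -XE; apply: filterS => w Pw; apply: contrapT => nw.
exact: (Pw w I nw).
Qed.

Definition umin (finX : finite_set [set: X]) (x : X) : opn :=
  Opn (umin_set_open x finX).

(* x <= y iff y lies in U_x. *)
Definition spec_le (x y : X) : Prop := umin_set x y.

Lemma spec_le_umin finX x y (xy : spec_le x y) : umin finX y `<=` umin finX x.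
Proof. by apply: umin_set_sub => //; apply: umin_set_open. Qed.

End OpenSets.
Arguments spec_le_umin {X} finX {x y} xy.

Definition opreim (X Y : topologicalType) (f : X -> Y) (fc : continuous f)
    (V : opn Y) : opn X :=
  Opn ((continuousP f).1 fc V (oset_open V)).

Section OpenSubspace.
Variables (X : topologicalType) (U : opn X).

Lemma oimg_open (V : opn (set_type U)) : open (set_val @` V).
Proof.
have [W oW WV] : exists2 W : set X, open W & set_val @^-1` W = V.
  exact: oset_open V.
have -> : set_val @` V = W `&` U.
  rewrite -WV; apply/seteqP; split=> [_ [[x xU] Wx <-]|x [Wx Ux]].
    by split=> //; apply: (set_mem xU).
  by exists (SigSub (mem_set Ux)).
exact: openI oW (oset_open U).
Qed.

(* An open set of the subspace U, seen as an open set of X. *)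
Definition oimg (V : opn (set_type U)) : opn X := Opn (oimg_open V).

Lemma oimgS (V W : opn (set_type U)) : V `<=` W -> oimg V `<=` oimg W.
Proof. exact: image_subset. Qed.

Lemma set_val_continuous : continuous (set_val : set_type U -> X).
Proof. exact: initial_continuous. Qed.

Lemma oimg_opreim (V : opn X) : oimg (opreim set_val_continuous V) `<=` V.
Proof. by move=> _ [x Vx <-]. Qed.

End OpenSubspace.

Record ringSheaf (X : topologicalType) := RingSheaf {
  rsec :> opn X -> comPzRingType;
  rres : forall U V : opn X, V `<=` U -> {rmorphism rsec U -> rsec V};
  rres_id : forall (U : opn X) (h : U `<=` U) s, rres h s = s;
  rres_comp : forall (U V W : opn X) (hV : V `<=` U) (hW : W `<=` V)
    (hWU : W `<=` U) s, rres hW (rres hV s) = rres hWU s;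
  rglue : forall (U : opn X) (I : Type) (V : I -> opn X)
    (hV : forall i, V i `<=` U), U `<=` \bigcup_i V i ->
    forall s : (forall i, rsec (V i)),
    (forall i j (W : opn X) (hi : W `<=` V i) (hj : W `<=` V j),
       rres hi (s i) = rres hj (s j)) ->
    exists! t : rsec U, forall i, rres (hV i) t = s i }.

Arguments rres {X r U V} h.
Arguments rres_id {X r U} h s.
Arguments rres_comp {X r U V W} hV hW hWU s.

Record modSheaf (X : topologicalType) (O : ringSheaf X) := ModSheaf {
  msec :> forall U : opn X, lmodType (O U);
  mres : forall U V : opn X, V `<=` U -> msec U -> msec V;
  mresL : forall (U V : opn X) (h : V `<=` U) (a : O U) s t,
    mres h (a *: s + t) = rres h a *: mres h s + mres h t;
  mres_id : forall (U : opn X) (h : U `<=` U) s, mres h s = s;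
  mres_comp : forall (U V W : opn X) (hV : V `<=` U) (hW : W `<=` V)
    (hWU : W `<=` U) s, mres hW (mres hV s) = mres hWU s;
  mglue : forall (U : opn X) (I : Type) (V : I -> opn X)
    (hV : forall i, V i `<=` U), U `<=` \bigcup_i V i ->
    forall s : (forall i, msec (V i)),
    (forall i j (W : opn X) (hi : W `<=` V i) (hj : W `<=` V j),
       mres hi (s i) = mres hj (s j)) ->
    exists! t : msec U, forall i, mres (hV i) t = s i }.

Arguments mres {X O m U V} h s.
Arguments mresL {X O m U V} h a s t.
Arguments mres_id {X O m U} h s.
Arguments mres_comp {X O m U V W} hV hW hWU s.

Section RingSheafTheory.
Variables (X : topologicalType) (O : ringSheaf X).

Lemma rsep (U : opn X) (I : Type) (V : I -> opn X)
    (hV : forall i, V i `<=` U) (t t' : O U) :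
  U `<=` \bigcup_i V i ->
  (forall i, rres (hV i) t = rres (hV i) t') -> t = t'.
Proof.
move=> cov tt'.
have [i j W hi hj|t0 [_ uniq]] := @rglue X O U I V hV cov
    (fun i => rres (hV i) t).
  by rewrite !(rres_comp _ _ (subset_trans hi (hV i))).
by rewrite -(uniq t) // -(uniq t') // => i; rewrite tt'.
Qed.

Lemma rres_compE (U V V' W : opn X) (hV : V `<=` U) (hW : W `<=` V)
    (hV' : V' `<=` U) (hW' : W `<=` V') (s : O U) :
  rres hW (rres hV s) = rres hW' (rres hV' s).
Proof. by rewrite !(rres_comp _ _ (subset_trans hW hV)). Qed.

End RingSheafTheory.

Section ModSheafTheory.
Variables (X : topologicalType) (O : ringSheaf X) (M : modSheaf O).

Lemma mresD (U V : opn X) (h : V `<=` U) (s t : M U) :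
  mres h (s + t) = mres h s + mres h t.
Proof. by have := mresL h 1 s t; rewrite rmorph1 !scale1r. Qed.

Lemma mres0 (U V : opn X) (h : V `<=` U) : mres h (0 : M U) = 0.
Proof. by apply: (addrI (mres h (0 : M U))); rewrite -mresD !addr0. Qed.

Lemma mresZ (U V : opn X) (h : V `<=` U) a (s : M U) :
  mres h (a *: s) = rres h a *: mres h s.
Proof. by have := mresL h a s 0; rewrite mres0 !addr0. Qed.

Lemma msep (U : opn X) (I : Type) (V : I -> opn X)
    (hV : forall i, V i `<=` U) (t t' : M U) :
  U `<=` \bigcup_i V i ->
  (forall i, mres (hV i) t = mres (hV i) t') -> t = t'.
Proof.
move=> cov tt'.
have [i j W hi hj|t0 [_ uniq]] := @mglue X O M U I V hV cov
    (fun i => mres (hV i) t).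
  by rewrite !(mres_comp _ _ (subset_trans hi (hV i))).
by rewrite -(uniq t) // -(uniq t') // => i; rewrite tt'.
Qed.

End ModSheafTheory.

Section ModMorphisms.
Variables (X : topologicalType) (O : ringSheaf X).

Record modHom (M N : modSheaf O) := ModHom {
  hom :> forall U : opn X, M U -> N U;
  homL : forall U, linear (@hom U);
  hom_res : forall (U V : opn X) (h : V `<=` U) s,
    @hom V (mres h s) = mres h (@hom U s) }.
Arguments hom {M N} m U s.
Arguments homL {M N} m U a x y : rename.
Arguments hom_res {M N} m {U V} h s.

Definition mod_iso (M N : modSheaf O) : Prop :=
  exists (f : modHom M N) (g : modHom N M),
    (forall U, cancel (f U) (g U)) /\ (forall U, cancel (g U) (f U)).

Definition mod_mono (M N : modSheaf O) (f : modHom M N) : Prop :=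
  forall U, injective (f U).

Definition locally_in (M : modSheaf O) (P : forall U : opn X, set (M U))
    (U : opn X) (s : M U) : Prop :=
  forall x, oset U x -> exists (V : opn X) (h : V `<=` U), oset V x /\ P V (mres h s).

Definition mod_epi (M N : modSheaf O) (f : modHom M N) : Prop :=
  forall U (s : N U), locally_in (fun V => range (f V)) s.

(* ker g = im f as subsheaves of M. *)
Definition exact_at (L M N : modSheaf O) (f : modHom L M) (g : modHom M N) :
    Prop :=
  forall U (s : M U), g U s = 0 <-> locally_in (fun V => range (f V)) s.

Definition mod_injective (E : modSheaf O) : Prop :=
  forall (A B : modSheaf O) (i : modHom A B) (g : modHom A E), mod_mono i ->
    exists h : modHom B E, forall U s, h U (i U s) = g U s.

Record injective_resolution (M : modSheaf O) := InjectiveResolution {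
  ires :> nat -> modSheaf O;
  ires_d : forall n, modHom (ires n) (ires n.+1);
  ires_aug : modHom M (ires 0%N);
  ires_inj : forall n, mod_injective (ires n);
  ires_mono : mod_mono ires_aug;
  ires_exact0 : exact_at ires_aug (ires_d 0%N);
  ires_exact : forall n, exact_at (ires_d n) (ires_d n.+1) }.

Lemma hom0 (M N : modSheaf O) (f : modHom M N) U : f U 0 = 0.
Proof.
have := homL f U 1 0 0; rewrite !scale1r !addr0 => f00.
by apply: (addrI (f U 0)); rewrite addr0 -f00.
Qed.

Section Kernel.
Variables (M N : modSheaf O) (f : modHom M N).

Fact ker_submod0 U : [set s : M U | f U s = 0] 0.
Proof. exact: hom0. Qed.
Fact ker_submodL U (a : O U) (u v : M U) :
  f U u = 0 -> f U v = 0 -> f U (a *: u + v) = 0.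
Proof. by move=> fu fv; rewrite homL fu fv scaler0 addr0. Qed.

Definition ker_submod U : submod (M U) := Submod (@ker_submod0 U) (@ker_submodL U).

Lemma ker_secP U (s : submod_type (ker_submod U)) : f U (val s) = 0.
Proof. exact/asboolP/(valP s). Qed.

Definition ker_sec U (s : M U) (fs : f U s = 0) : submod_type (ker_submod U) :=
  exist _ s (asboolT fs).

Fact ker_res_subproof (U V : opn X) (h : V `<=` U) (s : submod_type (ker_submod U)) :
  f V (mres h (val s)) = 0.
Proof. by rewrite hom_res ker_secP mres0. Qed.

Definition ker_res (U V : opn X) (h : V `<=` U) (s : submod_type (ker_submod U)) :
  submod_type (ker_submod V) := ker_sec (ker_res_subproof h s).

Fact ker_resL (U V : opn X) (h : V `<=` U) (a : O U) s t :
  ker_res h (a *: s + t) = rres h a *: ker_res h s + ker_res h t.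
Proof. by apply: val_inj; rewrite /= mresL. Qed.
Fact ker_res_id (U : opn X) (h : U `<=` U) s : ker_res h s = s.
Proof. by apply: val_inj; rewrite /= mres_id. Qed.
Fact ker_res_comp (U V W : opn X) (hV : V `<=` U) (hW : W `<=` V) (hWU : W `<=` U) s :
  ker_res hW (ker_res hV s) = ker_res hWU s.
Proof. by apply: val_inj; rewrite /= (mres_comp _ _ hWU). Qed.
Fact ker_glue (U : opn X) (I : Type) (V : I -> opn X)
    (hV : forall i, V i `<=` U) : U `<=` \bigcup_i V i ->
    forall s : (forall i, submod_type (ker_submod (V i))),
    (forall i j (W : opn X) (hi : W `<=` V i) (hj : W `<=` V j),
       ker_res hi (s i) = ker_res hj (s j)) ->
    exists! t : submod_type (ker_submod U), forall i, ker_res (hV i) t = s i.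
Proof.
move=> cov s sc.
have [i j W hi hj|t [tE tU]] := @mglue X O M U I V hV cov (fun i => val (s i)).
  by have /(congr1 val) := sc i j W hi hj.
have ft : f U t = 0.
  by apply: (msep (hV := hV) cov) => i; rewrite -hom_res tE ker_secP mres0.
exists (ker_sec ft); split=> [i|t' t'E]; apply: val_inj => //=.
by apply: tU => i; rewrite -t'E.
Qed.

Definition ker_sheaf : modSheaf O :=
  ModSheaf ker_resL ker_res_id ker_res_comp ker_glue.

End Kernel.

(* H is (a copy of) the i-th cohomology sheaf of K^0 -> K^1 -> ..., i.e. the
   quotient sheaf of ker d^i by the image of d^(i-1) (by 0 if i = 0): p is an
   epimorphism whose kernel consists of the local coboundaries. *)
Definition coboundaries (K : nat -> modSheaf O)
    (d : forall n, modHom (K n) (K n.+1)) (i : nat) : forall U, set (K i U) :=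
  match i with
  | 0 => fun U => [set 0]
  | n.+1 => fun U => range (d n U)
  end.
Arguments coboundaries {K} d i U.

Definition is_cohomology_sheaf (K : nat -> modSheaf O)
    (d : forall n, modHom (K n) (K n.+1)) (i : nat) (H : modSheaf O) : Prop :=
  exists p : modHom (ker_sheaf (d i)) H, mod_epi p /\
    forall U (z : ker_sheaf (d i) U),
      p U z = 0 <-> locally_in (coboundaries d i) (val z).

End ModMorphisms.
Arguments hom {X O M N} m U s.
Arguments homL {X O M N} m U a x y : rename.
Arguments hom_res {X O M N} m {U V} h s.
Arguments coboundaries {X O K} d i U.

(* The structure sheaf as a module, and the free module O^(I) = direct sum of
   I copies of O, whose sections are the locally finite families of sections
   of O. *)
Section FreeModules.
Variables (X : topologicalType) (O : ringSheaf X).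

Definition struct_mod : modSheaf O.
Proof.
apply: (@ModSheaf X O (fun U => (O U)^o : lmodType (O U))
  (fun U V h => rres h)).
- by move=> U V h a s t; rewrite rmorphD rmorphM.
- by move=> U h s; apply: (rres_id h s).
- by move=> U V W hV hW hWU s; apply: (rres_comp hV hW hWU s).
- by move=> U J V hV; apply: (@rglue X O U J V hV).
Defined.

Variable I : Type.

Definition locally_finite (U : opn X) : set (I -> (O U)^o) :=
  [set s | forall x, oset U x -> exists (V : opn X) (h : V `<=` U),
    oset V x /\ finite_set [set i | rres h (s i) <> 0]].

Fact free_submod0 U : @locally_finite U 0.
Proof.
move=> x Ux; exists U, (@subset_refl _ U); split=> //.
rewrite (_ : [set _ | _] = set0) //.
by apply/seteqP; split=> i //=; rewrite rmorph0.
Qed.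

Fact free_submodL U (a : O U) (u v : I -> (O U)^o) :
  locally_finite u -> locally_finite v -> locally_finite (a *: u + v).
Proof.
move=> fu fv x Ux.
have [V [hV [Vx Vf]]] := fu x Ux; have [W [hW [Wx Wf]]] := fv x Ux.
pose VW := Opn (openI (oset_open V) (oset_open W)).
have hVW : VW `<=` U by move=> y [/hV].
have h1 : VW `<=` V by move=> y [].
have h2 : VW `<=` W by move=> y [].
exists VW, hVW; split; first by split.
apply: (@sub_finite_set _ _
  ([set i | rres hV (u i) <> 0] `|` [set i | rres hW (v i) <> 0])); last first.
  by rewrite finite_setU.
move=> i /=; apply: contra_notP => /not_orP[/contrapT u0 /contrapT v0].
rewrite -[(a *: u + v) i]/(a * u i + v i) rmorphD rmorphM.
rewrite -(rres_comp hV h1 hVW (u i)) -(rres_comp hW h2 hVW (v i)).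
by rewrite u0 v0 !rmorph0 mulr0 addr0.
Qed.

Definition free_submod U := Submod (@free_submod0 U) (@free_submodL U).

Notation fsec U := (submod_type (free_submod U)).

Lemma free_secP U (s : fsec U) : locally_finite (val s).
Proof. exact/asboolP/(valP s). Qed.

Definition free_sec U (s : I -> (O U)^o) (fs : locally_finite s) : fsec U :=
  exist _ s (asboolT fs).

Fact free_res_subproof (U V : opn X) (h : V `<=` U) (s : fsec U) :
  @locally_finite V (fun i => rres h (val s i)).
Proof.
move=> x Vx; have [W [hW [Wx Wf]]] := free_secP s (h x Vx).
pose VW := Opn (openI (oset_open V) (oset_open W)).
have h1 : VW `<=` V by move=> y [].
have h2 : VW `<=` W by move=> y [].
exists VW, h1; split; first by split.
apply: sub_finite_set Wf => i /=; apply: contra_not => s0.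
by rewrite (rres_compE _ _ hW h2) s0 rmorph0.
Qed.

Definition free_res (U V : opn X) (h : V `<=` U) (s : fsec U) : fsec V :=
  free_sec (free_res_subproof h s).

Fact free_resL (U V : opn X) (h : V `<=` U) (a : O U) s t :
  free_res h (a *: s + t) = rres h a *: free_res h s + free_res h t.
Proof.
by apply: val_inj; apply/funext => i /=; rewrite rmorphD rmorphM.
Qed.
Fact free_res_id (U : opn X) (h : U `<=` U) s : free_res h s = s.
Proof. by apply: val_inj; apply/funext => i /=; rewrite rres_id. Qed.
Fact free_res_comp (U V W : opn X) (hV : V `<=` U) (hW : W `<=` V) (hWU : W `<=` U) s :
  free_res hW (free_res hV s) = free_res hWU s.
Proof.
by apply: val_inj; apply/funext => i /=; rewrite (rres_comp _ _ hWU).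
Qed.
Fact free_glue (U : opn X) (J : Type) (V : J -> opn X)
    (hV : forall j, V j `<=` U) : U `<=` \bigcup_j V j ->
    forall s : (forall j, fsec (V j)),
    (forall i j (W : opn X) (hi : W `<=` V i) (hj : W `<=` V j),
       free_res hi (s i) = free_res hj (s j)) ->
    exists! t : fsec U, forall j, free_res (hV j) t = s j.
Proof.
move=> cov s sc.
have /choice[t tP] : forall i, exists t : O U,
    (forall j, rres (hV j) t = val (s j) i) /\
    forall t' : O U, (forall j, rres (hV j) t' = val (s j) i) -> t = t'.
  move=> i; have [j j' W hj hj'|t [tE tU]] := @rglue X O U J V hV cov
      (fun j => val (s j) i); last by exists t.
  by have /(congr1 val)/(congr1 (@^~ i)) := sc j j' W hj hj'.
have ft : locally_finite (t : I -> (O U)^o).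
  move=> x Ux; have [j _ Vx] := cov x Ux.
  have [W [hW [Wx Wf]]] := free_secP (s j) Vx.
  exists W, (subset_trans hW (hV j)); split=> //.
  apply: sub_finite_set Wf => i /=; apply: contra_not.
  by rewrite -(tP i).1 (rres_comp _ _ (subset_trans hW (hV j))).
exists (free_sec ft); split=> [j|t' t'E]; apply: val_inj; apply/funext => i /=.
  exact: (tP i).1.
by apply: (tP i).2 => j; rewrite -t'E.
Qed.

Definition free_mod : modSheaf O :=
  ModSheaf free_resL free_res_id free_res_comp free_glue.

End FreeModules.

Section Restriction.
Variables (X : topologicalType) (O : ringSheaf X) (U : opn X).

Fact oimg_cover (V : opn (set_type U)) (I : Type)
    (W : I -> opn (set_type U)) :
  V `<=` \bigcup_i W i -> oimg V `<=` \bigcup_i oimg (W i).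
Proof.
by move=> cov _ [y Vy <-]; have [i _ Wy] := cov y Vy; exists i => //; exists y.
Qed.

(* Every open set W contained in U is the image of an open set of U. *)
Definition ores (W : opn X) : opn (set_type U) :=
  opreim (@set_val_continuous X U) W.

Fact oimg_ores (W : opn X) : W `<=` U -> oimg (ores W) = W :> set X.
Proof.
move=> WU; apply/seteqP; split=> [|x Wx]; first exact: oimg_opreim.
by exists (SigSub (mem_set (WU _ Wx))).
Qed.

Fact ores_sub (W : opn X) (V : opn (set_type U)) :
  W `<=` oimg V -> ores W `<=` V.
Proof.
move=> WV y /= /WV[z Vz zy]; suff <- : z = y by [].
exact: val_inj.
Qed.

Definition restr_ring : ringSheaf (set_type U).
Proof.
apply: (@RingSheaf _ (fun V => O (oimg V)) (fun V W h => rres (oimgS h))).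
- by move=> V h s; apply: rres_id.
- by move=> V W Z hW hZ hZV s; apply: rres_comp.
- move=> V I W hW cov s sc.
  apply: (@rglue X O (oimg V) I (fun i => oimg (W i))
    (fun i => oimgS (hW i)) (oimg_cover cov)) => i j Z hi hj.
  have ZU : Z `<=` U by move=> x /hi[y _ <-]; apply: (set_mem (valP y)).
  have ZE := oimg_ores ZU.
  have hZ : Z `<=` oimg (ores Z) by rewrite ZE.
  have := sc i j (ores Z) (ores_sub hi) (ores_sub hj).
  by move/(congr1 (rres hZ)); rewrite !(rres_comp _ _ hi) !(rres_comp _ _ hj).
Defined.

Definition restr_mod (M : modSheaf O) : modSheaf restr_ring.
Proof.
apply: (@ModSheaf _ restr_ring (fun V => M (oimg V))
  (fun V W h => mres (oimgS h))).
- by move=> V W h a s t; apply: mresL.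
- by move=> V h s; apply: mres_id.
- by move=> V W Z hW hZ hZV s; apply: mres_comp.
- move=> V I W hW cov s sc.
  apply: (@mglue X O M (oimg V) I (fun i => oimg (W i))
    (fun i => oimgS (hW i)) (oimg_cover cov)) => i j Z hi hj.
  have ZU : Z `<=` U by move=> x /hi[y _ <-]; apply: (set_mem (valP y)).
  have ZE := oimg_ores ZU.
  have hZ : Z `<=` oimg (ores Z) by rewrite ZE.
  have := sc i j (ores Z) (ores_sub hi) (ores_sub hj).
  by move/(congr1 (mres hZ)); rewrite !(mres_comp _ _ hi) !(mres_comp _ _ hj).
Defined.

End Restriction.

Definition quasi_coherent (X : topologicalType) (O : ringSheaf X)
    (M : modSheaf O) : Prop :=
  forall x : X, exists U : opn X, oset U x /\
    exists (I J : Type)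
      (phi : modHom (free_mod (restr_ring O U) J) (free_mod (restr_ring O U) I))
      (pi : modHom (free_mod (restr_ring O U) I) (restr_mod U M)),
      exact_at phi pi /\ mod_epi pi.

Record ringedMorphism (X Y : topologicalType) (OX : ringSheaf X)
    (OY : ringSheaf Y) := RingedMorphism {
  rsmap :> X -> Y;
  rscont : continuous rsmap;
  rsharp : forall V : opn Y, {rmorphism OY V -> OX (opreim rscont V)};
  rsharp_res : forall (V W : opn Y) (h : W `<=` V)
    (h' : opreim rscont W `<=` opreim rscont V) s,
    rsharp W (rres h s) = rres h' (rsharp V s) }.
Arguments rscont {X Y OX OY} r.
Arguments rsharp {X Y OX OY} r V.
Arguments rsharp_res {X Y OX OY} r {V W} h h' s.

Section DirectImage.
Variables (X Y : topologicalType) (OX : ringSheaf X) (OY : ringSheaf Y).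
Variable f : ringedMorphism OX OY.

Fact opreimS (V W : opn Y) :
  W `<=` V -> opreim (rscont f) W `<=` opreim (rscont f) V.
Proof. by move=> h x; apply: h. Qed.

Definition direct_image (M : modSheaf OX) : modSheaf OY.
Proof.
apply: (@ModSheaf Y OY
  (fun V => rscal (rsharp f V) (M (opreim (rscont f) V)) : lmodType (OY V))
  (fun V W h => mres (opreimS h))).
- move=> V W h a s t; rewrite !rscalE (rsharp_res f h (opreimS h)).
  exact: mresL.
- by move=> V h s; apply: mres_id.
- by move=> V W Z hW hZ hZV s; apply: mres_comp.
- move=> V I W hW cov s sc.
  apply: (@mglue X OX M (opreim (rscont f) V) I
    (fun i => opreim (rscont f) (W i)) (fun i => opreimS (hW i))).
    by move=> x /cov[i _ Wi]; exists i.
  move=> i j Z hi hj.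
  pose Wij := Opn (openI (oset_open (W i)) (oset_open (W j))).
  have h1 : Wij `<=` W i by move=> y [].
  have h2 : Wij `<=` W j by move=> y [].
  have hZ : Z `<=` opreim (rscont f) Wij.
    by move=> x Zx; split; [apply: hi | apply: hj].
  have /(congr1 (mres hZ)) := sc i j Wij h1 h2.
  by rewrite !(mres_comp _ _ hi) !(mres_comp _ _ hj).
Defined.

Definition direct_image_hom (M N : modSheaf OX) (u : modHom M N) :
  modHom (direct_image M) (direct_image N).
Proof.
apply: (@ModHom _ _ (direct_image M) (direct_image N)
  (fun V => u (opreim (rscont f) V))).
- by move=> V a s t; apply: (homL u _ (rsharp f V a) s t).
- by move=> V W h s; apply: (hom_res u (opreimS h) s).
Defined.

(* H is (a copy of) R^i f_* M, the i-th right derived functor of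
   f_* : Mod(OX) -> Mod(OY) at M, computed on some injective resolution of M. *)
Definition is_higher_direct_image (i : nat) (M : modSheaf OX)
    (H : modSheaf OY) : Prop :=
  exists I : injective_resolution M,
    is_cohomology_sheaf (K := fun n => direct_image (I n))
      (fun n => direct_image_hom (ires_d I n)) i H.

(* "R^i f_* M is quasi-coherent". Different injective resolutions give
   isomorphic R^i f_* M, so that quantifying existentially over H loses
   nothing. *)
Definition higher_direct_image_qcoh (i : nat) (M : modSheaf OX) : Prop :=
  exists2 H : modSheaf OY, is_higher_direct_image i M H & quasi_coherent H.

End DirectImage.

(* The inclusion j : (U, O|_U) -> (X, O). *)
Definition open_inclusion (X : topologicalType) (O : ringSheaf X)
  (U : opn X) : ringedMorphism (restr_ring O U) O.
Proof.
apply: (@RingedMorphism _ _ (restr_ring O U) O _ (@set_val_continuous X U)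
  (fun V => rres (@oimg_opreim X U V))).
move=> V W h h' s.
exact: (rres_compE h (@oimg_opreim X U W) (@oimg_opreim X U V) (oimgS h') s).
Defined.

Section ProductOfRings.
Variables (I : Type) (R : I -> comPzRingType).

Definition dprod_ring : Type := forall i, R i.

HB.instance Definition _ := gen_eqMixin dprod_ring.
HB.instance Definition _ := gen_choiceMixin dprod_ring.

Implicit Types f g h : dprod_ring.
Let addf f g : dprod_ring := fun i => f i + g i.
Let oppf f : dprod_ring := fun i => - f i.
Let mulf f g : dprod_ring := fun i => f i * g i.

Fact dprod_addA : associative addf.
Proof. by move=> f g h; apply/functional_extensionality_dep => i; apply: addrA. Qed.
Fact dprod_addC : commutative addf.
Proof. by move=> f g; apply/functional_extensionality_dep => i; apply: addrC. Qed.
Fact dprod_add0 : left_id (fun i => 0) addf.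
Proof. by move=> f; apply/functional_extensionality_dep => i; apply: add0r. Qed.
Fact dprod_addN : left_inverse (fun i => 0) oppf addf.
Proof. by move=> f; apply/functional_extensionality_dep => i; apply: addNr. Qed.

HB.instance Definition _ := GRing.isZmodule.Build dprod_ring
  dprod_addA dprod_addC dprod_add0 dprod_addN.

Fact dprod_mulA : associative mulf.
Proof. by move=> f g h; apply/functional_extensionality_dep => i; apply: mulrA. Qed.
Fact dprod_mulC : commutative mulf.
Proof. by move=> f g; apply/functional_extensionality_dep => i; apply: mulrC. Qed.
Fact dprod_mul1 : left_id (fun i => 1) mulf.
Proof. by move=> f; apply/functional_extensionality_dep => i; apply: mul1r. Qed.
Fact dprod_mulDl : left_distributive mulf +%R.
Proof. by move=> f g h; apply/functional_extensionality_dep => i; apply: mulrDl. Qed.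

HB.instance Definition _ := GRing.Zmodule_isComPzRing.Build dprod_ring
  dprod_mulA dprod_mulC dprod_mul1 dprod_mulDl.

End ProductOfRings.

(* The sheaf of rings on a finite space with prescribed stalks R z and
   restriction morphisms R z -> R z' for z <= z': sections over W are the
   compatible families in the product of the R z, z in W. *)
Section SheafOfStalks.
Variables (Z : topologicalType) (le : Z -> Z -> Prop).
Hypothesis le_open :
  forall (W : opn Z) z z', le z z' -> oset W z -> oset W z'.
Variables (R : Z -> comPzRingType).
Variable tr : forall z z', le z z' -> {rmorphism R z -> R z'}.

Definition stalk_fam (W : opn Z) : Type :=
  dprod_ring (fun w : {z | oset W z} => R (sval w)).

HB.instance Definition _ W := GRing.ComPzRing.on (stalk_fam W).

Definition compatible (W : opn Z) (s : stalk_fam W) : bool :=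
  `[< forall w w' (h : le (sval w) (sval w')), tr h (s w) = s w' >].

Fact compatible_closed W : subring_closed (@compatible W).
Proof.
split.
- by apply/asboolP => w w' h; apply: rmorph1.
- move=> s t /asboolP cs /asboolP ct; apply/asboolP => w w' h.
  by rewrite -[(s - t) w]/(s w - t w) rmorphB cs ct.
- move=> s t /asboolP cs /asboolP ct; apply/asboolP => w w' h.
  by rewrite -[(s * t) w]/(s w * t w) rmorphM cs ct.
Qed.

HB.instance Definition _ W := GRing.isSubringClosed.Build (stalk_fam W)
  (@compatible W) (compatible_closed W).

Definition stalk_sec (W : opn Z) : Type := {s : stalk_fam W | compatible s}.

HB.instance Definition _ W := SubChoice.on (stalk_sec W).
HB.instance Definition _ W := GRing.SubChoice_isSubComPzRing.Build
  (stalk_fam W) (@compatible W) (stalk_sec W) (compatible_closed W).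

Lemma stalk_secP (W : opn Z) (s : stalk_sec W) w w'
  (h : le (sval w) (sval w')) : tr h (val s w) = val s w'.
Proof. exact: (asboolP _ (valP s)). Qed.

Section Res.
Variables (V W : opn Z) (h : W `<=` V).

Let widen (w : {z | oset W z}) : {z | oset V z} :=
  exist _ (sval w) (h (proj2_sig w)).

Fact stalk_res_subproof (s : stalk_sec V) :
  compatible ((fun w => val s (widen w)) : stalk_fam W).
Proof.
by apply/asboolP => w w' hw; apply: (stalk_secP s (w := widen w) (w' := widen w')).
Qed.

Definition stalk_res (s : stalk_sec V) : stalk_sec W :=
  exist (fun t => is_true (compatible t)) _ (stalk_res_subproof s).

Lemma stalk_resE (s : stalk_sec V) z (Wz : oset W z) :
  val (stalk_res s) (exist _ z Wz) = val s (exist _ z (h Wz)).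
Proof. by []. Qed.

Fact stalk_res_zmod : zmod_morphism stalk_res.
Proof. by move=> s t; apply: val_inj. Qed.
Fact stalk_res_monoid : monoid_morphism stalk_res.
Proof. by split=> [|s t]; apply: val_inj. Qed.

HB.instance Definition _ := GRing.isZmodMorphism.Build
  (stalk_sec V) (stalk_sec W) stalk_res stalk_res_zmod.
HB.instance Definition _ := GRing.isMonoidMorphism.Build
  (stalk_sec V) (stalk_sec W) stalk_res stalk_res_monoid.

End Res.

Lemma stalk_sec_eq (W : opn Z) (s t : stalk_sec W) :
  (forall z (Wz : oset W z), val s (exist _ z Wz) = val t (exist _ z Wz)) ->
  s = t.
Proof.
by move=> st; apply/val_inj/functional_extensionality_dep => -[z Wz].
Qed.

Lemma stalk_sec_irr (W : opn Z) (s : stalk_sec W) z (h h' : oset W z) :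
  val s (exist _ z h) = val s (exist _ z h').
Proof. by rewrite (Prop_irrelevance h h'). Qed.

Definition sheaf_of_stalks : ringSheaf Z.
Proof.
apply: (@RingSheaf Z (fun W => stalk_sec W) (fun V W h => stalk_res h)).
- move=> W h s; apply: stalk_sec_eq => z Wz.
  by rewrite (stalk_resE h s Wz); exact (stalk_sec_irr s (h z Wz) Wz).
- move=> U V W hV hW hWU s; apply: stalk_sec_eq => z Wz.
  rewrite !stalk_resE.
  exact (stalk_sec_irr s (hV z (hW z Wz)) (hWU z Wz)).
move=> U I V hV cov s sc.
pose cv (u : {z | oset U z}) : {i | oset (V i) (sval u)} :=
  cid (let: ex_intro2 i _ Vi := cov _ (svalP u) in ex_intro _ i Vi).
have sE i j z (hi : oset (V i) z) (hj : oset (V j) z) :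
    val (s i) (exist _ z hi) = val (s j) (exist _ z hj).
  pose Vij := Opn (openI (oset_open (V i)) (oset_open (V j))).
  have h1 : Vij `<=` V i by move=> y [].
  have h2 : Vij `<=` V j by move=> y [].
  have /(congr1 (fun t : stalk_sec Vij => val t (exist _ z (conj hi hj)))) :=
    sc i j Vij h1 h2.
  by rewrite /= (stalk_sec_irr _ _ hi) => ->; apply: stalk_sec_irr.
pose t : stalk_fam U := fun u => val (s (sval (cv u))) (exist _ (sval u) (svalP (cv u))).
have tE i u (hi : oset (V i) (sval u)) : t u = val (s i) (exist _ (sval u) hi).
  exact: sE.
have tc : compatible t.
  apply/asboolP => u u' h; set i := sval (cv u).
  have hi : oset (V i) (sval u) := svalP (cv u).
  have hi' : oset (V i) (sval u') := le_open h hi.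
  rewrite (tE i u hi) (tE i u' hi').
  exact: (stalk_secP (s i) (w := exist _ _ hi) (w' := exist _ _ hi')).
exists (exist _ t tc); split=> [i|t' t'E]; apply: stalk_sec_eq => z Uz /=.
  exact: (tE i (exist _ z (hV i z Uz)) Uz).
have [i _ Vz] := cov z Uz; rewrite (tE i (exist _ z Uz) Vz) -t'E /=.
exact: stalk_sec_irr.
Defined.

End SheafOfStalks.

(* (X, O) is a ringed finite space over the base ring k, the structure morphism
   X -> ( *, k) being given by kappa : k -> O(X). *)
Section FiniteSpaces.
Variables (X : topologicalType) (finX : finite_set [set: X]).
Variables (O : ringSheaf X).

Definition stalk (x : X) : comPzRingType := O (umin finX x).

Definition stalk_map (x y : X) (xy : spec_le x y) :
  {rmorphism stalk x -> stalk y} := rres (spec_le_umin finX xy).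

Lemma stalk_map_irr (x y : X) (xy xy' : spec_le x y) a :
  stalk_map xy a = stalk_map xy' a.
Proof. by rewrite (Prop_irrelevance xy xy'). Qed.

Definition finite_space : Prop :=
  forall (x y : X) (xy : spec_le x y), flat (stalk_map xy).

Variables (k : comPzRingType) (kappa : {rmorphism k -> O (opnT X)}).

Definition stalk_alg (x : X) : {rmorphism k -> stalk x} :=
  @rres X O (opnT X) (umin finX x) (@subsetT X _) \o kappa.

Lemma stalk_map_alg (x y : X) (xy : spec_le x y) c :
  stalk_map xy (stalk_alg x c) = stalk_alg y c.
Proof. exact: rres_comp. Qed.

Definition prod_le (z z' : X * X) : Prop :=
  spec_le z.1 z'.1 /\ spec_le z.2 z'.2.

Lemma prod_le_open (W : opn (X * X)%type) z z' :
  prod_le z z' -> oset W z -> oset W z'.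
Proof.
move: z z' => [x y] [x' y'] [/= hx hy] Wz.
have [[A B] /= [/= nA nB] AB] : nbhs (x, y) W.
  by apply: open_nbhs_nbhs; split=> //; apply: oset_open.
apply: (AB (x', y')); split=> /=.
- by move: nA; rewrite nbhsE => -[V [oV Vx] VA]; apply: VA; apply: hx.
- by move: nB; rewrite nbhsE => -[V [oV Vy] VB]; apply: VB; apply: hy.
Qed.

Definition prod_stalk (z : X * X) : comPzRingType :=
  tring (stalk_alg z.1) (stalk_alg z.2).

Fact prod_tr_subproof z z' (h : prod_le z z') c :
  (tinl (stalk_alg z'.1) (stalk_alg z'.2) \o stalk_map h.1)
    (stalk_alg z.1 c) =
  (tinr (stalk_alg z'.1) (stalk_alg z'.2) \o stalk_map h.2)
    (stalk_alg z.2 c).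
Proof. by rewrite /= !stalk_map_alg tinl_tinr. Qed.

(* a (x) b |-> a|_(x') (x) b|_(y') for (x, y) <= (x', y') *)
Definition prod_tr z z' (h : prod_le z z') :
  {rmorphism prod_stalk z -> prod_stalk z'} := tpairing (prod_tr_subproof h).

(* X x_k X : the product topological space with stalks O_x (x)_k O_y. *)
Definition prod_sheaf : ringSheaf (X * X)%type :=
  sheaf_of_stalks prod_le_open prod_tr.

Definition diag (x : X) : X * X := (x, x).

Lemma diag_continuous : continuous diag.
Proof. by move=> x; apply: cvg_pair; apply: cvg_id. Qed.

(* The multiplication O_x (x)_k O_x -> O_x. *)
Definition diag_mult (x : X) : {rmorphism prod_stalk (x, x) -> stalk x} :=
  tpairing (u := idfun) (v := idfun)
    (fun c => erefl (stalk_alg x c)).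

Lemma diag_mult_tr (x y : X) (xy : spec_le x y) (t : prod_stalk (x, x)) :
  stalk_map xy (diag_mult x t) =
  diag_mult y (@prod_tr (x, x) (y, y) (conj xy xy) t).
Proof.
elim/tring_ind: t => [|a b t IH]; first by rewrite !rmorph0.
rewrite !rmorphD IH; congr (_ + _).
rewrite /= !tpairing_pure /= rmorphM /tinl /tinr tpureM mulr1 mul1r.
rewrite tpairing_pure.
exact (f_equal2 *%R (stalk_map_irr xy (proj1 (conj xy xy)) a)
  (stalk_map_irr xy (proj2 (conj xy xy)) b)).
Qed.

Section DiagSharp.
Variable W : opn (X * X)%type.
Let D := opreim diag_continuous W.

Fact umin_diag_sub (x : {x | oset D x}) : umin finX (sval x) `<=` D.
Proof. by apply: umin_set_sub; [apply: oset_open | apply: svalP]. Qed.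

Arguments umin_diag_sub x : clear implicits.

(* delta^# s is the section whose germ at x is the image of the germ of s at
   (x, x) by the multiplication. *)
Definition is_diag_sharp (s : prod_sheaf W) (t : O D) : Prop :=
  forall x : {x | oset D x}, rres (umin_diag_sub x) t =
    diag_mult (sval x) (val s (exist _ (diag (sval x)) (svalP x))).

Fact umin_cover : D `<=` \bigcup_(x : {x | oset D x}) umin finX (sval x).
Proof. by move=> x Dx; exists (exist _ x Dx) => //; apply: umin_set_refl. Qed.

Fact diag_sharp_subproof (s : prod_sheaf W) :
  exists t : O D, is_diag_sharp s t.
Proof.
have [i j Z hi hj|t [tE _]] := @rglue X O D _ _ umin_diag_sub umin_cover
  (fun x => diag_mult (sval x) (val s (exist _ (diag (sval x)) (svalP x))));
  last by exists t.
pose V (z : {z | oset Z z}) := umin finX (sval z).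
have hV z : V z `<=` Z.
  by apply: umin_set_sub; [apply: oset_open | apply: svalP].
apply: (rsep (hV := hV)) => [x Zx|z].
  by exists (exist _ x Zx) => //; apply: umin_set_refl.
have key (x : {x | oset D x}) (h : Z `<=` umin finX (sval x)) :
    rres (hV z) (rres h
      (diag_mult (sval x) (val s (exist _ (diag (sval x)) (svalP x))))) =
    diag_mult (sval z) (val s (exist _ (diag (sval z))
      (umin_diag_sub x _ (h _ (svalP z))))).
  have xz : spec_le (sval x) (sval z) := h _ (svalP z).
  rewrite (rres_comp _ _ (spec_le_umin finX xz)).
  rewrite -[LHS]/(stalk_map xz _) diag_mult_tr.
  congr (diag_mult _ _).
  exact: (stalk_secP s (w := exist _ (diag (sval x)) _)
    (w' := exist _ (diag (sval z)) _) (conj xz xz)).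
by rewrite !key (Prop_irrelevance (umin_diag_sub i _ (hi _ (svalP z)))
  (umin_diag_sub j _ (hj _ (svalP z)))).
Qed.

Definition diag_sharp (s : prod_sheaf W) : O D := sval (cid (diag_sharp_subproof s)).

Lemma diag_sharpP s : is_diag_sharp s (diag_sharp s).
Proof. exact: svalP (cid _). Qed.

Lemma is_diag_sharp_unique s t t' :
  is_diag_sharp s t -> is_diag_sharp s t' -> t = t'.
Proof. by move=> st st'; apply: (rsep (hV := umin_diag_sub) umin_cover) => x; rewrite st st'. Qed.

Fact diag_sharp_zmod : zmod_morphism diag_sharp.
Proof.
move=> s t; apply: is_diag_sharp_unique (diag_sharpP _) _ => x.
by rewrite rmorphB !diag_sharpP -rmorphB.
Qed.
Fact diag_sharp_monoid : monoid_morphism diag_sharp.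
Proof.
split=> [|s t]; apply: is_diag_sharp_unique (diag_sharpP _) _ => x.
  by rewrite !rmorph1.
by rewrite rmorphM !diag_sharpP -rmorphM.
Qed.

HB.instance Definition _ := GRing.isZmodMorphism.Build
  (prod_sheaf W) (O D) diag_sharp diag_sharp_zmod.
HB.instance Definition _ := GRing.isMonoidMorphism.Build
  (prod_sheaf W) (O D) diag_sharp diag_sharp_monoid.

End DiagSharp.
Arguments umin_diag_sub {W} x.

Definition diagonal_morphism : ringedMorphism O prod_sheaf.
Proof.
refine (@RingedMorphism X (X * X)%type O prod_sheaf diag diag_continuous
  (fun W => @diag_sharp W) _).
move=> V W h h' s; apply: is_diag_sharp_unique (diag_sharpP _) _ => x.
pose x' : {x | oset (opreim diag_continuous V) x} :=
  exist _ (sval x) (h _ (svalP x)).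
rewrite (rres_comp _ _ (umin_diag_sub x')) (diag_sharpP s x').
congr (diag_mult _ _).
exact (stalk_sec_irr s (svalP x') (h _ (svalP x))).
Defined.

Definition schematic : Prop :=
  finite_space /\
  forall i : nat, higher_direct_image_qcoh diagonal_morphism i (struct_mod O).

End FiniteSpaces.
Arguments umin_diag_sub {X} finX {W} x : rename.

(* Main.v *)
Require Import Defs.
From HB Require Import structures.
From mathcomp Require Import all_boot all_algebra generic_quotient.
From mathcomp Require Import boolp classical_sets functions cardinality topology.

(* On a finite space a module M is quasi-coherent iff, for all p <= q, the map
   O_q (x)_{O_p} M_p -> M_q is bijective. For p <= p', p <= x and W the
   intersection of U_p' and U_x, this criterion applied to R^i delta_* O at
   (p, x) <= (p', x) gives O(W) = O_p' (x)_{O_p} O_x and H^i(W, O) = 0 for i > 0.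
   As the O_y, y in W, are flat over O_x, both facts remain true after tensoring
   over O_x with the stalk of a quasi-coherent module: if x lies in U then
   O_p' (x)_{O_p} N_x = (j_* N)(W) and the higher cohomology of j_* N on W
   vanishes. Let K = j_* I for an injective resolution I of N. Then
   O_p' (x)_{O_p} K(V) -> K(V /\ U_p') is a quasi-isomorphism for V = U_x, x in
   U /\ U_p, hence by Mayer-Vietoris for V = U /\ U_p; since O_p' is flat over
   O_p, O_p' (x)_{O_p} H^i(K(U_p)) = H^i(K(U_p')), which is the criterion for
   R^i j_* N. The case i = 0 gives the extension j_* N of N. *)

Set Implicit Arguments.
Unset Strict Implicit.
Unset Printing Implicit Defensive.

Import GRing.Theory Num.Theory.
Local Open Scope classical_set_scope.
Local Open Scope ring_scope.

(** * Quotients and products of modules *)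

(** Schematicity provides some injective resolution of O with exact sections over W, whereas
    exactness is wanted for j_* I. The two are compared through [Hvan], a vanishing condition that
    mentions no resolution: it is defined by dimension shifting along Godement cokernels on a finite
    poset, and every flasque resolution detects it. Tensoring with N_x, which need not be flat, is
    harmless because over O_x the sequence 0 -> Gamma(F) -> prod_y F(y) -> Gamma(F') -> 0, with F'
    the Godement cokernel, has a flat last term: it stays exact after tensoring, and its first term
    is flat. On a finite poset F' is zero after finitely many repetitions, so induction applies. At
    points outside U the complex j_* I need not resolve j_* N, so the comparison is made at points
    of U only; it reaches U_p because sections of j_* I over V and over V /\ U coincide.
    Quasi-isomorphisms are expressed as acyclicity of a cone; Mayer-Vietoris is then a chase with
    two open sets and surjective restrictions, without long exact sequences. *)

Section AdditiveFunctions.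
Variables (V W : zmodType) (f : V -> W) (fD : {morph f : x y / x + y}).

(** Tensor products carry only a group structure here and maps out of them are bare functions; hence
    this calculus for additive functions that are not packed as morphisms. *)
Lemma morphD0 : f 0 = 0.
Proof. by apply: (addrI (f 0)); rewrite -fD !addr0. Qed.

Lemma morphDN : {morph f : x / - x}.
Proof. by move=> x; apply: (addrI (f x)); rewrite -fD !subrr morphD0. Qed.

Lemma morphDB : {morph f : x y / x - y}.
Proof. by move=> x y; rewrite fD morphDN. Qed.

Lemma morphD_sum I (r : seq I) (P : pred I) (F : I -> V) :
  f (\sum_(i <- r | P i) F i) = \sum_(i <- r | P i) f (F i).
Proof. by elim/big_ind2: _ => // [|x ? y ? <- <-]; [apply: morphD0|]. Qed.

Lemma morphD_inj : (forall x, f x = 0 -> x = 0) -> injective f.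
Proof.
by move=> f0 x y fxy; apply/subr0_eq/f0; rewrite morphDB fxy subrr.
Qed.

End AdditiveFunctions.

Section PackLinear.
Variables (R : pzRingType) (V W : lmodType R) (f : V -> W) (fL : linear f).
Definition lin_of : {linear V -> W} :=
  HB.pack f (GRing.isLinear.Build R V W *:%R f fL).
Lemma lin_ofE x : lin_of x = f x. Proof. by []. Qed.
End PackLinear.

Lemma linear_morphD (R : pzRingType) (V W : lmodType R) (f : V -> W) :
  linear f -> {morph f : x y / x + y}.
Proof. by move=> fL x y; have := fL 1 x y; rewrite !scale1r. Qed.

Lemma linear_morph0 (R : pzRingType) (V W : lmodType R) (f : V -> W) :
  linear f -> f 0 = 0.
Proof. by move=> /linear_morphD; apply: morphD0. Qed.

Lemma linear_scale (R : pzRingType) (V W : lmodType R) (f : V -> W) :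
  linear f -> forall a x, f (a *: x) = a *: f x.
Proof.
by move=> fL a x; have := fL a x 0; rewrite (linear_morph0 fL) !addr0.
Qed.

Section Quotient.
Variable V : zmodType.

Record zsubgroup := ZSubgroup {
  zsub_set :> V -> Prop;
  zsub0 : zsub_set 0;
  zsubB : forall u v, zsub_set u -> zsub_set v -> zsub_set (u - v) }.

Variable S : zsubgroup.

Lemma zsubN u : S u -> S (- u).
Proof. by move=> Su; rewrite -sub0r; apply: zsubB => //; apply: zsub0. Qed.
Lemma zsubD u v : S u -> S v -> S (u + v).
Proof. by move=> Su Sv; rewrite -[v]opprK; apply: zsubB => //; apply: zsubN. Qed.

Let quo_rel (u v : V) := `[< S (u - v) >].
Fact quo_refl : reflexive quo_rel.
Proof. by move=> u; apply/asboolP; rewrite subrr; apply: zsub0. Qed.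
Fact quo_sym : symmetric quo_rel.
Proof.
by move=> u v; apply/asboolP/asboolP => /zsubN; rewrite opprB.
Qed.
Fact quo_trans : transitive quo_rel.
Proof.
move=> v u w /asboolP uv /asboolP vw; apply/asboolP.
by rewrite -(subrK v u) -addrA; apply: zsubD.
Qed.
Canonical quo_equiv := EquivRel quo_rel quo_refl quo_sym quo_trans.

Definition zquot : Type := {eq_quot quo_equiv}%qT.
HB.instance Definition _ := Choice.on zquot.

Definition qclass (v : V) : zquot := (\pi_({eq_quot quo_equiv}) v)%qT.
Definition qrepr (x : zquot) : V := repr (x : {eq_quot quo_equiv}%qT).

Lemma qreprK x : qclass (qrepr x) = x.
Proof. exact: reprK. Qed.

Lemma qclassP u v : qclass u = qclass v <-> S (u - v).
Proof. by split; [move/eqmodP/asboolP | move=> ?; apply/eqmodP/asboolP]. Qed.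

Let qadd x y := qclass (qrepr x + qrepr y).
Let qopp x := qclass (- qrepr x).

Let qaddE u v : qadd (qclass u) (qclass v) = qclass (u + v).
Proof.
apply/qclassP; rewrite opprD addrACA; apply: zsubD; apply/qclassP;
  exact: qreprK.
Qed.
Let qoppE u : qopp (qclass u) = qclass (- u).
Proof. by apply/qclassP; rewrite -opprD; apply/zsubN/qclassP/qreprK. Qed.

Fact qaddA : associative qadd.
Proof.
by move=> x y z; rewrite -[x]qreprK -[y]qreprK -[z]qreprK !qaddE addrA.
Qed.
Fact qaddC : commutative qadd.
Proof. by move=> x y; rewrite -[x]qreprK -[y]qreprK !qaddE addrC. Qed.
Fact qadd0 : left_id (qclass 0) qadd.
Proof. by move=> x; rewrite -[x]qreprK qaddE add0r. Qed.
Fact qaddN : left_inverse (qclass 0) qopp qadd.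
Proof. by move=> x; rewrite -[x]qreprK qoppE qaddE addNr. Qed.

HB.instance Definition _ := GRing.isZmodule.Build zquot qaddA qaddC qadd0 qaddN.

Lemma qclassD : {morph qclass : u v / u + v}.
Proof. by move=> u v; rewrite -qaddE. Qed.
Lemma qclass_eq0 u : qclass u = 0 <-> S u.
Proof. by rewrite -[0]/(qclass 0) qclassP subr0. Qed.

End Quotient.
Arguments qclass {V} S v.

Section ModuleQuotient.
Variables (R : comPzRingType) (V : lmodType R) (S : submod V).

Fact submod_subB u v : submod_set S u -> submod_set S v -> submod_set S (u - v).
Proof.
by move=> Su Sv; rewrite addrC -scaleN1r; apply: submodL.
Qed.

Definition zsub_of_submod := ZSubgroup (submod0 S) submod_subB.
Definition lquot : Type := zquot zsub_of_submod.
HB.instance Definition _ := GRing.Zmodule.on lquot.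

Definition lclass (v : V) : lquot := qclass zsub_of_submod v.
Let lscale (a : R) (x : lquot) : lquot := lclass (a *: qrepr x).
Let lscaleE a v : lscale a (lclass v) = lclass (a *: v).
Proof.
apply/qclassP; rewrite -scalerBr -[_ *: _]addr0.
by apply: submodL (submod0 S); apply/(qclassP zsub_of_submod)/qreprK.
Qed.

Lemma lclassD : {morph lclass : u v / u + v}.
Proof. exact: qclassD. Qed.
Lemma lclass_surj x : exists v, lclass v = x.
Proof. by exists (qrepr x); apply: qreprK. Qed.
Lemma lclass_eq0 v : lclass v = 0 <-> submod_set S v.
Proof. exact: (qclass_eq0 zsub_of_submod). Qed.

Fact lscaleA a b v : lscale a (lscale b v) = lscale (a * b) v.
Proof. by have [u <-] := lclass_surj v; rewrite !lscaleE scalerA. Qed.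
Fact lscale1 : left_id 1 lscale.
Proof. by move=> v; have [u <-] := lclass_surj v; rewrite !lscaleE scale1r. Qed.
Fact lscaleDr : right_distributive lscale +%R.
Proof.
move=> a v w; have [u <-] := lclass_surj v; have [u' <-] := lclass_surj w.
by rewrite -lclassD !lscaleE -lclassD scalerDr.
Qed.
Fact lscaleDl v : {morph lscale^~ v : a b / a + b}.
Proof.
move=> a b; have [u <-] := lclass_surj v.
by rewrite !lscaleE -lclassD scalerDl.
Qed.
HB.instance Definition _ := GRing.Zmodule_isLmodule.Build R lquot
  lscaleA lscale1 lscaleDr lscaleDl.

Lemma lclassL : linear lclass.
Proof. by move=> a u v; rewrite lclassD -lscaleE. Qed.

End ModuleQuotient.
Arguments lclass {R V} S v.

Section DependentProduct.
Variables (R : comPzRingType) (I : Type) (F : I -> lmodType R).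

Definition dprod : Type := forall i, F i.
HB.instance Definition _ := gen_eqMixin dprod.
HB.instance Definition _ := gen_choiceMixin dprod.

Implicit Types f g h : dprod.
Let addf f g : dprod := fun i => f i + g i.
Let oppf f : dprod := fun i => - f i.
Let scalef a f : dprod := fun i => a *: f i.

Lemma dprod_eq f g : (forall i, f i = g i) -> f = g.
Proof. exact: functional_extensionality_dep. Qed.

Fact dprod_lmod_addA : associative addf.
Proof. by move=> f g h; apply/dprod_eq => i; apply: addrA. Qed.
Fact dprod_lmod_addC : commutative addf.
Proof. by move=> f g; apply/dprod_eq => i; apply: addrC. Qed.
Fact dprod_lmod_add0 : left_id (fun i => 0) addf.
Proof. by move=> f; apply/dprod_eq => i; apply: add0r. Qed.
Fact dprod_lmod_addN : left_inverse (fun i => 0) oppf addf.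
Proof. by move=> f; apply/dprod_eq => i; apply: addNr. Qed.
HB.instance Definition _ := GRing.isZmodule.Build dprod
  dprod_lmod_addA dprod_lmod_addC dprod_lmod_add0 dprod_lmod_addN.

Fact dprod_scaleA a b f : scalef a (scalef b f) = scalef (a * b) f.
Proof. by apply/dprod_eq => i; apply: scalerA. Qed.
Fact dprod_scale1 : left_id 1 scalef.
Proof. by move=> f; apply/dprod_eq => i; apply: scale1r. Qed.
Fact dprod_scaleDr : right_distributive scalef +%R.
Proof. by move=> a f g; apply/dprod_eq => i; apply: scalerDr. Qed.
Fact dprod_scaleDl f : {morph scalef^~ f : a b / a + b}.
Proof. by move=> a b; apply/dprod_eq => i; apply: scalerDl. Qed.
HB.instance Definition _ := GRing.Zmodule_isLmodule.Build R dprod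
  dprod_scaleA dprod_scale1 dprod_scaleDr dprod_scaleDl.

Lemma dprodD f g i : (f + g) i = f i + g i. Proof. by []. Qed.
Lemma dprodZ a f i : (a *: f) i = a *: f i. Proof. by []. Qed.

End DependentProduct.

Lemma submod_valP (R : comPzRingType) (V : lmodType R) (S : submod V)
  (s : submod_type S) : submod_set S (val s).
Proof. exact/asboolP/(valP s). Qed.

Definition submod_sub (R : comPzRingType) (V : lmodType R) (S : submod V)
  (v : V) (Sv : submod_set S v) : submod_type S := exist _ v (asboolT Sv).

(** * Tensor products and flatness *)

Lemma finite_set_seq (I : choiceType) (A : set I) : finite_set A ->
  exists2 l : seq I, uniq l & forall i, A i -> i \in l.
Proof.
move=> /finite_seqP[l lA]; exists (undup l); first exact: undup_uniq.
by move=> i Ai; rewrite mem_undup; move: Ai; rewrite lA.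
Qed.

Section FreeModule.
Variables (R : comPzRingType) (I : choiceType).

Definition finsupp : set (I -> R^o) := [set s | finite_set [set i | s i <> 0]].

Fact finsupp0 : finsupp 0.
Proof.
by rewrite /finsupp /= (_ : [set _ | _] = set0) //; apply/seteqP; split=> i.
Qed.

Fact finsuppL (a : R) (u v : I -> R^o) :
  finsupp u -> finsupp v -> finsupp (a *: u + v).
Proof.
move=> fu fv; apply: (@sub_finite_set _ _
  ([set i | u i <> 0] `|` [set i | v i <> 0])); last by rewrite finite_setU.
move=> i /=; apply: contra_notP => /not_orP[/contrapT u0 /contrapT v0].
by rewrite -[(a *: u + v) i]/(a * u i + v i) u0 v0 mulr0 addr0.
Qed.

Definition freem_submod := Submod finsupp0 finsuppL.
Definition freem : Type := submod_type freem_submod.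
HB.instance Definition _ := GRing.Lmodule.on freem.

Definition coef (s : freem) (i : I) : R := val s i.

Definition freem_of (s : I -> R^o) (h : finsupp s) : freem :=
  submod_sub (S := freem_submod) h.

Lemma freem_finite (s : freem) : finite_set [set i | coef s i <> 0].
Proof. exact: (submod_valP s). Qed.

Fact basis_subproof (i : I) : finsupp (fun j => if j == i then 1 else 0).
Proof.
apply: (@sub_finite_set _ _ [set i]); last exact: finite_set1.
by move=> j /=; case: eqP.
Qed.
Definition basis i : freem := freem_of (basis_subproof i).

Lemma freem_eq (s t : freem) : coef s =1 coef t -> s = t.
Proof. by move=> st; apply/val_inj/funext. Qed.

Lemma coef_basis i j : coef (basis i) j = if j == i then 1 else 0.
Proof. by []. Qed.
Lemma coefD s t i : coef (s + t) i = coef s i + coef t i.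
Proof. by []. Qed.
Lemma coefZ a s i : coef (a *: s) i = a * coef s i.
Proof. by []. Qed.
Lemma coefL a s t i : coef (a *: s + t) i = a * coef s i + coef t i.
Proof. by []. Qed.

Lemma freem_decomp (s : freem) (l : seq I) : uniq l ->
  (forall i, coef s i <> 0 -> i \in l) ->
  s = \sum_(i <- l) coef s i *: basis i.
Proof.
move=> ul sl; apply: freem_eq => j.
rewrite (morphD_sum (f := coef^~ j)) //.
have [jl|jl] := boolP (j \in l).
  rewrite (bigD1_seq j) //= big1 => [|i ij].
    by rewrite coefZ coef_basis eqxx mulr1 addr0.
  by rewrite coefZ coef_basis eq_sym (negPf ij) mulr0.
rewrite big_seq big1 => [|i il].
  by apply: contrapT => /sl; rewrite (negPf jl).
by rewrite coefZ coef_basis; case: eqP => [ji|_]; rewrite ?mulr0 //; rewrite ji il in jl.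
Qed.

Lemma freem_supp (s : freem) : exists2 l : seq I, uniq l &
  forall i, coef s i <> 0 -> i \in l.
Proof. exact: finite_set_seq (freem_finite s). Qed.

Lemma freem_ind (P : freem -> Prop) : P 0 ->
  (forall a i s, P s -> P (a *: basis i + s)) -> forall s, P s.
Proof.
move=> P0 PS s; have [l ul ls] := freem_supp s.
rewrite (freem_decomp ul ls); move: (coef s) => c.
by elim: l {ul ls} => [|i l IH]; rewrite ?big_nil ?big_cons //; apply: PS.
Qed.

Section Sum.
Variables (G : zmodType) (h : I -> R -> G).
Hypothesis hD : forall i, {morph h i : a b / a + b}.

(** [h i] is only additive, so that the values may lie in a tensor product, which is a mere
    group. *)
Definition free_sum (s : freem) : G :=
  \sum_(i <- s2val (cid2 (freem_supp s))) h i (coef s i).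

Lemma free_sumE (s : freem) (l : seq I) : uniq l ->
  (forall i, coef s i <> 0 -> i \in l) ->
  free_sum s = \sum_(i <- l) h i (coef s i).
Proof.
move=> ul sl; rewrite /free_sum; case: cid2 => r ur sr /=.
(* Zero coefficients contribute nothing; cut down to the support, the two lists are permutations of
   each other. *)
have cut (q : seq I) : \sum_(i <- q) h i (coef s i) =
    \sum_(i <- [seq i <- q | `[< coef s i <> 0 >]]) h i (coef s i).
  rewrite big_filter [LHS](bigID (fun i => `[< coef s i <> 0 >])) /= addrC.
  by rewrite big1 ?add0r // => i /asboolPn/contrapT ->; apply: morphD0.
rewrite cut [RHS]cut; apply: perm_big.
apply: uniq_perm; rewrite ?filter_uniq // => i; rewrite !mem_filter.
by case: asboolP => //= si; rewrite sl // sr.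
Qed.

Lemma free_sumD : {morph free_sum : s t / s + t}.
Proof.
move=> s t; have [l ul ls] := freem_supp s.
have [l' ul' lt] := freem_supp t.
have sub (r : freem) :
    (forall i, coef r i <> 0 -> coef s i <> 0 \/ coef t i <> 0) ->
    free_sum r = \sum_(i <- undup (l ++ l')) h i (coef r i).
  move=> rst; apply: free_sumE; rewrite ?undup_uniq //.
  by move=> i /rst[/ls|/lt] il; rewrite mem_undup mem_cat il ?orbT.
rewrite !sub; try by move=> i; auto.
  by rewrite -big_split; apply: eq_bigr => i _; apply: hD.
move=> i; rewrite coefD; apply: contra_notP => /not_orP[/contrapT -> /contrapT ->].
by rewrite addr0.
Qed.

Lemma free_sum_basis a i : free_sum (a *: basis i) = h i a.
Proof.
rewrite (@free_sumE _ [:: i]) ?big_seq1 //; first by rewrite coefZ coef_basis eqxx mulr1.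
move=> j; rewrite coefZ coef_basis inE; case: eqP => // _ []; exact: mulr0.
Qed.

End Sum.

End FreeModule.

Section TensorTheory.
Variables (R : comPzRingType).
Implicit Types (L M N P A B C : lmodType R) (G : zmodType).

Lemma tensor_ext M N G (f g : tensor M N -> G) :
  {morph f : x y / x + y} -> {morph g : x y / x + y} ->
  (forall m n, f (pure m n) = g (pure m n)) -> f =1 g.
Proof.
move=> fD gD fg; apply: tensor_ind => [|m n x IH]; first by rewrite !morphD0.
by rewrite fD gD fg IH.
Qed.

Lemma tensor_indD M N (P : tensor M N -> Prop) : P 0 ->
  (forall x y, P x -> P y -> P (x + y)) -> (forall m n, P (pure m n)) ->
  forall x, P x.
Proof. by move=> P0 PD Pp; apply: tensor_ind => // m n x Px; apply: PD. Qed.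

Lemma pure0l M N (n : N) : pure (0 : M) n = 0.
Proof. by apply: (morphD0 (f := fun m : M => pure m n)) => x y; apply: pureDl. Qed.
Lemma pure0r M N (m : M) : pure m (0 : N) = 0.
Proof. by apply: (morphD0 (f := fun n : N => pure m n)) => x y; apply: pureDr. Qed.
Lemma pureBl M N (m m' : M) (n : N) : pure (m - m') n = pure m n - pure m' n.
Proof. by apply: (morphDB (f := fun m : M => pure m n)) => x y; apply: pureDl. Qed.
Lemma pureBr M N (m : M) (n n' : N) : pure m (n - n') = pure m n - pure m n'.
Proof. by apply: (morphDB (f := fun n : N => pure m n)) => x y; apply: pureDr. Qed.

Section Tmap.
Variables (M N M' N' : lmodType R) (f : {linear M -> M'}) (g : {linear N -> N'}).

Lemma tmapD : {morph tmap f g : x y / x + y}.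
Proof. exact: (tliftD (tmap_balanced f g)). Qed.
Lemma tmap0 : tmap f g 0 = 0. Proof. exact: (morphD0 tmapD). Qed.
Lemma tmap_pure m n : tmap f g (pure m n) = pure (f m) (g n).
Proof. exact: (tlift_pure (tmap_balanced f g)). Qed.

Lemma tmap_surj : (forall y, exists x, f x = y) -> (forall y, exists x, g x = y) ->
  forall t, exists s, tmap f g s = t.
Proof.
move=> fs gs; apply: tensor_indD => [|x y [s <-] [t <-]|m n].
- by exists 0; rewrite tmap0.
- by exists (s + t); rewrite tmapD.
- have [x <-] := fs m; have [y <-] := gs n.
  by exists (pure x y); rewrite tmap_pure.
Qed.

End Tmap.

Lemma tmap_comp (M N M' N' M2 N2 : lmodType R) (f : {linear M -> M'}) (g : {linear N -> N'})
    (f' : {linear M' -> M2}) (g' : {linear N' -> N2})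
    (f2 : {linear M -> M2}) (g2 : {linear N -> N2}) :
  (forall x, f' (f x) = f2 x) -> (forall x, g' (g x) = g2 x) ->
  forall t, tmap f' g' (tmap f g t) = tmap f2 g2 t.
Proof.
move=> fE gE; apply: tensor_ext => [x y|x y|m n]; rewrite ?tmapD //.
by rewrite !tmap_pure fE gE.
Qed.

Lemma tmap_id M N (f : {linear M -> M}) (g : {linear N -> N}) :
  (forall x, f x = x) -> (forall x, g x = x) -> forall t, tmap f g t = t.
Proof.
move=> fE gE; apply: tensor_ext => [x y|x y|m n]; rewrite ?tmapD //.
by rewrite !tmap_pure fE gE.
Qed.

Lemma tmap_zero (M N M' N' : lmodType R) (f : {linear M -> M'}) (g : {linear N -> N'}) :
  (forall x, f x = 0) \/ (forall x, g x = 0) -> forall t, tmap f g t = 0.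
Proof.
move=> fg; apply: (tensor_ext (g := fun=> 0)) => [x y|x y|m n]; rewrite ?tmapD ?addr0 //.
by rewrite tmap_pure; case: fg => ->; rewrite ?pure0l ?pure0r.
Qed.

Fact range_tmap_subproof (M N M' N' : lmodType R) (f : {linear M -> M'}) (g : {linear N -> N'}) :
  forall u v, range (tmap f g) u -> range (tmap f g) v -> range (tmap f g) (u - v).
Proof.
by move=> _ _ [x _ <-] [y _ <-]; exists (x - y) => //; rewrite (morphDB (tmapD f g)).
Qed.
Definition range_tmap (M N M' N' : lmodType R) (f : {linear M -> M'}) (g : {linear N -> N'}) :
  zsubgroup (tensor M' N') :=
  ZSubgroup (ex_intro2 _ _ 0 I (tmap0 f g)) (@range_tmap_subproof _ _ _ _ f g).

(* Modulo [S], [(f m, g a) |-> m (x) a] is a well defined pairing. *)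
Lemma tensor_ker (M P A C : lmodType R) (f : {linear M -> P}) (g : {linear A -> C})
    (S : zsubgroup (tensor M A)) :
  (forall y, exists x, f x = y) -> (forall y, exists x, g x = y) ->
  (forall m a, f m = 0 -> S (pure m a)) ->
  (forall m a, g a = 0 -> S (pure m a)) ->
  forall t, tmap f g t = 0 -> S t.
Proof.
move=> fs gs Sf Sg.
have [sg sgK] := choice fs; have [ta taK] := choice gs.
pose h p c : zquot S := qclass S (pure (sg p) (ta c)).
have hE m a : h (f m) (g a) = qclass S (pure m a).
  apply/esym/qclassP.
  rewrite -[X in X - _](subrK (pure (sg (f m)) a)) -addrA -pureBl -pureBr.
  by apply: zsubD; [apply: Sf | apply: Sg]; rewrite linearB /= ?sgK ?taK subrr.
have hb : balanced h.
  split=> [p p' c|p c c'|r p c].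
  - have [m <-] := fs p; have [m' <-] := fs p'; have [a <-] := gs c.
    by rewrite -linearD !hE pureDl qclassD.
  - have [m <-] := fs p; have [a' <-] := gs c'; have [a <-] := gs c.
    by rewrite -linearD !hE pureDr qclassD.
  - have [m <-] := fs p; have [a <-] := gs c.
    by rewrite -!linearZ !hE pureZ.
move=> t t0; apply/qclass_eq0.
rewrite -[RHS](tlift0 hb) -t0.
apply: (tensor_ext (f := qclass S) (g := fun t => tlift h (tmap f g t))).
- exact: qclassD.
- by move=> x y; rewrite tmapD (tliftD hb).
- by move=> m a; rewrite tmap_pure (tlift_pure hb) hE.
Qed.

Lemma tensor_exactl L M P A (i : {linear L -> M}) (q : {linear M -> P}) :
  (forall y, exists x, q x = y) -> (forall m, q m = 0 -> exists l, i l = m) ->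
  forall t : tensor M A, tmap q idfun t = 0 -> exists s, tmap i idfun s = t.
Proof.
move=> qs ex t t0.
have [|m a /ex[l <-]|m a /= ->|s _ <-] :=
    tensor_ker (S := range_tmap i (idfun : {linear A -> A})) qs _ _ _ t0; last by exists s.
- by move=> y; exists y.
- by exists (pure l a) => //; rewrite tmap_pure.
- by exists 0 => //; rewrite tmap0 pure0r.
Qed.

Lemma tensor_exactr L M P A (i : {linear L -> M}) (q : {linear M -> P}) :
  (forall y, exists x, q x = y) -> (forall m, q m = 0 -> exists l, i l = m) ->
  forall t : tensor A M, tmap idfun q t = 0 -> exists s, tmap idfun i s = t.
Proof.
move=> qs ex t t0.
have [|a m /= ->|a m /ex[l <-]|s _ <-] :=
    tensor_ker (S := range_tmap (idfun : {linear A -> A}) i) _ qs _ _ t0; last by exists s.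
- by move=> y; exists y.
- by exists 0 => //; rewrite tmap0 pure0l.
- by exists (pure a l) => //; rewrite tmap_pure.
Qed.

(** For M the target ring of f, viewed over its source, this unfolds to [flat f]; products and
    modules of sections call for the general form. *)
Definition flat_mod M : Prop := forall A B (u : {linear A -> B}),
  injective u -> injective (@tmap R M A M B idfun u).

(** The coefficient of [basis R i] is the image of x under the i-th coordinate map M (x) R^(I) -> M.
    Any list containing l0 is allowed, so that supports can be merged in the induction. *)
Lemma tensor_free_decomp M (I : choiceType) (x : tensor M (freem R I)) :
  exists l0 : seq I, forall l, uniq l -> {subset l0 <= l} ->
  x = \sum_(i <- l) pure (tlift (fun m (s : freem R I) => coef s i *: m) x) (basis R i).
Proof.
have hb i : balanced (fun (m : M) (s : freem R I) => coef s i *: m).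
  split=> [m m' s|m s s'|a m s]; first by rewrite scalerDr.
    by rewrite coefD scalerDl.
  by rewrite coefZ !scalerA mulrC.
elim/tensor_ind: x => [|m s x [l0 IH]].
  by exists [::] => l _ _; rewrite big1 // => i _; rewrite (tlift0 (hb i)) pure0l.
have [r ur rs] := freem_supp s.
exists (r ++ l0) => l ul sl.
have sE : pure m s = \sum_(i <- l) pure m (coef s i *: basis R i).
  rewrite -(morphD_sum (f := fun s => pure m s)); last by move=> u v; apply: pureDr.
  congr pure; apply: freem_decomp => // i /rs ir.
  by apply: sl; rewrite mem_cat ir.
have xE := IH l ul _.
under eq_bigr do rewrite (tliftD (hb _)) (tlift_pure (hb _)) pureDl pureZ.
rewrite big_split /= -sE -xE // => i il.
by apply: sl; rewrite mem_cat il orbT.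
Qed.

(** Free modules are flat: each coordinate of x is killed by the injection i, hence is zero. *)
Lemma tensor_free_inj L M (I : choiceType) (i : {linear L -> M}) :
  injective i -> injective (tmap i (idfun : {linear freem R I -> freem R I})).
Proof.
move=> ii; apply: morphD_inj => [|x x0]; first exact: tmapD.
have [l0 xE] := tensor_free_decomp x.
rewrite (xE (undup l0)) ?undup_uniq => [|//|j]; last by rewrite mem_undup.
rewrite big1 // => j _.
pose h N (m : N) (s : freem R I) := coef s j *: m.
have hb N : balanced (@h N).
  split=> [m m' s|m s s'|a m s]; first by rewrite /h scalerDr.
    by rewrite /h coefD scalerDl.
  by rewrite /h coefZ !scalerA mulrC.
suff -> : tlift (@h L) x = 0 by rewrite pure0l.
apply: ii; rewrite linear0 -(tlift0 (hb M)) -x0.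
apply: (tensor_ext (f := fun x => i (tlift (@h L) x))
  (g := fun x => tlift (@h M) (tmap i idfun x))) => [u v|u v|m s].
- by rewrite (tliftD (hb L)) linearD.
- by rewrite tmapD (tliftD (hb M)).
- by rewrite tmap_pure !(tlift_pure (hb _)) /h linearZ.
Qed.

(* Tor_1(P, A) = 0, read off a free presentation of A. *)
Lemma tensor_flat_inj L M P A (i : {linear L -> M}) (q : {linear M -> P}) :
  injective i -> (forall y, exists x, q x = y) ->
  (forall m, q m = 0 <-> exists l, i l = m) -> flat_mod P ->
  injective (tmap i (idfun : {linear A -> A})).
Proof.
move=> ii qs ex flP; apply: morphD_inj => [|x x0]; first exact: tmapD.
(* The presentation 0 -> K -> F -> A -> 0 with F free on the underlying set of A. *)
pose F := freem R A.
pose g0 : F -> A := free_sum (fun (a : A) (r : R) => r *: a).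
have gD : {morph g0 : x y / x + y}.
  by apply: free_sumD => a r s; apply: scalerDl.
have gb r a : g0 (r *: basis R a) = r *: a.
  by apply: free_sum_basis => b s t; apply: scalerDl.
have gL : linear g0.
  move=> r s t; rewrite gD; congr (_ + _).
  elim/freem_ind: s => [|b a s IH]; first by rewrite scaler0 (morphD0 gD) scaler0.
  by rewrite scalerDr !gD IH scalerA !gb scalerDr scalerA.
pose g := lin_of gL.
have gs y : exists x, g x = y by exists (1 *: basis R y); rewrite lin_ofE gb scale1r.
have K0 : [set s | g s = 0] 0 by apply: (linear0 g).
have KL a u v : g u = 0 -> g v = 0 -> g (a *: u + v) = 0.
  by move=> u0 v0; rewrite linearP u0 v0 scaler0 addr0.
pose K := submod_type (Submod K0 KL).
have kL : linear (val : K -> F) by [].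
pose ka := lin_of kL.
have kex s : g s = 0 -> exists t, ka t = s.
  by move=> s0; exists (submod_sub (S := Submod K0 KL) s0).
(* x lifts to y in L (x) F; the image of y in M (x) F dies in M (x) A, hence comes from some z in M
   (x) K. *)
have [y yx] := tmap_surj (f := (idfun : {linear L -> L})) (g := g)
  (fun y => ex_intro _ y erefl) gs x.
have [z zE] : exists z, tmap idfun ka z = tmap i idfun y.
  apply: (tensor_exactr gs kex).
  rewrite -[RHS]x0 -yx (tmap_comp (f2 := i) (g2 := g)) //.
  by rewrite (tmap_comp (f2 := i) (g2 := g)).
(* z dies in P (x) F because q i = 0, hence already in P (x) K by flatness of P; so it comes from L
   (x) K. *)
have [w wz] : exists w, tmap i idfun w = z.
  apply: (tensor_exactl qs) => [m /ex//|].
  apply: (flP _ _ ka); first exact: val_inj.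
  rewrite tmap0 (tmap_comp (f2 := q) (g2 := ka)) //.
  rewrite -(tmap_comp (f := idfun) (g := ka) (f' := q) (g' := idfun)) // zE.
  rewrite (tmap_comp (f2 := q \o i) (g2 := idfun)) //.
  by apply: tmap_zero; left=> l /=; apply/ex; exists l.
have yE : y = tmap idfun ka w.
  apply: (tensor_free_inj ii); rewrite -zE -wz.
  by rewrite !(tmap_comp (f2 := i) (g2 := ka)).
rewrite -yx yE (tmap_comp (f2 := idfun) (g2 := g \o ka)) //.
by apply: tmap_zero; right=> s; apply: (submod_valP s).
Qed.

(** Factor v through its image I: right exactness handles B -> I, flatness the inclusion of I in
    C. *)
Lemma flat_exact N A B C (u : {linear A -> B}) (v : {linear B -> C}) :
  flat_mod N -> (forall b, v b = 0 -> exists a, u a = b) ->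
  forall t : tensor N B, tmap idfun v t = 0 -> exists s, tmap idfun u s = t.
Proof.
move=> flN ex t t0.
have I0 : [set c | exists b, v b = c] 0 by exists 0; rewrite linear0.
have IL a c c' : (exists b, v b = c) -> (exists b, v b = c') ->
    exists b, v b = a *: c + c'.
  by move=> [b <-] [b' <-]; exists (a *: b + b'); rewrite linearP.
pose I := submod_type (Submod I0 IL).
pose v0 b : I := submod_sub (S := Submod I0 IL) (ex_intro _ b erefl).
have vL : linear v0 by move=> a b b'; apply: val_inj; rewrite /= linearP.
have iL : linear (val : I -> C) by [].
apply: (tensor_exactr (q := lin_of vL)) => [c|b /(congr1 val)/ex//|].
  by have [b bc] := submod_valP c; exists b; apply: val_inj.
apply: (flN _ _ (lin_of iL)); first exact: val_inj.
by rewrite tmap0 (tmap_comp (f2 := idfun) (g2 := v)).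
Qed.

End TensorTheory.

(** * Enough injective modules *)

Lemma pairMz (V W : zmodType) (x : V) (y : W) (k : int) :
  (x, y) *~ k = (x *~ k, y *~ k).
Proof.
have pn n : (x, y) *+ n = (x *+ n, y *+ n).
  by elim: n => [|n IH]; rewrite ?mulr0n // !mulrS IH.
by case: k => n; rewrite ?NegzE ?mulrNz // -!pmulrn pn.
Qed.

Section DivisibleExtension.
Variables (B D : zmodType).
Hypothesis divD : forall (d : D) n, (0 < n)%N -> exists e, e *+ n = d.

Lemma zsubMz (V : zmodType) (S : zsubgroup V) (v : V) (m : int) :
  S v -> S (v *~ m).
Proof.
move=> Sv; have SvN n : S (v *+ n).
  elim: n => [|n IH]; first exact: zsub0.
  by rewrite mulrS; apply: zsubD.
by case: m => n; rewrite ?NegzE ?mulrNz //; [apply: SvN | apply/zsubN/SvN].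
Qed.

Definition functional_graph (S : zsubgroup (B * D)%type) : Prop :=
  forall d, S (0, d) -> d = 0.

Lemma functional_graph_eq (S : zsubgroup (B * D)%type) b d d' :
  functional_graph S -> S (b, d) -> S (b, d') -> d = d'.
Proof.
move=> fS Sd Sd'; apply/subr0_eq/fS.
by have := zsubB Sd Sd'; rewrite /= -[X in S X]/(b - b, d - d') subrr.
Qed.

(** The m with m b in the domain form an ideal n0 Z. A value e for b is consistent as soon as n0 e
    is the value at n0 b, and divisibility provides such an e. *)
Lemma functional_graph_extend (S : zsubgroup (B * D)%type) (b : B) :
  functional_graph S -> exists S' : zsubgroup (B * D)%type,
    [/\ functional_graph S', (forall x, S x -> S' x) & exists d, S' (b, d)].
Proof.
move=> fS; have [e eP] : exists e : D, forall m c, S (b *~ m, c) -> c = e *~ m.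
  have SN n c : S (b *~ n, c) -> S (b *~ - n, - c).
    by move=> /zsubN; rewrite mulrNz.
  have [ex|nex] := pselect (exists n, `[< (0 < n)%N /\ exists d, S (b *+ n, d) >]).
    case: (ex_minnP ex) => n0 /asboolP[n0_gt0 [d0 Sd0]] n0_min.
    have [e ed] := divD d0 n0_gt0; exists e => m c Sc.
    pose q := (m %/ n0)%Z; pose r := `|(m %% n0)%Z|%N.
    have mE : m = q * n0%:Z + r.
      by rewrite {1}(divz_eq m n0) /r gez0_abs // modz_ge0 // eqz_nat -lt0n.
    have Sq : S (b *~ (q * n0%:Z), e *~ (q * n0%:Z)).
      by have := zsubMz q Sd0; rewrite pairMz ![q * _]mulrC !mulrzA -ed.
    have r0 : r = 0%N.
      apply: contrapT => /eqP; rewrite -lt0n => r_gt0.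
      suff /n0_min : `[< (0 < r)%N /\ exists d, S (b *+ r, d) >].
        have : (r < n0)%N; last by rewrite ltnNge => /negPf ->.
        by rewrite -ltz_nat gez0_abs ?ltz_pmod // modz_ge0 // eqz_nat -lt0n.
      apply/asboolP; split=> //; exists (c - e *~ (q * n0%:Z)).
      have -> : b *+ r = b *~ m - b *~ (q * n0%:Z).
        by rewrite -mulrzBr {1}mE addrAC subrr add0r.
      exact: (zsubB Sc Sq).
    by apply: (functional_graph_eq fS Sc); rewrite mE r0 addr0.
  (* No positive multiple of b lies in the domain, so b can take any value. *)
  exists 0 => m c Sc; rewrite mul0rz.
  have [m0|m0] := eqVneq m 0; first by apply: fS; move: Sc; rewrite m0 mulr0z.
  exfalso; apply: nex; case: m Sc m0 => n Sc m0.
    by exists n; apply/asboolP; split; [rewrite lt0n | exists c].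
  exists n.+1; apply/asboolP; split=> //; exists (- c).
  by move: (SN _ _ Sc); rewrite NegzE opprK.
pose S' := [set u : (B * D)%type | exists x m, S x /\ u = x + (b *~ m, e *~ m)].
have S'0 : S' 0.
  by exists 0, 0; split; [apply: zsub0 | rewrite !mulr0z addr0].
have S'B u v : S' u -> S' v -> S' (u - v).
  move=> [x [m [Sx ->]]] [y [n [Sy ->]]]; exists (x - y), (m - n).
  split; first exact: zsubB.
  by rewrite opprD addrACA !mulrzBr.
exists (ZSubgroup S'0 S'B); split.
- move=> d [[x y] [m [Sx [xE yE]]]].
  have xN : x = - (b *~ m) by apply/eqP; rewrite -addr_eq0 -xE.
  by rewrite yE (eP (- m) y) mulrNz ?addNr // -xN.
- by move=> x Sx; exists x, 0; split=> //; rewrite !mulr0z addr0.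
- by exists e, 0, 1; split; [apply: zsub0 | rewrite !mulr1z add0r].
Qed.

Lemma divisible_extension (S0 : zsubgroup (B * D)%type) :
  functional_graph S0 -> exists f : B -> D, {morph f : x y / x + y} /\
    forall b d, S0 (b, d) -> f b = d.
Proof.
move=> fS0.
(* S0 is added to A so that the union of the empty chain is admissible too. *)
pose P (A : set (B * D)) := exists S : zsubgroup (B * D)%type,
  functional_graph S /\ forall x, S x <-> A x \/ S0 x.
have [F FP Ftot|A [[S [fS SE]] Smax]] := @Zorn_bigcup _ P.
  pose U := [set x | (\bigcup_(X in F) X) x \/ S0 x].
  have U1 x y : U x -> U y ->
      exists S : zsubgroup (B * D)%type, [/\ functional_graph S, S x, S y & S `<=` U].
    have U2 X : F X -> exists S : zsubgroup (B * D)%type,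
        [/\ functional_graph S, X `<=` S, S0 `<=` S & S `<=` U].
      move=> FX; have [S [fS SE]] := FP X FX; exists S; split=> // z.
      - by move=> ?; apply/SE; left.
      - by move=> ?; apply/SE; right.
      - by move=> /SE[Xz|]; [left; exists X | right].
    move=> [[X FX Xx]|Sx] [[Y FY Yy]|Sy].
    - by have [XY|YX] := Ftot X Y FX FY; [have [S []] := U2 Y FY | have [S []] := U2 X FX];
        exists S; split=> //; auto.
    - by have [S []] := U2 X FX; exists S; split; auto.
    - by have [S []] := U2 Y FY; exists S; split; auto.
    - by exists S0; split=> // z; right.
  have U0 : U 0 by right; apply: zsub0.
  have UB x y : U x -> U y -> U (x - y).
    by move=> Ux Uy; have [S [_ Sx Sy]] := U1 x y Ux Uy; apply; apply: zsubB.
  exists (ZSubgroup U0 UB); split=> // d Ud.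
  by have [S [fS Sd _ _]] := U1 _ _ Ud Ud; apply: fS.
have tot b : exists d, S (b, d).
  have [S' [fS' SS' [d Sd]]] := functional_graph_extend b fS.
  apply: contrapT => nS; apply: (Smax S').
    split; first by move=> x Ax; apply: SS'; apply/SE; left.
    by apply: contra_not nS => S'A; exists d; apply/SE; left; apply: S'A.
  exists S'; split=> // x; split; first by left.
  by case=> // S0x; apply: SS'; apply/SE; right.
have [f fE] := choice tot; exists f; split=> [x y|b d Sd].
  by apply: (functional_graph_eq fS (fE _)); apply: (zsubD (fE x) (fE y)).
by apply: (functional_graph_eq fS (fE _)); apply/SE; right.
Qed.

End DivisibleExtension.

(** * Q/Z as a divisible group that separates points *)

Section RationalCircle.

Fact int_in_rat_subproof (u v : rat) :
  (exists z : int, u = z%:~R) -> (exists z : int, v = z%:~R) ->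
  exists z : int, u - v = z%:~R.
Proof. by move=> [z ->] [t ->]; exists (z - t); rewrite rmorphB. Qed.

Definition int_in_rat : zsubgroup rat :=
  @ZSubgroup rat [set u | exists z : int, u = z%:~R] (ex_intro _ 0 erefl)
    int_in_rat_subproof.

Definition qz : zmodType := zquot int_in_rat.

Lemma qz_classMn u n : qclass int_in_rat u *+ n = qclass int_in_rat (u *+ n).
Proof.
elim: n => [|n IH]; first by rewrite !mulr0n.
by rewrite !mulrS IH -qclassD.
Qed.

Lemma qz_divisible (d : qz) n : (0 < n)%N -> exists e, e *+ n = d.
Proof.
move=> n_gt0; rewrite -[d]qreprK.
exists (qclass int_in_rat (qrepr d / n%:R)).
by rewrite qz_classMn -[X in qclass _ X]mulr_natr divfK // pnatr_eq0 -lt0n.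
Qed.

Lemma qz_torsion n : (1 < n)%N -> exists2 e : qz, e != 0 & e *+ n = 0.
Proof.
move=> n_gt1; have n0 : n%:R != 0 :> rat by rewrite pnatr_eq0 -lt0n ltnW.
exists (qclass int_in_rat n%:R^-1).
  apply/eqP => /qclass_eq0[z zE].
  have /eqP := congr1 ( *%R n%:R) zE; rewrite divff // -[n%:R]/(n%:Z%:~R).
  rewrite -intrM -[1]/(1%:~R) eqr_int => /eqP/esym nz.
  have : (n%:Z %| 1)%Z by apply/dvdzP; exists z; rewrite mulrC.
  by rewrite dvdzE /= dvdn1 => /eqP n1; move: n_gt1; rewrite n1.
by rewrite qz_classMn -[X in qclass _ X]mulr_natr mulVf //; apply/qclass_eq0; exists 1.
Qed.

(** The subgroup Z m has a map to Q/Z that is nonzero at m, and divisibility of Q/Z extends it to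
    M. *)
Lemma qz_separates (M : zmodType) (m : M) : m <> 0 ->
  exists f : M -> qz, {morph f : x y / x + y} /\ f m <> 0.
Proof.
move=> m0.
have [e e0 eP] : exists2 e : qz, e != 0 & forall k, m *~ k = 0 -> e *~ k = 0.
  have [ex|nex] := pselect (exists n, (0 < n)%N && (m *+ n == 0)).
    case: (ex_minnP ex) => n /andP[n_gt0 /eqP mn] n_min.
    have n1 : (1 < n)%N.
      rewrite ltn_neqAle n_gt0 andbT; apply/eqP => n1.
      by apply: m0; rewrite -mn -n1 mulr1n.
    have [e e0 en] := qz_torsion n1; exists e => // k mk.
    have kE := divz_eq k n; set r := (k %% n)%Z in kE.
    have rE : r = `|r|%N by rewrite gez0_abs // modz_ge0 // eqz_nat -lt0n.
    have mr : m *+ `|r|%N = 0.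
      move: mk; rewrite kE mulrzDr mulrC mulrzA -pmulrn mn mul0rz add0r.
      by rewrite {1}rE -pmulrn.
    have r0 : `|r|%N = 0%N.
      apply: contrapT => /eqP; rewrite -lt0n => r_gt0.
      have := n_min `|r|%N; rewrite r_gt0 mr eqxx => /(_ isT).
      apply/negP; rewrite -ltnNge -ltz_nat -rE ltz_pmod //.
    by rewrite kE rE r0 addr0 mulrC mulrzA -pmulrn en mul0rz.
  (* m has infinite order: any nonzero class will do, and the class of 1/2 is one. *)
  have [e e0 _] := @qz_torsion 2 isT; exists e => // -[] n mk.
    case: n mk => [|n] mk; first by rewrite mulr0z.
    by case: nex; exists n.+1; apply/eqP.
  case: nex; exists n.+1; apply/eqP.
  by apply: oppr_inj; rewrite oppr0 -mk NegzE mulrNz.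
pose S := [set u : (M * qz)%type | exists k, u = (m *~ k, e *~ k)].
have S0 : S 0 by exists 0; rewrite !mulr0z.
have SB u v : S u -> S v -> S (u - v).
  by move=> [k ->] [l ->]; exists (k - l); rewrite !mulrzBr.
have [|f [fD fE]] := divisible_extension qz_divisible (S0 := ZSubgroup S0 SB).
  by move=> d [k [mk ->]]; apply: eP.
exists f; split=> //; rewrite (fE m e); first exact/eqP.
by exists 1; rewrite !mulr1z.
Qed.

End RationalCircle.

(** * Coinduced modules and embeddings into injective modules *)

Section Injectives.

Record addfun (V W : zmodType) := AddFun {
  addfun_fun :> V -> W;
  addfunD : {morph addfun_fun : x y / x + y} }.

HB.instance Definition _ V W := gen_eqMixin (addfun V W).
HB.instance Definition _ V W := gen_choiceMixin (addfun V W).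

Lemma addfun_eq (V W : zmodType) (f g : addfun V W) : f =1 g -> f = g.
Proof.
case: f g => [f fD] [g gD] /= /funext fg; subst g.
by rewrite (Prop_irrelevance fD gD).
Qed.

Section Coinduced.
Variables (R : comPzRingType) (D : zmodType).

(** Hom_Z(R, D), with R acting through the argument. *)
Definition coind : Type := addfun R D.
HB.instance Definition _ := Choice.on coind.
Implicit Types f g h : coind.

Fact coind_add_subproof f g : {morph (fun r => f r + g r) : x y / x + y}.
Proof. by move=> x y; rewrite !addfunD addrACA. Qed.
Fact coind_opp_subproof f : {morph (fun r => - f r) : x y / x + y}.
Proof. by move=> x y; rewrite addfunD opprD. Qed.
Fact coind_zero_subproof : {morph (fun r : R => 0 : D) : x y / x + y}.
Proof. by move=> x y; rewrite addr0. Qed.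
Fact coind_scale_subproof (a : R) f : {morph (fun r => f (a * r)) : x y / x + y}.
Proof. by move=> x y; rewrite mulrDr addfunD. Qed.

Let addc f g : coind := AddFun (@coind_add_subproof f g).
Let oppc f : coind := AddFun (@coind_opp_subproof f).
Let zeroc : coind := AddFun coind_zero_subproof.
Let scalec a f : coind := AddFun (@coind_scale_subproof a f).

Fact coind_addA : associative addc.
Proof. by move=> f g h; apply/addfun_eq => r; apply: addrA. Qed.
Fact coind_addC : commutative addc.
Proof. by move=> f g; apply/addfun_eq => r; apply: addrC. Qed.
Fact coind_add0 : left_id zeroc addc.
Proof. by move=> f; apply/addfun_eq => r; apply: add0r. Qed.
Fact coind_addN : left_inverse zeroc oppc addc.
Proof. by move=> f; apply/addfun_eq => r; apply: addNr. Qed.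
HB.instance Definition _ := GRing.isZmodule.Build coind
  coind_addA coind_addC coind_add0 coind_addN.

Fact coind_scaleA a b f : scalec a (scalec b f) = scalec (a * b) f.
Proof. by apply/addfun_eq => r /=; rewrite mulrA [b * a]mulrC. Qed.
Fact coind_scale1 : left_id 1 scalec.
Proof. by move=> f; apply/addfun_eq => r /=; rewrite mul1r. Qed.
Fact coind_scaleDr : right_distributive scalec +%R.
Proof. by move=> a f g; apply/addfun_eq. Qed.
Fact coind_scaleDl f : {morph scalec^~ f : a b / a + b}.
Proof. by move=> a b; apply/addfun_eq => r /=; rewrite mulrDl addfunD. Qed.
HB.instance Definition _ := GRing.Zmodule_isLmodule.Build R coind
  coind_scaleA coind_scale1 coind_scaleDr coind_scaleDl.

Definition coind_eval (f : coind) (r : R) : D := f r.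
Lemma coind_eq (f g : coind) : coind_eval f =1 coind_eval g -> f = g.
Proof. exact: addfun_eq. Qed.
Lemma coind_evalD f g r : coind_eval (f + g) r = coind_eval f r + coind_eval g r.
Proof. by []. Qed.
Lemma coind_evalZ a f r : coind_eval (a *: f) r = coind_eval f (a * r).
Proof. by []. Qed.

End Coinduced.

Definition injective_mod (R : comPzRingType) (E : lmodType R) : Prop :=
  forall (A B : lmodType R) (i : A -> B) (g : A -> E), linear i -> linear g ->
  injective i -> exists2 h : B -> E, linear h & forall a, h (i a) = g a.

(* Hom_R(A, Hom_Z(R, D)) = Hom_Z(A, D). *)
Lemma injective_coind (R : comPzRingType) (D : zmodType) :
  (forall (d : D) n, (0 < n)%N -> exists e, e *+ n = d) ->
  injective_mod (coind R D).
Proof.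
move=> divD A B i g iL gL ii.
have iD := linear_morphD iL.
pose S := [set u : (B * D)%type | exists a, u = (i a, coind_eval (g a) 1)].
have gD a b : coind_eval (g (a - b)) 1 = coind_eval (g a) 1 - coind_eval (g b) 1.
  by rewrite (morphDB (linear_morphD gL)).
have S0 : S 0 by exists 0; rewrite (morphD0 iD) (linear_morph0 gL).
have SB u v : S u -> S v -> S (u - v).
  by move=> [a ->] [b ->]; exists (a - b); rewrite gD (morphDB iD).
have [|f [fD fE]] := divisible_extension divD (S0 := ZSubgroup S0 SB).
  move=> d [a [a0 ->]]; have -> : a = 0 by apply: ii; rewrite -a0 (morphD0 iD).
  by rewrite (linear_morph0 gL).
have hD b : {morph (fun r : R => f (r *: b)) : x y / x + y}.
  by move=> x y; rewrite scalerDl fD.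
exists (fun b => AddFun (hD b) : coind R D) => [r b c|a]; apply: coind_eq => s.
  by rewrite coind_evalD coind_evalZ /coind_eval /= scalerDr fD scalerA mulrC.
rewrite {1}/coind_eval /= -(linear_scale iL) (fE _ (coind_eval (g (s *: a)) 1)).
  by rewrite (linear_scale gL) coind_evalZ mulr1.
by exists (s *: a).
Qed.

Lemma dprod_choice (I : Type) (T : I -> Type) (P : forall i, T i -> Prop) :
  (forall i, exists x, P i x) -> exists f : forall i, T i, forall i, P i (f i).
Proof.
by move=> ex; exists (fun i => sval (cid (ex i))) => i; apply: (svalP (cid (ex i))).
Qed.

Lemma injective_dprod (R : comPzRingType) (I : Type) (E : I -> lmodType R) :
  (forall i, injective_mod (E i)) -> injective_mod (dprod E).
Proof.
move=> injE A B u g uL gL ui.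
have [i|h hP] := @dprod_choice I (fun i => B -> E i)
    (fun i h => linear h /\ forall a, h (u a) = g a i).
  have [r a b|h hL hE] := @injE i A B u (fun a => g a i) uL _ ui.
    by rewrite gL.
  by exists h.
exists (fun b i => h i b) => [r a b|a]; apply: dprod_eq => i; last by case: (hP i).
by rewrite (hP i).1.
Qed.

Section Hull.
Variables (R : comPzRingType) (M : lmodType R).

(** Not a minimal injective extension: one factor Hom_Z(R, Q/Z) for every additive f : M -> Q/Z, so
    that M embeds because Q/Z separates its points. *)
Definition injhull : Type := dprod (fun f : addfun M qz => coind R qz).
HB.instance Definition _ := GRing.Lmodule.on injhull.

Fact injhull_emb_subproof (f : addfun M qz) (m : M) :
  {morph (fun r : R => f (r *: m)) : x y / x + y}.
Proof. by move=> x y; rewrite scalerDl addfunD. Qed.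

Definition injhull_emb (m : M) : injhull :=
  fun f => AddFun (injhull_emb_subproof f m).

Lemma injhull_injective : injective_mod injhull.
Proof. by apply: injective_dprod => f; apply/injective_coind/qz_divisible. Qed.

Lemma injhull_emb_linear : linear injhull_emb.
Proof.
move=> a x y; apply: dprod_eq => f; apply: coind_eq => r.
rewrite dprodD dprodZ coind_evalD coind_evalZ /coind_eval /=.
by rewrite scalerDr addfunD scalerA mulrC.
Qed.

Lemma injhull_emb_inj : injective injhull_emb.
Proof.
apply: (morphD_inj (linear_morphD injhull_emb_linear)) => x x0.
apply: contrapT => /qz_separates[f [fD fx]]; apply: fx.
have := congr1 (fun e : injhull => coind_eval (e (AddFun fD)) 1) x0.
by rewrite /coind_eval /= scale1r.
Qed.

End Hull.

End Injectives.

(** * Sheaves of modules on finite spaces *)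

Section OpenLemmas.
Variable X : topologicalType.

Lemma opn_eq (U V : opn X) : U = V :> set X -> U = V.
Proof.
case: U V => [U oU] [V oV] /= UV; subst V.
by rewrite (Prop_irrelevance oU oV).
Qed.

Definition opnI (U V : opn X) : opn X := Opn (openI (oset_open U) (oset_open V)).

Lemma opnIl (U V : opn X) : opnI U V `<=` U. Proof. by move=> x []. Qed.
Lemma opnIr (U V : opn X) : opnI U V `<=` V. Proof. by move=> x []. Qed.

Lemma spec_le_refl (x : X) : spec_le x x.
Proof. exact: umin_set_refl. Qed.

Lemma spec_le_open (U : opn X) x y : spec_le x y -> oset U x -> oset U y.
Proof. by move=> xy Ux; apply: (umin_set_sub (oset_open U) Ux). Qed.

Lemma spec_le_trans (y x z : X) : spec_le x y -> spec_le y z -> spec_le x z.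
Proof. by move=> xy yz V [oV Vx]; apply: yz; split=> //; apply: xy. Qed.

Variable finX : finite_set [set: X].

Definition umin_sub (V : opn X) x (Vx : oset V x) : umin finX x `<=` V :=
  umin_set_sub (oset_open V) Vx.

Lemma umin_refl x : oset (umin finX x) x.
Proof. exact: umin_set_refl. Qed.

Lemma umin_coverE (V : opn X) :
  V `<=` \bigcup_(w : {x | oset V x}) umin finX (sval w).
Proof. by move=> x Vx; exists (exist _ x Vx) => //; apply: umin_refl. Qed.

End OpenLemmas.
Arguments umin_sub {X} finX {V x} Vx.
Arguments umin_refl {X} finX x.

Section SheafOfModules.
Variables (X : topologicalType) (finX : finite_set [set: X]) (O : ringSheaf X).
Variables (le : X -> X -> Prop).
Hypothesis le_open : forall (W : opn X) x y, le x y -> oset W x -> oset W y.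
Variables (H : forall x, lmodType (O (umin finX x))).
Variables (tr : forall x y, le x y -> H x -> H y).
Hypothesis trL : forall x y (xy : le x y) (h : umin finX y `<=` umin finX x) a s t,
  tr xy (a *: s + t) = rres h a *: tr xy s + tr xy t.

(** The relation [le] is a parameter: the specialization order serves to glue a functorial system of
    stalks, the empty relation to form products of skyscrapers. *)
Definition sys_fam (V : opn X) : Type := dprod (fun w : {x | oset V x} =>
  rscal (@rres X O V _ (umin_sub finX (svalP w))) (H (sval w))).
HB.instance Definition _ V := GRing.Lmodule.on (sys_fam V).

Let le_umin x y (xy : le x y) : umin finX y `<=` umin finX x.
Proof. by apply: umin_sub; apply: le_open xy _; apply: umin_refl. Qed.

Definition sys_compat (V : opn X) : set (sys_fam V) :=
  [set s | forall w w' (h : le (sval w) (sval w')), tr h (s w) = s w'].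

Let tr0 x y (xy : le x y) : tr xy 0 = 0.
Proof.
apply: (addrI (tr xy 0)); rewrite addr0.
by have := trL xy (le_umin xy) 1 0 0; rewrite rmorph1 !scale1r addr0.
Qed.

Fact sys_compat0 V : @sys_compat V 0.
Proof. by move=> w w' h; apply: tr0. Qed.

Fact sys_compatL V (a : O V) (s t : sys_fam V) :
  sys_compat s -> sys_compat t -> sys_compat (a *: s + t).
Proof.
move=> cs ct w w' h; rewrite !dprodD !dprodZ !rscalE (trL _ (le_umin h)) cs ct.
by rewrite (rres_comp _ _ (umin_sub finX (svalP w'))).
Qed.

Definition sys_submod V := Submod (@sys_compat0 V) (@sys_compatL V).
Notation sec V := (submod_type (sys_submod V)).

Definition sys_val (V : opn X) (s : sec V) x (Vx : oset V x) : H x :=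
  val s (exist _ x Vx).

Lemma sys_valL V (a : O V) (s t : sec V) x (Vx : oset V x) :
  sys_val (a *: s + t) Vx =
  rres (umin_sub finX Vx) a *: sys_val s Vx + sys_val t Vx.
Proof.
rewrite -[LHS]/(rres (umin_sub finX (svalP (exist _ x Vx))) a *: sys_val s Vx
  + sys_val t Vx).
by congr (rres _ a *: _ + _); apply: Prop_irrelevance.
Qed.

Lemma sys_val_irr V (s : sec V) x (h h' : oset V x) : sys_val s h = sys_val s h'.
Proof. by rewrite (Prop_irrelevance h h'). Qed.

Lemma sys_valP V (s : sec V) x y (xy : le x y) (Vx : oset V x) (Vy : oset V y) :
  tr xy (sys_val s Vx) = sys_val s Vy.
Proof. exact: (submod_valP s (exist _ x Vx) (exist _ y Vy) xy). Qed.

Definition sys_sec (V : opn X) (f : forall x, oset V x -> H x)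
    (fc : forall x y (xy : le x y) (Vx : oset V x) (Vy : oset V y),
      tr xy (f x Vx) = f y Vy) : sec V :=
  submod_sub (S := sys_submod V) (v := (fun w => f _ (proj2_sig w) : H (sval w)))
    (fun w w' h => fc _ _ h (proj2_sig w) (proj2_sig w')).

Lemma sys_secE V f fc x (Vx : oset V x) : sys_val (@sys_sec V f fc) Vx = f x Vx.
Proof. by []. Qed.

Lemma sys_eq V (s t : sec V) :
  (forall x (Vx : oset V x), sys_val s Vx = sys_val t Vx) -> s = t.
Proof. by move=> st; apply/val_inj/dprod_eq => -[x Vx]; apply: st. Qed.

Fact sys_res_subproof (V W : opn X) (h : W `<=` V) (s : sec V) x y (xy : le x y)
    (Wx : oset W x) (Wy : oset W y) :
  tr xy (sys_val s (h x Wx)) = sys_val s (h y Wy).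
Proof. exact: sys_valP. Qed.

Definition sys_res (V W : opn X) (h : W `<=` V) (s : sec V) : sec W :=
  sys_sec (@sys_res_subproof V W h s).

Fact sys_resL (V W : opn X) (h : W `<=` V) (a : O V) s t :
  sys_res h (a *: s + t) = rres h a *: sys_res h s + sys_res h t.
Proof.
apply: sys_eq => x Wx.
rewrite [RHS]sys_valL -[LHS]/(sys_val (a *: s + t) (h x Wx)) sys_valL.
by rewrite (rres_comp _ _ (umin_sub finX (h x Wx))).
Qed.

Fact sys_res_id (V : opn X) (h : V `<=` V) s : sys_res h s = s.
Proof. by apply: sys_eq => x Vx; apply: (sys_val_irr s (h x Vx) Vx). Qed.

Fact sys_res_comp (U V W : opn X) (hV : V `<=` U) (hW : W `<=` V)
  (hWU : W `<=` U) s : sys_res hW (sys_res hV s) = sys_res hWU s.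
Proof. by apply: sys_eq => x Wx; apply: (sys_val_irr s (hV x (hW x Wx)) (hWU x Wx)). Qed.

Fact sys_glue (U : opn X) (I : Type) (V : I -> opn X)
    (hV : forall i, V i `<=` U) : U `<=` \bigcup_i V i ->
    forall s : (forall i, sec (V i)),
    (forall i j (W : opn X) (hi : W `<=` V i) (hj : W `<=` V j),
       sys_res hi (s i) = sys_res hj (s j)) ->
    exists! t : sec U, forall i, sys_res (hV i) t = s i.
Proof.
move=> cov s sc.
have sE i j x (hi : oset (V i) x) (hj : oset (V j) x) :
    sys_val (s i) hi = sys_val (s j) hj.
  have := congr1 (fun t : sec (umin finX x) => sys_val t (umin_refl finX x))
    (sc i j (umin finX x) (umin_sub finX hi) (umin_sub finX hj)).
  rewrite (sys_secE _ (umin_refl finX x)) (sys_secE _ (umin_refl finX x)) => e.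
  rewrite (sys_val_irr _ hi (umin_sub finX hi x (umin_refl finX x))) e.
  exact: sys_val_irr.
pose ix x (Ux : oset U x) : {i | oset (V i) x} :=
  cid (let: ex_intro2 i _ Vi := cov _ Ux in ex_intro _ i Vi).
pose f x (Ux : oset U x) : H x := sys_val (s (sval (ix x Ux))) (svalP (ix x Ux)).
have fE i x (Ux : oset U x) (hi : oset (V i) x) : f x Ux = sys_val (s i) hi.
  exact: sE.
have fc x y (xy : le x y) (Ux : oset U x) (Uy : oset U y) : tr xy (f x Ux) = f y Uy.
  have hx := svalP (ix x Ux); have hy := le_open xy hx.
  by rewrite (fE _ _ _ hx) (fE _ _ _ hy); apply: sys_valP.
exists (sys_sec fc); split=> [i|t tE]; apply: sys_eq => x hx.
  exact: fE.
have [i _ Vi] := cov _ hx; rewrite (sys_secE _ hx) (fE i x hx Vi) -tE.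
exact: (sys_val_irr t (hV i x Vi) hx).
Qed.

Definition sys_sheaf : modSheaf O :=
  ModSheaf sys_resL sys_res_id sys_res_comp sys_glue.

End SheafOfModules.

Section LocalOnMinimal.
Variables (X : topologicalType) (finX : finite_set [set: X]) (O : ringSheaf X).

(** A predicate, instead of the open set [umin finX x] itself: traces and preimages of minimal open
    sets often are minimal without having that form syntactically. *)
Definition minimal_at (P : opn X) x : Prop := P = umin_set x :> set X.

Lemma minimal_umin x : minimal_at (umin finX x) x. Proof. by []. Qed.

(** The only open neighbourhood of x inside a minimal open set at x is that set. Thus epimorphisms
    and exactness of sheaves become surjectivity and exactness of sections there. *)
Lemma locally_in_minimal (M : modSheaf O) (Pr : forall U : opn X, set (M U))
    (P : opn X) x (s : M P) :
  minimal_at P x -> locally_in Pr s -> Pr P s.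
Proof.
move=> Px ls; have [|V [h [Vx PrV]]] := ls x.
  by rewrite Px; apply: umin_set_refl.
have VP : V = P.
  apply: opn_eq; apply/seteqP; split=> //; rewrite Px.
  exact: umin_set_sub (oset_open V) Vx.
by subst V; move: PrV; rewrite mres_id.
Qed.

Lemma locally_inP (M : modSheaf O) (Pr : forall U : opn X, set (M U))
    (U : opn X) (s : M U) :
  (forall x (Ux : oset U x), Pr (umin finX x) (mres (umin_sub finX Ux) s)) ->
  locally_in Pr s.
Proof.
move=> PrU x Ux; exists (umin finX x), (umin_sub finX Ux); split=> //.
exact: umin_refl.
Qed.

Lemma locally_in_res (M : modSheaf O) (Pr : forall U : opn X, set (M U))
    (U V : opn X) (h : V `<=` U) (s : M U) :
  (forall (V W : opn X) (h : W `<=` V) (s : M V), Pr V s -> Pr W (mres h s)) ->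
  locally_in Pr s -> locally_in Pr (mres h s).
Proof.
move=> PrR ls x Vx; have [W [hW [Wx PrW]]] := ls x (h x Vx).
exists (opnI V W), (@opnIl _ V W); split; first by split.
rewrite (mres_comp _ _ (subset_trans (@opnIr _ V W) hW)).
by rewrite -(mres_comp hW (@opnIr _ V W)); apply: PrR.
Qed.

Lemma msep_umin (M : modSheaf O) (V : opn X) (s t : M V) :
  (forall x (Vx : oset V x), mres (umin_sub finX Vx) s = mres (umin_sub finX Vx) t) ->
  s = t.
Proof.
by move=> st; apply: (msep (hV := fun w : {x | oset V x} => umin_sub finX (proj2_sig w)))
  (@umin_coverE _ finX V) _ => -[x Vx]; apply: st.
Qed.

End LocalOnMinimal.

(** * Injective resolutions and cohomology sheaves *)

Section QuotientMap.
Variables (R R' : comPzRingType) (V : lmodType R) (W : lmodType R').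
Variables (S : submod V) (S' : submod W) (f : V -> W).
Hypothesis fD : {morph f : x y / x + y}.
Hypothesis fS : forall v, submod_set S v -> submod_set S' (f v).

Definition lquot_map (x : lquot S) : lquot S' := lclass S' (f (qrepr x)).

Lemma lquot_mapE v : lquot_map (lclass S v) = lclass S' (f v).
Proof.
apply/(qclassP (zsub_of_submod S')); rewrite -(morphDB fD); apply: fS.
exact/(qclassP (zsub_of_submod S))/qreprK.
Qed.

End QuotientMap.

Section Resolutions.
Variables (X : topologicalType) (finX : finite_set [set: X]) (O : ringSheaf X).
Implicit Types (M A B : modSheaf O).
Notation U_ := (umin finX).

Lemma range_hom_res A B (g : modHom A B) (V W : opn X) (h : W `<=` V) (s : B V) :
  range (g V) s -> range (g W) (mres h s).
Proof. by move=> [t _ <-]; exists (mres h t) => //; rewrite hom_res. Qed.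

Section Skyscrapers.
Variable E : forall x, lmodType (O (U_ x)).

Let nole (x y : X) : Prop := False.
Let nole_open (W : opn X) x y : nole x y -> oset W x -> oset W y.
Proof. by []. Qed.
Let notr x y (xy : nole x y) : E x -> E y := match xy with end.
Let notrL x y (xy : nole x y) (h : U_ y `<=` U_ x) a s t :
  notr xy (a *: s + t) = rres h a *: notr xy s + notr xy t.
Proof. by []. Qed.

(* With the empty relation as order there is no compatibility condition, and
   one gets the product of the skyscraper sheaves with stalks E x. *)
Definition skysheaf : modSheaf O := sys_sheaf nole_open notrL.

Definition sky_val (V : opn X) (s : skysheaf V) x (Vx : oset V x) : E x :=
  sys_val s Vx.

Definition sky_sec (V : opn X) (f : forall x, oset V x -> E x) : skysheaf V :=
  @sys_sec X finX O nole nole_open E notr notrL V f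
    (fun x y (xy : nole x y) _ _ => match xy with end).

Lemma sky_secE V f x (Vx : oset V x) : sky_val (@sky_sec V f) Vx = f x Vx.
Proof. by []. Qed.

Lemma sky_eq V (s t : skysheaf V) :
  (forall x (Vx : oset V x), sky_val s Vx = sky_val t Vx) -> s = t.
Proof. exact: sys_eq. Qed.

Lemma sky_valL V (a : O V) (s t : skysheaf V) x (Vx : oset V x) :
  sky_val (a *: s + t) Vx =
  rres (umin_sub finX Vx) a *: sky_val s Vx + sky_val t Vx.
Proof. exact: sys_valL. Qed.

Lemma sky_val_res (V W : opn X) (h : W `<=` V) (s : skysheaf V) x (Wx : oset W x) :
  sky_val (mres h s) Wx = sky_val s (h x Wx).
Proof. by []. Qed.

Section Hom.
Variables (M : modSheaf O) (phi : forall x, M (U_ x) -> E x).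
Hypothesis phiL : forall x, linear (@phi x).

Definition sky_map (V : opn X) (s : M V) : skysheaf V :=
  sky_sec (fun x Vx => phi (mres (umin_sub finX Vx) s)).

Fact sky_mapL V : linear (@sky_map V).
Proof.
move=> a s t; apply: sky_eq => x Vx.
by rewrite sky_valL !sky_secE mresL phiL.
Qed.

Fact sky_map_res (V W : opn X) (h : W `<=` V) s :
  sky_map (mres h s) = mres h (sky_map s).
Proof.
apply: sky_eq => x Wx; rewrite sky_val_res !sky_secE.
by rewrite (mres_comp _ _ (umin_sub finX (h x Wx))).
Qed.

Definition sky_hom : modHom M skysheaf := ModHom sky_mapL sky_map_res.

Lemma sky_hom_eq0 V (s : M V) : sky_hom V s = 0 <->
  forall x (Vx : oset V x), phi (mres (umin_sub finX Vx) s) = 0.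
Proof.
split=> [e x Vx|e]; last by apply: sky_eq => x Vx; apply: e.
by have := congr1 (fun t => sky_val t Vx) e.
Qed.

End Hom.

(** A morphism from B to this sheaf is a family of linear maps B(U_x) -> E x, so the extension
    problem splits over the points. *)
Lemma sky_injective : (forall x, injective_mod (E x)) -> mod_injective skysheaf.
Proof.
move=> injE A B i g mi.
pose g0 x (a : A (U_ x)) : E x := sky_val (g (U_ x) a) (umin_refl finX x).
have g0L x : linear (@g0 x).
  move=> a s t; rewrite /g0 homL sky_valL; congr (_ *: _ + _).
  exact: rres_id.
have [x|h hP] := @dprod_choice X (fun x => B (U_ x) -> E x)
    (fun x h => linear h /\ forall a, h (i (U_ x) a) = g0 x a).
  have [h hL hE] := injE x _ _ (i (U_ x)) (g0 x) (homL i (U_ x)) (g0L x) (mi (U_ x)).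
  by exists h.
exists (sky_hom (fun x => (hP x).1)) => V s; apply: sky_eq => x Vx.
rewrite sky_secE -hom_res (hP x).2 /g0 hom_res sky_val_res.
exact: sys_val_irr.
Qed.

End Skyscrapers.

Lemma modHom_eq0 A B (g : modHom A B) V s :
  (forall x (Vx : oset V x), g (U_ x) (mres (umin_sub finX Vx) s) = 0) -> g V s = 0.
Proof.
move=> e; apply: (msep_umin (finX := finX)) => x Vx.
by rewrite -hom_res e mres0.
Qed.

Section Next.
Variables (A B : modSheaf O) (g : modHom A B).

Fact range_submod0 V : range (g V) 0.
Proof. by exists 0 => //; apply: hom0. Qed.
Fact range_submodL V (a : O V) u v :
  range (g V) u -> range (g V) v -> range (g V) (a *: u + v).
Proof. by move=> [s _ <-] [t _ <-]; exists (a *: s + t) => //; apply: homL. Qed.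
Definition range_submod V := Submod (@range_submod0 V) (@range_submodL V).

Let phi x (b : B (U_ x)) : injhull (lquot (range_submod (U_ x))) :=
  injhull_emb (lclass _ b).
Let phiL x : linear (@phi x).
Proof. by move=> a s t; rewrite /phi lclassL injhull_emb_linear. Qed.

(** At each point, an injective module containing the stalk of the cokernel of g. *)
Definition next_sheaf : modSheaf O :=
  skysheaf (fun x => injhull (lquot (range_submod (U_ x)))).
Definition next_hom : modHom B next_sheaf := sky_hom phiL.

Lemma next_injective : mod_injective next_sheaf.
Proof. by apply: sky_injective => x; apply: injhull_injective. Qed.

Lemma next_exact : exact_at g next_hom.
Proof.
move=> V s; rewrite sky_hom_eq0; split=> [e|ls x Vx].
  apply: (locally_inP (finX := finX)) => x Vx.
  apply/(lclass_eq0 (range_submod _)); apply: injhull_emb_inj.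
  by rewrite -[injhull_emb _]/(phi _) e (linear_morph0 (@injhull_emb_linear _ _)).
rewrite /phi (_ : lclass _ _ = 0).
  by rewrite (linear_morph0 (@injhull_emb_linear _ _)).
apply/lclass_eq0.
apply: (locally_in_minimal (Pr := fun V => range (g V)) (minimal_umin finX x)).
by apply: locally_in_res ls => *; apply: range_hom_res.
Qed.

End Next.

Section InjectiveResolution.
Variable M : modSheaf O.

(** Packing source and target lets [res_arrow] build each differential from the previous one, whose
    target is itself produced by the recursion. *)
Record arrow := Arrow { asrc : modSheaf O; atgt : modSheaf O; ahom : modHom asrc atgt }.

Let phi x (s : M (U_ x)) : injhull (M (U_ x)) := injhull_emb s.
Let phiL x : linear (@phi x). Proof. exact: injhull_emb_linear. Qed.

Fixpoint res_arrow (n : nat) : arrow :=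
  if n is m.+1 then Arrow (next_hom (ahom (res_arrow m))) else Arrow (sky_hom phiL).

Lemma injective_resolution_exists : inhabited (injective_resolution M).
Proof.
split; apply: (@InjectiveResolution _ _ M (fun n => atgt (res_arrow n))
  (fun n => ahom (res_arrow n.+1)) (ahom (res_arrow 0))).
- case=> [|n]; last exact: next_injective.
  by apply: sky_injective => x; apply: injhull_injective.
- move=> V; apply: morphD_inj (linear_morphD (homL _ V)) _ => s.
  move=> /sky_hom_eq0 e.
  apply: (msep_umin (finX := finX)) => x Vx.
  apply: injhull_emb_inj; rewrite mres0.
  by rewrite (linear_morph0 (@injhull_emb_linear _ _)); apply: e.
- exact: next_exact.
- by move=> n; apply: next_exact.
Qed.

End InjectiveResolution.

Definition mod_id M : modHom M M.
Proof. by apply: (@ModHom _ _ M M (fun V s => s)). Defined.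

Definition flasque M : Prop := forall (V W : opn X) (h : W `<=` V) (s : M W),
  exists t : M V, mres h t = s.

(* An injective sheaf is a retract of a product of skyscrapers. *)
Lemma injective_flasque M : mod_injective M -> flasque M.
Proof.
move=> injM V W h s.
pose E x := M (U_ x); have idL x : linear (id : M (U_ x) -> E x) by [].
have [V0|r rK] := injM _ _ (sky_hom idL)
    (mod_id M).
  apply: morphD_inj (linear_morphD (homL _ V0)) _ => s' /sky_hom_eq0 e.
  apply: (msep_umin (finX := finX)) => x Vx.
  by rewrite mres0; apply: e.
(* Extension by zero outside W; sections of a product of skyscrapers obey no compatibility
   condition. *)
pose t : skysheaf E V := sky_sec (fun x (Vx : oset V x) =>
  if pselect (oset W x) is left Wx then sky_val (sky_hom idL W s) Wx else 0).
exists (r V t); rewrite -hom_res -[RHS](rK W s); congr (r W _).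
apply: sky_eq => x Wx; rewrite sky_val_res sky_secE.
by case: pselect => // Wx'; apply: sys_val_irr.
Qed.

Section CohomologySheaf.
Variables (K : nat -> modSheaf O) (d : forall n, modHom (K n) (K n.+1)) (i : nat).

Lemma coboundaries0 V : coboundaries d i V 0.
Proof. by case: i => [|n] //=; apply: range_submod0. Qed.
Lemma coboundariesL V (a : O V) u v : coboundaries d i V u ->
  coboundaries d i V v -> coboundaries d i V (a *: u + v).
Proof.
case: i u v => [|n] u v /=; last exact: range_submodL.
by move=> -> ->; rewrite scaler0 addr0.
Qed.
Lemma coboundaries_res (V W : opn X) (h : W `<=` V) s :
  coboundaries d i V s -> coboundaries d i W (mres h s).
Proof.
case: i s => [|n] s /=; last exact: range_hom_res.
by move=> ->; rewrite mres0.
Qed.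

Notation Z := (ker_sheaf (d i)).

Fact cob_submod0 V : [set z : Z V | coboundaries d i V (val z)] 0.
Proof. exact: coboundaries0. Qed.
Fact cob_submodL V (a : O V) (u v : Z V) : coboundaries d i V (val u) ->
  coboundaries d i V (val v) -> coboundaries d i V (val (a *: u + v)).
Proof. exact: coboundariesL. Qed.
Definition cob_submod V : submod (Z V) := Submod (@cob_submod0 V) (@cob_submodL V).

Let H x := lquot (cob_submod (U_ x)).
Let tr x y (xy : spec_le x y) : H x -> H y :=
  lquot_map (cob_submod (U_ y)) (mres (spec_le_umin finX xy)).
Let trE x y (xy : spec_le x y) z :
  tr xy (lclass _ z) = lclass _ (mres (spec_le_umin finX xy) z).
Proof.
apply: lquot_mapE => [s t|s]; first exact: mresD.
exact: coboundaries_res.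
Qed.
Let trL x y (xy : spec_le x y) (h : U_ y `<=` U_ x) a s t :
  tr xy (a *: s + t) = rres h a *: tr xy s + tr xy t.
Proof.
have [u <-] := lclass_surj s; have [v <-] := lclass_surj t.
rewrite -lclassL !trE -lclassL mresL.
by congr (lclass _ (rres _ _ *: _ + _)); apply: Prop_irrelevance.
Qed.

(** Sheafification is carried out on stalks: at x, cocycles modulo coboundaries over U_x. *)
Definition coh_sheaf : modSheaf O := sys_sheaf (@spec_le_open X) trL.

Let pf V (z : Z V) x (Vx : oset V x) : H x := lclass _ (mres (umin_sub finX Vx) z).
Let pfc V (z : Z V) x y (xy : spec_le x y) (Vx : oset V x) (Vy : oset V y) :
  tr xy (pf z Vx) = pf z Vy.
Proof.
by rewrite trE (mres_comp _ _ (umin_sub finX Vy)).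
Qed.
Let p V (z : Z V) : coh_sheaf V := sys_sec (@spec_le_open X) trL (pfc z).
Let pL V : linear (@p V).
Proof.
move=> a s t; apply: sys_eq => x Vx; rewrite sys_valL !sys_secE /pf.
by rewrite mresL lclassL.
Qed.
Let p_res (V W : opn X) (h : W `<=` V) z : p (mres h z) = mres h (p z).
Proof.
apply: sys_eq => x Wx; rewrite sys_secE -[RHS]/(pf z (h x Wx)) /pf.
by rewrite (mres_comp _ _ (umin_sub finX (h x Wx))).
Qed.

Lemma cohomology_sheaf_exists : is_cohomology_sheaf d i coh_sheaf.
Proof.
exists (ModHom pL p_res); split=> [V t x Vx|V z].
  exists (U_ x), (umin_sub finX Vx); split; first exact: umin_refl.
  have [z zE] := lclass_surj (sys_val t Vx).
  exists z => //; apply: sys_eq => y xy.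
  rewrite sys_secE -[RHS]/(sys_val t (umin_sub finX Vx y xy)).
  rewrite -(sys_valP t (xy : spec_le x y) Vx) -zE trE /pf.
  by congr (lclass _ (mres _ _)); apply: Prop_irrelevance.
split=> [e|lz].
  apply: (locally_inP (finX := finX)) => x Vx.
  have /lclass_eq0 := congr1 (fun t => sys_val t Vx) e.
  by [].
apply: sys_eq => x Vx; apply/lclass_eq0.
change (coboundaries d i (U_ x) (mres (umin_sub finX Vx) (val z))).
apply: (locally_in_minimal (Pr := coboundaries d i) (minimal_umin finX x)).
by apply: locally_in_res lz => *; apply: coboundaries_res.
Qed.

End CohomologySheaf.

End Resolutions.

(** * Quasi-coherence as base change between stalks *)

(** The pairing b exhibits the group T as a tensor product of M and A, without a chosen inverse. *)
Definition istensor (R : comPzRingType) (M A : lmodType R) (T : zmodType)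
    (b : M -> A -> T) : Prop :=
  [/\ balanced b, injective (tlift b) & forall t, exists u, tlift b u = t].

Lemma istensor_intro (R : comPzRingType) (M A : lmodType R) (T : zmodType)
    (b : M -> A -> T) : balanced b -> (forall u, tlift b u = 0 -> u = 0) ->
  (forall t, exists u, tlift b u = t) -> istensor b.
Proof. by move=> bb bi bs; split=> //; apply: morphD_inj bi; apply: tliftD. Qed.

Lemma istensor_ker (R : comPzRingType) (M A : lmodType R) (T : zmodType)
    (b : M -> A -> T) : istensor b -> forall u, tlift b u = 0 -> u = 0.
Proof. by move=> [bb bi _] u u0; apply: bi; rewrite u0 (tlift0 bb). Qed.

Section BaseChange.
Variables (A B : comPzRingType) (f : {rmorphism A -> B}).

Lemma bc_balanced (M : lmodType A) (N : lmodType B) (r : M -> N) :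
  (forall a u v, r (a *: u + v) = f a *: r u + r v) ->
  balanced (fun (b : rscal f B^o) (m : M) => (b : B) *: r m).
Proof.
move=> rL; have rD : {morph r : x y / x + y}.
  by move=> x y; have := rL 1 x y; rewrite rmorph1 !scale1r.
have rZ a m : r (a *: m) = f a *: r m.
  by have := rL a m 0; rewrite (morphD0 rD) !addr0.
split=> [b b' m|b m m'|a b m].
- by rewrite scalerDl.
- by rewrite rD scalerDr.
- by rewrite rscalE rZ !scalerA mulrC.
Qed.

Section FreeMap.
Variable I : choiceType.

Fact fmap_subproof (s : freem A I) : @finsupp B I (fun i => f (coef s i)).
Proof.
apply: sub_finite_set (freem_finite s) => i /=; apply: contra_not => ->.
exact: rmorph0.
Qed.
Definition fmap (s : freem A I) : freem B I := freem_of (fmap_subproof s).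

Lemma coef_fmap s i : coef (fmap s) i = f (coef s i). Proof. by []. Qed.

Lemma fmapL a s t : fmap (a *: s + t) = f a *: fmap s + fmap t.
Proof.
by apply: freem_eq => i; rewrite coefL !coef_fmap coefL rmorphD rmorphM.
Qed.

Lemma fmap0 : fmap 0 = 0.
Proof. by apply: freem_eq => i; rewrite coef_fmap rmorph0. Qed.

Lemma fmap_basis i : fmap (basis A i) = basis B i.
Proof.
apply: freem_eq => j; rewrite coef_fmap !coef_basis.
by case: eqP => _; rewrite ?rmorph1 ?rmorph0.
Qed.

End FreeMap.
End BaseChange.

Section FreeLinear.
Variables (R : comPzRingType) (I : choiceType) (M : lmodType R) (e : I -> M).

Definition free_lin (s : freem R I) : M := free_sum (fun i a => a *: e i) s.

Let hD i : {morph (fun a : R => a *: e i) : a b / a + b}.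
Proof. by move=> a b; apply: scalerDl. Qed.

Lemma free_linZb a i : free_lin (a *: basis R i) = a *: e i.
Proof. exact: free_sum_basis. Qed.
Lemma free_lin_basis i : free_lin (basis R i) = e i.
Proof. by rewrite -[basis R i]scale1r free_linZb scale1r. Qed.

Lemma free_linL : linear free_lin.
Proof.
have D := free_sumD hD; move=> a s t; rewrite {1}/free_lin D; congr (_ + _).
elim/freem_ind: s => [|b i s IH].
  by rewrite scaler0 /free_lin (morphD0 D) scaler0.
rewrite scalerDr scalerA /free_lin !D scalerDr; congr (_ + _) => //.
by rewrite -![free_sum _ _]/(free_lin _) !free_linZb scalerA.
Qed.

Lemma free_lin_unique (g : freem R I -> M) : linear g ->
  (forall i, g (basis R i) = e i) -> g =1 free_lin.
Proof.
move=> gL ge; elim/freem_ind => [|a i s IH].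
  by rewrite !(linear_morph0 _) //; apply: free_linL.
by rewrite gL free_linL IH ge free_lin_basis.
Qed.

End FreeLinear.

Lemma free_lin_natural (A B : comPzRingType) (f : {rmorphism A -> B})
    (I : choiceType) (M : lmodType A) (N : lmodType B) (r : M -> N) (e : I -> M) :
  (forall a u v, r (a *: u + v) = f a *: r u + r v) ->
  forall s, r (free_lin e s) = free_lin (fun i => r (e i)) (fmap f s).
Proof.
move=> rL; have r0 : r 0 = 0.
  apply: (addrI (r 0)); rewrite addr0.
  by have := rL 1 0 0; rewrite rmorph1 !scale1r addr0.
elim/freem_ind => [|a i s IH].
  rewrite fmap0 !(linear_morph0 _) ?r0 //; exact: free_linL.
by rewrite fmapL !free_linL fmap_basis !free_lin_basis rL IH.
Qed.

(** * A common presentation gives base change *)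

Section Presentation.
Variables (A B : comPzRingType) (f : {rmorphism A -> B}).
Variables (M : lmodType A) (N : lmodType B) (r : M -> N).
Hypothesis rL : forall a u v, r (a *: u + v) = f a *: r u + r v.
Variables (I J : choiceType).
Variables (piA : freem A I -> M) (piB : freem B I -> N).
Variables (phiA : freem A J -> freem A I) (phiB : freem B J -> freem B I).
Hypotheses (piAL : linear piA) (piBL : linear piB).
Hypotheses (phiBL : linear phiB).
Hypothesis pi_r : forall i, piB (basis B i) = r (piA (basis A i)).
Hypothesis phi_f : forall j, phiB (basis B j) = fmap f (phiA (basis A j)).
Hypotheses (piA_surj : forall m, exists s, piA s = m).
Hypotheses (piB_surj : forall m, exists s, piB s = m).
Hypothesis exB : forall s, piB s = 0 -> exists w, phiB w = s.
Hypothesis zeroA : forall w, piA (phiA w) = 0.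

Let b0 (b : rscal f B^o) (m : M) : N := (b : B) *: r m.
Let bb : balanced b0 := bc_balanced rL.
Let T := tensor (rscal f B^o) M.
Let h (i : I) (b : B) : T := pure (b : rscal f B^o) (piA (basis A i)).
Let hD i : {morph h i : a b / a + b}. Proof. by move=> a b; apply: pureDl. Qed.
Let Psi : freem B I -> T := free_sum h.
Let PsiD : {morph Psi : s t / s + t} := free_sumD hD.

Let Psi_fmap b u : Psi (b *: fmap f u) = pure (b : rscal f B^o) (piA u).
Proof.
have piA0 := linear_morph0 piAL.
elim/freem_ind: u => [|a i u IH].
  by rewrite fmap0 scaler0 (morphD0 PsiD) piA0 pure0r.
rewrite fmapL scalerDr PsiD IH piAL pureDr fmap_basis scalerA; congr (_ + _).
rewrite -pureZ /Psi free_sum_basis // /h; congr (pure _ _).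
by rewrite rscalE mulrC.
Qed.

Let piB_fmap u : piB (fmap f u) = r (piA u).
Proof.
rewrite (free_lin_unique piBL pi_r) (free_lin_unique piAL (fun=> erefl)).
by rewrite (free_lin_natural _ rL).
Qed.

(** The map [Psi] : B^(I) -> B (x) M is onto since [piA] is, it lifts [piB], and it kills the image
    of [phiB] because [piA] kills that of [phiA]. As the kernel of [piB] lies in the image of
    [phiB], the map B (x) M -> N is injective. *)
Lemma bc_of_presentation : istensor b0.
Proof.
have piB0 := linear_morph0 piBL.
have phiB0 := linear_morph0 phiBL.
apply: istensor_intro => // [t t0|n].
  have [s [tE ts]] : exists s, t = Psi s /\ tlift b0 t = piB s.
    elim/tensor_ind: t {t0} => [|b m x [s [-> sE]]].
      by exists 0; rewrite (morphD0 PsiD) (tlift0 bb) piB0.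
    have [u <-] := piA_surj m; exists ((b : B) *: fmap f u + s).
    by rewrite PsiD Psi_fmap (tliftD bb) sE (tlift_pure bb) piBL piB_fmap.
  rewrite t0 in ts; have [w wE] := exB (esym ts); rewrite tE -wE.
  elim/freem_ind: w {wE} => [|b j w IH]; first by rewrite phiB0 (morphD0 PsiD).
  by rewrite phiBL PsiD IH addr0 phi_f Psi_fmap zeroA pure0r.
have [s <-] := piB_surj n; elim/freem_ind: s => [|b i s [u uE]].
  by exists 0; rewrite (tlift0 bb) piB0.
exists (pure (b : rscal f B^o) (piA (basis A i)) + u).
by rewrite (tliftD bb) uE (tlift_pure bb) piBL pi_r.
Qed.

End Presentation.

Section FreeSections.
Variables (X : topologicalType) (finX : finite_set [set: X]) (O : ringSheaf X).
Variable I : Type.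
Notation cI := {classic I}.

(** On a finite space a locally finite family is finite: a nonzero section is nonzero at some stalk,
    and each of the finitely many stalks sees finitely many indices. *)
Fact of_free_subproof (U : opn X) (s : free_mod O I U) :
  @finsupp (O U) cI (val s).
Proof.
have fs : forall x, finite_set [set i | exists Ux : oset U x,
    rres (umin_sub finX Ux) (val s i) <> 0].
  move=> x; have [Ux|nUx] := pselect (oset U x); last first.
    rewrite (_ : [set _ | _] = set0) //.
    by apply/seteqP; split=> i // [Ux]; have := nUx Ux.
  have [V [hV [Vx fV]]] := free_secP s Ux.
  apply: sub_finite_set fV => i [Ux']; apply: contra_not => s0.
  by rewrite -(rres_comp hV (umin_sub finX Vx)) s0 rmorph0.
apply: (@sub_finite_set _ _ (\bigcup_(x in [set: X])
    [set i | exists Ux : oset U x, rres (umin_sub finX Ux) (val s i) <> 0])).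
  move=> i /= si; apply: contrapT => nx; apply: si.
  apply: (rsep (hV := fun w : {x | oset U x} => umin_sub finX (proj2_sig w)))
    (@umin_coverE _ finX U) _ => -[x Ux] /=; rewrite rmorph0.
  by apply: contrapT => ne; apply: nx; exists x => //; exists Ux.
by apply: bigcup_finite => // x _; apply: fs.
Qed.

Definition of_free (U : opn X) (s : free_mod O I U) : freem (O U) cI :=
  freem_of (of_free_subproof s).

Fact to_free_subproof (U : opn X) (s : freem (O U) cI) :
  @locally_finite X O I U (coef s).
Proof.
move=> x Ux; exists U, (@subset_refl _ U); split=> //.
apply: sub_finite_set (freem_finite s) => i /=; apply: contra_not => ->.
exact: rmorph0.
Qed.

Definition to_free (U : opn X) (s : freem (O U) cI) : free_mod O I U :=
  free_sec (to_free_subproof s).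

Lemma of_freeK U : cancel (@of_free U) (@to_free U).
Proof. by move=> s; apply: val_inj. Qed.
Lemma to_freeK U : cancel (@to_free U) (@of_free U).
Proof. by move=> s; apply: freem_eq. Qed.
Lemma of_freeL U : linear (@of_free U).
Proof. by move=> a s t; apply: freem_eq. Qed.
Lemma to_freeL U : linear (@to_free U).
Proof. by move=> a s t; apply: val_inj. Qed.
Lemma of_free_res (U V : opn X) (h : V `<=` U) s :
  of_free (mres h s) = fmap (rres h) (of_free s).
Proof. exact: freem_eq. Qed.
Lemma to_free_res (U V : opn X) (h : V `<=` U) s :
  mres h (to_free s) = to_free (fmap (rres h) s).
Proof. exact: val_inj. Qed.

End FreeSections.

Section Subspace.
Variables (X : topologicalType) (U : opn X).

Lemma finite_subspace : finite_set [set: X] -> finite_set [set: set_type U].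
Proof.
move=> finX; rewrite -(preimage_setT (val : set_type U -> X)).
by apply: finite_preimage => // x y _ _; apply: val_inj.
Qed.

Lemma oimg_ores_eq (W : opn X) : W `<=` U -> oimg (ores U W) = W.
Proof. by move=> WU; apply/opn_eq/oimg_ores. Qed.

Lemma minimal_ores (P : opn X) (x : set_type U) :
  minimal_at P (val x) -> minimal_at (ores U P) x.
Proof.
move=> Px; apply/seteqP; split=> [y /= Py W [oW Wx]|].
  have : oset (oimg (Opn oW)) (val y).
    move: Py; rewrite [oset P]Px; apply: umin_set_sub; last by exists x.
    exact: oset_open.
  by move=> [z Wz zy]; have <- : z = y by apply: val_inj.
apply: umin_set_sub; first exact: oset_open.
by rewrite /= [oset P]Px; apply: umin_set_refl.
Qed.

End Subspace.

Section QuasiCoherentBaseChange.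
Variables (X : topologicalType) (finX : finite_set [set: X]) (O : ringSheaf X).

Definition base_change (M : modSheaf O) (P Q : opn X) (h : Q `<=` P) : Prop :=
  @istensor (O P) (rscal (@rres X O P Q h) (O Q)^o) (M P) (M Q)
    (fun b m => (b : O Q) *: mres h m).

Section Forward.
Variables (M : modSheaf O) (V : opn X) (I J : Type).
Notation OV := (restr_ring O V).
Variables (phi : modHom (free_mod OV J) (free_mod OV I)).
Variables (pi : modHom (free_mod OV I) (restr_mod V M)).
Hypotheses (exact_phi_pi : exact_at phi pi) (pi_epi : mod_epi pi).

Let finV : finite_set [set: set_type V] := finite_subspace V finX.

Let pi_surj (P : opn (set_type V)) x : minimal_at P x ->
  forall m, exists s, pi P (to_free s) = m.
Proof.
move=> Px m.
have [s _ <-] := locally_in_minimal (Pr := fun V => range (pi V)) Px (@pi_epi P m).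
by exists (of_free finV s); rewrite of_freeK.
Qed.

(** On minimal open sets the presentation is exact on sections, and restriction from P to Q matches
    the generators and the relations. *)
Lemma presentation_base_change (P Q : opn (set_type V)) x y (h : Q `<=` P) :
  minimal_at P x -> minimal_at Q y -> @base_change M _ _ (oimgS h).
Proof.
move=> Px Qy.
apply: (@bc_of_presentation _ _ (@rres _ OV P Q h) (M (oimg P)) (M (oimg Q))
  (@mres _ O M _ _ (oimgS h)) _ {classic I} {classic J}
  (fun s => pi P (to_free s)) (fun s => pi Q (to_free s))
  (fun w => of_free finV (phi P (to_free w)))
  (fun w => of_free finV (phi Q (to_free w)))).
- by move=> a u v; apply: mresL.
- by move=> a u v; rewrite to_freeL homL.
- by move=> a u v; rewrite to_freeL homL.
- by move=> a u v; rewrite to_freeL homL of_freeL.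
- move=> i; rewrite -[RHS]/(@mres _ OV (restr_mod V M) _ _ h _) -hom_res.
  by rewrite to_free_res fmap_basis.
- move=> j; rewrite -(fmap_basis (@rres _ OV P Q h)) -to_free_res hom_res.
  exact: of_free_res.
- exact: pi_surj Px.
- exact: pi_surj Qy.
- move=> s /exact_phi_pi ls.
  have [w _ wE] := locally_in_minimal (Pr := fun V => range (phi V)) Qy ls.
  by exists (of_free finV w); rewrite of_freeK wE to_freeK.
- move=> w; rewrite of_freeK; apply/exact_phi_pi => z Pz.
  exists P, (@subset_refl _ P); split=> //.
  by rewrite mres_id; exists (to_free w).
Qed.

End Forward.

Lemma quasi_coherent_base_change (M : modSheaf O) : quasi_coherent M ->
  forall (P Q : opn X) (h : Q `<=` P) x y, minimal_at P x -> minimal_at Q y ->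
  base_change M h.
Proof.
move=> qM P Q h x y Px Qy.
have [V [Vx [I [J [phi [pi [ex epi]]]]]]] := qM x.
have PV : P `<=` V by rewrite Px; apply: umin_set_sub (oset_open V) Vx.
have QV := subset_trans h PV.
have Vy : oset V y by apply: QV; rewrite Qy; apply: umin_set_refl.
pose x' : set_type V := SigSub (mem_set Vx); pose y' : set_type V := SigSub (mem_set Vy).
have h' : ores V Q `<=` ores V P by move=> z; apply: h.
have := presentation_base_change ex epi h'
  (minimal_ores (x := x') Px) (minimal_ores (x := y') Qy).
(* [oimg (ores V P)] equals P only propositionally, so the result is transported along equations of
   open sets. *)
have gen : forall (P' Q' : opn X), P' = P -> Q' = Q -> forall h0 : Q' `<=` P',
    base_change M h0 -> base_change M h.
  by move=> P' Q' eP eQ; subst P' Q' => h0; rewrite (Prop_irrelevance h0 h).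
by apply: gen; apply: oimg_ores_eq.
Qed.

End QuasiCoherentBaseChange.

(** * Base change gives a presentation *)

Section KernelOfBaseChange.
Variables (A B : comPzRingType) (f : {rmorphism A -> B}).
Variables (M : lmodType A) (N : lmodType B) (r : M -> N).
Hypothesis bc : istensor (fun (b : rscal f B^o) (m : M) => (b : B) *: r m).
Variables (I : choiceType) (e : I -> M).
Hypothesis e_surj : forall m, exists s, free_lin e s = m.
Let J := {s : freem A I | free_lin e s = 0}.

(** A^(J) -> A^(I) -> M -> 0, with J the set of all relations, stays exact after tensoring with B,
    and B (x) M embeds in N; so relations over B are generated by relations over A. *)
Lemma free_lin_base_change_ker (s : freem B I) :
  free_lin (fun i => r (e i)) s = 0 ->
  exists w : freem B {classic J}, free_lin (fun j : {classic J} => fmap f (sval (j : J))) w = s.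
Proof.
move=> s0; pose T := tensor (rscal f B^o) (freem A I).
pose tau0 (b : rscal f B^o) (u : freem A I) : freem B I := (b : B) *: fmap f u.
have tb : balanced tau0 := bc_balanced (@fmapL _ _ f I).
pose phi (w : freem B {classic J}) := free_lin (fun j : {classic J} => fmap f (sval (j : J))) w.
have phiL : linear phi := free_linL _.
(* The elements of B (x) A^(I) whose image in B^(I) is generated by the relations; [tensor_ker]
   places the lift of s among them. *)
have S0 : [set t : T | exists w, phi w = tlift tau0 t] 0.
  by exists 0; rewrite (linear_morph0 phiL) (tlift0 tb).
have SB u v : (exists w, phi w = tlift tau0 u) -> (exists w, phi w = tlift tau0 v) ->
    exists w, phi w = tlift tau0 (u - v).
  move=> [w wE] [w' wE']; exists (w - w').
  by rewrite (morphDB (linear_morphD phiL)) wE wE' (morphDB (tliftD tb)).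
pose p := lin_of (@free_linL _ _ _ e).
pose h (i : I) (b : B) : T := pure (b : rscal f B^o) (basis A i).
have hD i : {morph h i : a b / a + b} by move=> a b; apply: pureDl.
pose t0 := free_sum h s.
have tauE : tlift tau0 t0 = s.
  rewrite /t0; elim/freem_ind: s {s0 t0} => [|b i s IH].
    by rewrite (morphD0 (free_sumD hD)) (tlift0 tb).
  rewrite (free_sumD hD) (tliftD tb) IH (free_sum_basis hD) (tlift_pure tb).
  by rewrite /tau0 fmap_basis.
have [bb _ _] := bc.
have pE u : tlift (fun (b : rscal f B^o) (m : M) => (b : B) *: r m)
    (tmap (idfun : {linear rscal f B^o -> rscal f B^o}) p (free_sum h u)) =
    free_lin (fun i => r (e i)) u.
  have D0 := linear_morph0 (free_linL (fun i => r (e i))).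
  elim/freem_ind: u => [|b i u IH].
    by rewrite (morphD0 (free_sumD hD)) tmap0 (tlift0 bb) D0.
  rewrite (free_sumD hD) tmapD (tliftD bb) IH (free_sum_basis hD) tmap_pure.
  rewrite (tlift_pure bb) free_linL -[p _]/(free_lin e (basis A i)).
  by rewrite !free_lin_basis.
have tm0 : tmap (idfun : {linear rscal f B^o -> rscal f B^o}) p t0 = 0.
  by apply: (istensor_ker bc); rewrite pE.
have [|b m /= ->|b m pm|w wE] := 
  @tensor_ker _ _ _ _ _ (idfun : {linear rscal f B^o -> rscal f B^o}) p
    (ZSubgroup S0 SB) _ e_surj _ _ _ tm0.
- by move=> b; exists b.
- by rewrite pure0l.
- exists ((b : B) *: basis B (exist _ m pm : {classic J})).
  by rewrite (tlift_pure tb) /phi free_linZb.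
- by exists w; rewrite -[LHS]/(phi w) wE tauE.
Qed.

Lemma free_lin_base_change_surj (n : N) :
  exists s : freem B {classic M}, free_lin (fun m : {classic M} => r (m : M)) s = n.
Proof.
have [bb _ bs] := bc; have [u <-] := bs n.
have L := free_linL (fun m : {classic M} => r (m : M)).
elim/tensor_ind: u => [|b m u [s sE]].
  by exists 0; rewrite (tlift0 bb) (linear_morph0 L).
exists ((b : B) *: basis B (m : {classic M}) + s).
by rewrite L sE free_lin_basis (tliftD bb) (tlift_pure bb).
Qed.

End KernelOfBaseChange.

Section QuasiCoherentOfBaseChange.
Variables (X : topologicalType) (finX : finite_set [set: X]) (O : ringSheaf X).
Variables (M : modSheaf O).

Lemma minimal_oimg (V : opn X) (W : opn (set_type V)) (y : set_type V) :
  minimal_at W y -> minimal_at (oimg W) (val y).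
Proof.
move=> Wy; apply/seteqP; split=> [_ [z Wz <-] G [oG Gy]|].
  move: Wz; rewrite Wy; apply: (umin_set_sub (oset_open (ores V (Opn oG)))).
  exact: Gy.
apply: umin_set_sub; first exact: oset_open.
by exists y => //; rewrite Wy; apply: umin_set_refl.
Qed.

Lemma oimg_sub (V : opn X) (W : opn (set_type V)) : oimg W `<=` V.
Proof. by move=> _ [y _ <-]; apply: set_mem (valP y). Qed.

Hypothesis bcM : forall (P Q : opn X) (h : Q `<=` P) x y,
  minimal_at P x -> minimal_at Q y -> base_change M h.

Section Local.
Variable x : X.
Let V := umin finX x.
Notation OV := (restr_ring O V).
Let finV : finite_set [set: set_type V] := finite_subspace V finX.
(** The tautological presentation: all elements of M(U_x) as generators, all linear relations
    between them as relations. *)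
Let I : Type := M V.
Let J : Type := {s : freem (O V) {classic I} | free_lin (id : {classic I} -> M V) s = 0}.

Let eW (W : opn (set_type V)) (m : {classic I}) : M (oimg W) :=
  mres (@oimg_sub V W) (m : M V).
Let rW (W : opn (set_type V)) (j : {classic J}) : freem (O (oimg W)) {classic I} :=
  fmap (@rres _ O _ _ (@oimg_sub V W)) (sval (j : J)).

Let pi0 (W : opn (set_type V)) (s : free_mod OV I W) : restr_mod V M W :=
  free_lin (@eW W) (of_free finV s).
Let pi0L W : linear (@pi0 W).
Proof. by move=> a s t; rewrite /pi0 of_freeL free_linL. Qed.
Let pi0_res (W W' : opn (set_type V)) (h : W' `<=` W) s :
  pi0 (mres h s) = mres h (pi0 s).
Proof.
rewrite /pi0 -[RHS]/(@mres _ O M _ _ (oimgS h) (free_lin (@eW W) (of_free finV s))).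
rewrite (@free_lin_natural _ _ (@rres _ O _ _ (oimgS h)) _ _ (M (oimg W'))
  (@mres _ O M _ _ (oimgS h)) (@eW W) (@mresL _ O M _ _ (oimgS h))).
rewrite of_free_res; congr (free_lin _ _); apply/funext => m.
by rewrite /eW (mres_comp _ _ (@oimg_sub V W')).
Qed.
Let pi : modHom (free_mod OV I) (restr_mod V M) := ModHom pi0L pi0_res.

Let phi0 (W : opn (set_type V)) (w : free_mod OV J W) : free_mod OV I W :=
  to_free (free_lin (@rW W) (of_free finV w) : freem (OV W) {classic I}).
Let phi0L W : linear (@phi0 W).
Proof. by move=> a s t; rewrite /phi0 of_freeL free_linL to_freeL. Qed.
Let phi0_res (W W' : opn (set_type V)) (h : W' `<=` W) s :
  phi0 (mres h s) = mres h (phi0 s).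
Proof.
rewrite /phi0 to_free_res of_free_res; congr (to_free _).
rewrite (@free_lin_natural _ _ (@rres _ OV _ _ h) _
  (freem (OV W) {classic I}) (freem (OV W') {classic I}) _ (@rW W) (@fmapL _ _ _ _)).
congr (free_lin _ _); apply/funext => j; apply: freem_eq => i.
by rewrite !coef_fmap (rres_comp _ _ (@oimg_sub V W')).
Qed.
Let phi : modHom (free_mod OV J) (free_mod OV I) := ModHom phi0L phi0_res.

Let bcW (W : opn (set_type V)) y : minimal_at W y -> base_change M (@oimg_sub V W).
Proof. by move=> Wy; apply: bcM (minimal_umin finX x) (minimal_oimg Wy). Qed.

Let I_surj (m : M V) : exists s, free_lin (id : {classic I} -> M V) s = m.
Proof. by exists (basis _ (m : {classic I})); rewrite free_lin_basis. Qed.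

Let pi_phi W w : pi W (phi W w) = 0.
Proof.
rewrite /= /pi0 /phi0 to_freeK.
have L := free_linL (@eW W); have L' := free_linL (@rW W).
elim/freem_ind: (of_free finV w) => [|a j s IH].
  by rewrite (linear_morph0 L') (linear_morph0 L).
rewrite L' L IH addr0 free_lin_basis /rW.
rewrite -(@free_lin_natural _ _ (@rres _ O _ _ (@oimg_sub V W)) _ (M V)
  (M (oimg W)) (@mres _ O M _ _ (@oimg_sub V W)) (id : {classic I} -> M V)
  (@mresL _ O M _ _ (@oimg_sub V W))).
by rewrite (svalP (j : J)) mres0 scaler0.
Qed.

Lemma base_change_presentation : exact_at phi pi /\ mod_epi pi.
Proof.
split=> [U s|U m].
  split=> [s0|ls].
    apply: (locally_inP (finX := finV)) => y Uy.
    have Wy := minimal_umin finV y.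
    set W := umin finV y in Wy *; set t := mres _ s.
    have t0 : free_lin (@eW W) (of_free finV t) = 0.
      by rewrite -[LHS]/(pi W t) hom_res s0 mres0.
    have [w wE] := free_lin_base_change_ker
      (bcW Wy) I_surj t0.
    by exists (@to_free _ OV J W w) => //=; rewrite /phi0 to_freeK wE of_freeK.
  apply: (modHom_eq0 (finX := finV)) => y Uy.
  have [|w _ <-] := locally_in_minimal (Pr := fun V => range (phi V))
    (minimal_umin finV y) (s := mres (umin_sub finV Uy) s); last exact: pi_phi.
  by apply: locally_in_res ls => *; apply: range_hom_res.
apply: (locally_inP (finX := finV)) => y Uy.
have Wy := minimal_umin finV y.
have [s sE] := free_lin_base_change_surj (bcW Wy) (mres (umin_sub finV Uy) m).
by exists (@to_free _ OV I (umin finV y) s) => //=; rewrite /pi0 to_freeK.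
Qed.

End Local.

Lemma base_change_quasi_coherent : quasi_coherent M.
Proof.
move=> x; exists (umin finX x); split; first exact: umin_refl.
have [ex epi] := base_change_presentation x.
by do 4 eexists; split; [apply: ex | apply: epi].
Qed.

End QuasiCoherentOfBaseChange.

(** * Cohomology of systems of modules on a finite poset *)

Lemma subr_swap (V : zmodType) (x x' z z' : V) :
  x' - x = z' - z -> x - z = x' - z'.
Proof.
move=> e; rewrite -[x'](subrK x) e [RHS]addrAC addrC; congr (_ + _).
by rewrite addrAC subrr add0r.
Qed.

Section Systems.
Variables (R : comPzRingType) (T : finType) (le : rel T).
Hypotheses (le_refl : reflexive le) (le_anti : antisymmetric le)
  (le_trans : transitive le).

Definition ltr a b := le a b && (a != b).

Lemma ltrW a b : ltr a b -> le a b. Proof. by case/andP. Qed.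
Lemma ltr_irr a : ltr a a = false. Proof. by rewrite /ltr eqxx andbF. Qed.
Lemma le_ltr_trans a b c : le a b -> ltr b c -> ltr a c.
Proof.
move=> ab /andP[bc nbc]; rewrite /ltr (le_trans ab bc).
apply: contra_neqN nbc => /eqP ac; subst c.
by apply: le_anti; rewrite bc ab.
Qed.
Lemma ltr_le_trans a b c : ltr a b -> le b c -> ltr a c.
Proof.
move=> /andP[ab nab] bc; rewrite /ltr (le_trans ab bc).
apply: contra_neqN nab => /eqP ac; subst c.
by apply: le_anti; rewrite ab bc.
Qed.
Lemma le_eqVltr a b : le a b -> a = b \/ ltr a b.
Proof. by move=> ab; rewrite /ltr ab; case: eqVneq; auto. Qed.

Definition up a := [pred b | le a b].

(** The measure for the inductions that run from the maximal points downwards. *)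
Lemma up_ltr a b : ltr a b -> (#|up b| < #|up a|)%N.
Proof.
move=> ab; apply: proper_card; apply/properP; split.
  by apply/fintype.subsetP => c; rewrite !inE; apply: le_trans (ltrW ab).
exists a; rewrite inE ?le_refl //; apply/negP => ba.
by case/andP: ab => ab /eqP[]; apply: le_anti; rewrite ab.
Qed.

(* [smap a b] is meaningful only for a <= b. *)
Record sys := Sys {
  sob :> T -> lmodType R;
  smap : forall a b, sob a -> sob b;
  smapL : forall a b, linear (@smap a b);
  smap_id : forall a s, @smap a a s = s;
  smap_comp : forall a b c s, le a b -> le b c ->
    @smap b c (@smap a b s) = @smap a c s }.
Arguments smap s {a b} x : rename.

Definition scompat (F : sys) (s : forall a, F a) : Prop :=
  forall a b, le a b -> smap F (s a) = s b.

Lemma smapD (F : sys) a b : {morph @smap F a b : x y / x + y}.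
Proof. exact/linear_morphD/smapL. Qed.
Lemma smapB (F : sys) a b : {morph @smap F a b : x y / x - y}.
Proof. exact/morphDB/smapD. Qed.
Lemma smap0 (F : sys) a b : @smap F a b 0 = 0.
Proof. exact/morphD0/smapD. Qed.

Section ProductOver.
Variables (F : T -> lmodType R) (P : pred T).

Fact pmod0 : [set m : dprod F | forall y, ~~ P y -> m y = 0] 0.
Proof. by []. Qed.
Fact pmodL (a : R) (u v : dprod F) : (forall y, ~~ P y -> u y = 0) ->
  (forall y, ~~ P y -> v y = 0) -> forall y, ~~ P y -> (a *: u + v) y = 0.
Proof.
by move=> u0 v0 y Py; rewrite dprodD dprodZ u0 // v0 // scaler0 addr0.
Qed.
Definition pmod_submod := Submod pmod0 pmodL.
(** Families on all of T vanishing outside P, rather than families on a subtype, so that [pval m y]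
    takes no proof of P y. *)
Definition pmod : Type := submod_type pmod_submod.
HB.instance Definition _ := GRing.Lmodule.on pmod.

Definition pval (m : pmod) (y : T) : F y := (val m : dprod F) y.

Lemma pval_out m y : ~~ P y -> pval m y = 0.
Proof. exact: (submod_valP m). Qed.

Fact pmk_subproof (f : forall y, F y) :
  submod_set pmod_submod (fun y => if P y then f y else 0).
Proof. by move=> y /negPf ->. Qed.
Definition pmk (f : forall y, F y) : pmod := submod_sub (@pmk_subproof f).

Lemma pval_mk f y : P y -> pval (pmk f) y = f y.
Proof. by rewrite /pval /= => ->. Qed.

Lemma pmod_eq (m n : pmod) : (forall y, P y -> pval m y = pval n y) -> m = n.
Proof.
move=> mn; apply/val_inj/dprod_eq => y.
by have [/mn//|Py] := boolP (P y); rewrite -!/(pval _ y) !pval_out.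
Qed.

Lemma pvalL a m n y : pval (a *: m + n) y = a *: pval m y + pval n y.
Proof. by []. Qed.
Lemma pvalD m n y : pval (m + n) y = pval m y + pval n y.
Proof. by []. Qed.
Lemma pval0 y : pval 0 y = 0. Proof. by []. Qed.

End ProductOver.

(* For the Godement embedding of F in [a |-> prod_(y >= a) F y], the cokernel
   at a is [prod_(y > a) F y], the class of m being [y |-> m y - F(a, y) (m a)]. *)
Section CosyzygySystem.
Variable F : sys.

Definition cosyz_ob (a : T) : lmodType R := pmod F (ltr a).
(** A class at b is represented by the family that is 0 at b; subtracting F(b, y) (m b) restores
    this normalisation. For a = b nothing changes, since [pval m a] is 0. *)
Definition cosyz_map a b (m : cosyz_ob a) : cosyz_ob b :=
  pmk (ltr b) (fun y => pval m y - smap F (pval m b)).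

Fact cosyz_mapL a b : linear (@cosyz_map a b).
Proof.
move=> c m n; apply: pmod_eq => y by_; rewrite pvalL !pval_mk // !pvalL smapL.
by rewrite scalerBr opprD addrACA.
Qed.
Fact cosyz_map_id a m : @cosyz_map a a m = m.
Proof.
apply: pmod_eq => y ay; rewrite /cosyz_map pval_mk //.
by rewrite [pval m a]pval_out ?ltr_irr // smap0 subr0.
Qed.
Lemma cosyz_mapE a b (m : cosyz_ob a) y : ltr b y ->
  pval (cosyz_map b m) y = pval m y - smap F (pval m b).
Proof. exact: pval_mk. Qed.

Lemma cosyz_self a (m : cosyz_ob a) : pval m a = 0.
Proof. by rewrite pval_out ?ltr_irr. Qed.

Fact cosyz_map_comp a b c m : le a b -> le b c ->
  @cosyz_map b c (@cosyz_map a b m) = @cosyz_map a c m.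
Proof.
move=> ab bc; apply: pmod_eq => y cy; have by_ := le_ltr_trans bc cy.
rewrite (cosyz_mapE _ cy) [RHS](cosyz_mapE _ cy) (cosyz_mapE _ by_).
have [ebc|lbc] := le_eqVltr bc.
  by subst c; rewrite cosyz_self smap0 subr0.
rewrite (cosyz_mapE _ lbc) smapB (smap_comp _ bc (ltrW cy)).
by rewrite opprB addrA subrK.
Qed.
Definition cosyz : sys := Sys cosyz_mapL cosyz_map_id cosyz_map_comp.

Definition cobound (m : forall y, F y) a : cosyz a :=
  pmk (ltr a) (fun y => m y - smap F (m a)).

Lemma coboundE m a y : ltr a y -> pval (cobound m a) y = m y - smap F (m a).
Proof. exact: pval_mk. Qed.

Lemma cobound_compat m : scompat (F := cosyz) (cobound m).
Proof.
move=> a b ab; apply: pmod_eq => y by_; have ay := le_ltr_trans ab by_.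
rewrite [LHS](cosyz_mapE _ by_) (coboundE _ ay) (coboundE _ by_).
have [eab|lab] := le_eqVltr ab.
  by subst b; rewrite cosyz_self smap0 subr0.
rewrite (coboundE _ lab) smapB (smap_comp _ ab (ltrW by_)).
by rewrite opprB addrA subrK.
Qed.

(** The Godement system [a |-> prod_(y >= a) F y] is acyclic and has global sections prod_y F y, so
    H^1(F) is the cokernel of [cobound]. *)
Definition H1van : Prop := forall z : forall a, cosyz a, scompat z ->
  exists m : forall y, F y, forall a, z a = cobound m a.

(** Extension of sections from the open set of points strictly above x to x itself; on a finite
    poset, other extensions follow one point at a time. *)
Definition sflasque : Prop := forall x (m : forall y, F y),
  (forall y y', ltr x y -> le y y' -> smap F (m y) = m y') ->
  exists s : F x, forall y, ltr x y -> smap F s = m y.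

(** m is chosen from the maximal points downwards: the condition at a prescribes the restrictions of
    m a to the points above a, and flasqueness supplies m a. The up-set P is there for
    [sflasque_cosyz], which takes the points above a given one. *)
Lemma sflasque_H1 (P : pred T) (z : forall a, cosyz a) : sflasque ->
  (forall a b, P a -> le a b -> P b) ->
  (forall a b, P a -> le a b -> smap cosyz (z a) = z b) ->
  exists m : forall y, F y, forall a, P a -> z a = cobound m a.
Proof.
move=> flF Pup zP.
suff [m mP] : exists m : forall y, F y,
    forall a, (#|up a| <= #|T|)%N -> P a -> z a = cobound m a.
  by exists m => a; apply: mP; apply: max_card.
elim: #|T| => [|n [m mP]].
  by exists (fun=> 0) => a; rewrite leqn0 => /eqP/card0_eq/(_ a); rewrite !inE le_refl.
have [a|s sP] := @dprod_choice T (fun a => F a) (fun a s => P a ->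
    (#|up a| <= n.+1)%N -> forall y, ltr a y -> smap F s = m y - pval (z a) y).
  have [Pa|nPa] := boolP (P a); last by exists 0.
  have [an|nan] := boolP (#|up a| <= n.+1)%N; last by exists 0.
  have [|s sE] := flF a (fun y => m y - pval (z a) y); last by exists s.
  move=> y y' ay yy'; have ay' := ltr_le_trans ay yy'.
  have Py := Pup a y Pa (ltrW ay).
  have yn : (#|up y| <= n)%N by rewrite -ltnS (leq_trans (up_ltr ay)).
  have [eyy'|lyy'] := le_eqVltr yy'; first by subst y'; rewrite smap_id.
  (* The equation already known at y, read at y', is the compatibility of the prescribed
     restrictions. *)
  have := congr1 (fun u => pval u y') (mP y yn Py).
  rewrite pval_mk // -(zP a y Pa (ltrW ay)) pval_mk // smapB => e.
  exact/subr_swap/esym.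
(* Only the points with [#|up a|] equal to n.+1 are new; points strictly above them have a smaller
   count and keep their values. *)
exists (fun a => if (#|up a| == n.+1)%N then s a else m a) => a an Pa.
apply: pmod_eq => y ay; rewrite pval_mk //.
have -> : (#|up y| == n.+1) = false.
  by apply/negbTE; rewrite neq_ltn (leq_trans (up_ltr ay)).
have [ea|na] := eqVneq.
  by rewrite (sP a Pa an y ay) opprB addrC subrK.
rewrite (mP a) ?pval_mk //.
by rewrite -ltnS ltn_neqAle na.
Qed.

End CosyzygySystem.

(** A section of [cosyz F] over the points above x is the coboundary of some m, and m itself
    represents an extension to x. *)
Lemma sflasque_cosyz (F : sys) : sflasque F -> sflasque (cosyz F).
Proof.
move=> flF x M Mc.
have [||m mP] := @sflasque_H1 F (ltr x) M flF.
- by move=> a b xa ab; apply: ltr_le_trans ab.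
- by move=> a b xa ab; apply: Mc.
exists (pmk (ltr x) m) => y xy; rewrite mP //; apply: pmod_eq => w yw.
rewrite !pval_mk //; exact: ltr_le_trans (ltrW yw).
Qed.

(* [Hvan i F] is the vanishing of H^(i+1)(F), by dimension shifting along
   [cosyz]. *)
Fixpoint Hvan (i : nat) (F : sys) : Prop :=
  if i is j.+1 then Hvan j (cosyz F) else H1van F.

(** * Short exact sequences and dimension shifting *)

Section ShortExact.
Variables (F J Q : sys) (i : forall a, F a -> J a) (q : forall a, J a -> Q a).

Record short_exact : Prop := ShortExact {
  sesL1 : forall a, linear (@i a);
  sesL2 : forall a, linear (@q a);
  ses_nat1 : forall a b x, le a b -> i (smap F x : F b) = smap J (i (x : F a));
  ses_nat2 : forall a b x, le a b -> q (smap J x : J b) = smap Q (q (x : J a));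
  ses_inj : forall a, injective (@i a);
  ses_surj : forall a y, exists x, @q a x = y;
  ses_ex : forall a x, @q a x = 0 <-> exists y, i y = x }.

Hypothesis ses : short_exact.

Let iB a : {morph @i a : x y / x - y} := morphDB (linear_morphD (@sesL1 ses a)).
Let qB a : {morph @q a : x y / x - y} := morphDB (linear_morphD (@sesL2 ses a)).
Let i0 a : @i a 0 = 0 := linear_morph0 (@sesL1 ses a).

Definition cosyz_hom (A B : sys) (f : forall a, A a -> B a) a (m : cosyz A a) : cosyz B a :=
  pmk (ltr a) (fun y => f y (pval m y)).

Lemma cosyz_homE (A B : sys) (f : forall a, A a -> B a) a (m : cosyz A a) y :
  ltr a y -> pval (cosyz_hom f m) y = f y (pval m y).
Proof. exact: pval_mk. Qed.

Lemma cosyz_hom_cobound (A B : sys) (f : forall a, A a -> B a) m :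
  (forall a, linear (@f a)) ->
  (forall a b x, le a b -> f b (smap A (x : A a)) = smap B (f a x)) ->
  forall a, cosyz_hom f (cobound m a) = cobound (fun y => f y (m y)) a.
Proof.
move=> fL fn a; apply: pmod_eq => y ay; rewrite !pval_mk //.
by rewrite (morphDB (linear_morphD (fL y))) fn // ltrW.
Qed.

Definition ses_lifts : Prop := forall u, scompat (F := Q) u ->
  exists2 v, scompat (F := J) v & forall a, q (v a) = u a.

Hypothesis flJ : sflasque J.

(** J being flasque, H^1(F) is the cokernel of Gamma(J) -> Gamma(Q); the proof writes out the
    connecting map. *)
Lemma H1van_lifts : H1van F <-> ses_lifts.
Proof.
split=> [hF u uc|lif z zc].
  have [a|g gE] := @dprod_choice T (fun a => J a) (fun a x => q x = u a).
    exact: (ses_surj ses).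
  (* The failure of the chosen lifts g to be compatible is a section of [cosyz F]. *)
  have [a|f fE] := @dprod_choice T (fun a => cosyz F a) (fun a f =>
      forall y, ltr a y -> i (pval f y) = g y - smap J (g a)).
    have [y|f fE] := @dprod_choice T (fun a => F a)
        (fun y x => ltr a y -> i x = g y - smap J (g a)).
      have [ay|nay] := boolP (ltr a y); last by exists 0.
      have /(ses_ex ses)[x xE] : q (g y - smap J (g a)) = 0; last by exists x.
      by rewrite qB gE (ses_nat2 ses) ?ltrW // gE uc ?subrr // ltrW.
    by exists (pmk (ltr a) f) => y ay; rewrite pval_mk // fE.
  have [a b ab|m mE] := hF f.
    apply: pmod_eq => y by_; have ay := le_ltr_trans ab by_.
    rewrite [LHS](cosyz_mapE _ by_); apply: (ses_inj ses).
    rewrite iB (ses_nat1 ses) ?ltrW // (fE a y ay) (fE b y by_).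
    have [eab|lab] := le_eqVltr ab.
      by subst b; rewrite cosyz_self i0 smap0 subr0.
    by rewrite (fE a b lab) smapB (smap_comp _ ab (ltrW by_)) opprB addrA subrK.
  exists (fun a => g a - i (m a)) => [a b ab|a]; last first.
    rewrite qB gE (_ : q (i (m a)) = 0) ?subr0 //.
    by apply/(ses_ex ses); exists (m a).
  have [eab|lab] := le_eqVltr ab; first by subst b; rewrite smap_id.
  rewrite smapB -(ses_nat1 ses) //.
  have := fE a b lab; rewrite mE pval_mk // iB => e.
  exact/subr_swap/esym.
pose iz a := cosyz_hom i (z a).
have [||m mE] := @sflasque_H1 J predT iz flJ => // [a b _ ab|].
  apply: pmod_eq => y by_; have ay := le_ltr_trans ab by_.
  rewrite [LHS](cosyz_mapE _ by_) (cosyz_homE _ _ ay) (cosyz_homE _ _ by_) -(zc a b ab).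
  rewrite [in RHS](cosyz_mapE _ by_) iB (ses_nat1 ses) ?ltrW //.
  have [eab|lab] := le_eqVltr ab; last by rewrite cosyz_homE.
  by subst b; rewrite !cosyz_self i0.
have mq a b : ltr a b -> i (pval (z a) b) = m b - smap J (m a).
  by move=> ab; have := congr1 (fun u => pval u b) (mE a isT); rewrite !pval_mk.
(* In J the image of z is the coboundary of m. Modulo F this makes q m compatible; for a compatible
   lift v of q m, the difference m - v lies in F. *)
have [|v vc vE] := lif (fun a => q (m a)).
  move=> a b ab; have [eab|lab] := le_eqVltr ab; first by subst b; rewrite smap_id.
  rewrite -(ses_nat2 ses) //; apply/esym/eqP; rewrite -subr_eq0 -qB -mq //.
  by apply/eqP/(ses_ex ses); eexists.
have [a|f fE] := @dprod_choice T (fun a => F a) (fun a f => i f = m a - v a).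
  by apply/(ses_ex ses); rewrite qB vE subrr.
exists f => a; apply: pmod_eq => y ay; rewrite pval_mk //; apply: (ses_inj ses).
rewrite iB (ses_nat1 ses) ?ltrW // !fE mq // smapB (vc a y (ltrW ay)).
by rewrite opprB addrA subrK.
Qed.

(** Global sections of [cosyz J] are coboundaries, J being flasque; lifting a section of [cosyz Q]
    to [cosyz J] therefore amounts to writing it as a coboundary. *)
Lemma Hvan_Q1 : (forall z, scompat (F := cosyz Q) z ->
  exists2 v, scompat (F := cosyz J) v & forall a, cosyz_hom q (v a) = z a) <-> H1van Q.
Proof.
split=> [lif z zc|hQ z zc].
  have [v vc vE] := lif z zc.
  have [||m mE] := @sflasque_H1 J predT v flJ => // [a b _|]; first exact: vc.
  exists (fun y => q (m y)) => a; rewrite -vE mE //.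
  by apply: cosyz_hom_cobound; [apply: (sesL2 ses) | move=> *; apply: (ses_nat2 ses)].
have [m mE] := hQ z zc.
have [a|n nE] := @dprod_choice T (fun a => J a) (fun a n => q n = m a); first exact: (ses_surj ses).
exists (cobound n) => [|a]; first exact: cobound_compat.
rewrite mE cosyz_hom_cobound; [|exact: (sesL2 ses)|by move=> *; apply: (ses_nat2 ses)].
by apply: pmod_eq => y ay; rewrite !pval_mk // !nE.
Qed.

End ShortExact.

Lemma cosyz_homL (A B : sys) (f : forall a, A a -> B a) a :
  (forall a, linear (@f a)) -> linear (@cosyz_hom A B f a).
Proof.
by move=> fL c m n; apply: pmod_eq => y ay; rewrite pvalL !pval_mk // pvalL fL.
Qed.

Lemma cosyz_hom_nat (A B : sys) (f : forall a, A a -> B a) :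
  (forall a, linear (@f a)) ->
  (forall a b x, le a b -> f b (smap A (x : A a)) = smap B (f a x)) ->
  forall a b x, le a b ->
    cosyz_hom f (smap (cosyz A) x : cosyz A b) = smap (cosyz B) (cosyz_hom f (x : cosyz A a)).
Proof.
move=> fL fn a b x ab; apply: pmod_eq => y by_.
have ay := le_ltr_trans ab by_.
rewrite [LHS](cosyz_homE _ _ by_) [X in f y X](cosyz_mapE _ by_).
rewrite [RHS](cosyz_mapE _ by_) (cosyz_homE _ _ ay).
rewrite (morphDB (linear_morphD (fL y))) fn ?ltrW //.
have [eab|lab] := le_eqVltr ab; last by rewrite cosyz_homE.
by subst b; rewrite !cosyz_self (linear_morph0 (fL a)).
Qed.

Lemma short_exact_cosyz (F J Q : sys) (i : forall a, F a -> J a) (q : forall a, J a -> Q a) :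
  short_exact i q -> short_exact (F := cosyz F) (J := cosyz J) (Q := cosyz Q)
    (fun a => @cosyz_hom F J i a) (fun a => @cosyz_hom J Q q a).
Proof.
move=> ses; have [iL qL in_ qn ii qs ex] := ses; split.
- by move=> a; apply: cosyz_homL.
- by move=> a; apply: cosyz_homL.
- by move=> a b x; apply: cosyz_hom_nat.
- by move=> a b x; apply: cosyz_hom_nat.
- move=> a x y xy; apply: pmod_eq => w aw; apply: ii.
  by have := congr1 (fun u => pval u w) xy; rewrite !pval_mk.
- move=> a y.
  have [w|f fE] := @dprod_choice T (fun a => J a) (fun w x => q w x = pval y w); first exact: qs.
  by exists (pmk (ltr a) f); apply: pmod_eq => w aw; rewrite !pval_mk.
- move=> a x; split=> [x0|[y <-]].
    have [w|f fE] := @dprod_choice T (fun a => F a) (fun w y => ltr a w -> i w y = pval x w).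
      have [aw|] := boolP (ltr a w); last by exists 0.
      have /ex[y yE] : q w (pval x w) = 0; last by exists y.
      by have := congr1 (fun u => pval u w) x0; rewrite pval_mk.
    by exists (pmk (ltr a) f); apply: pmod_eq => w aw; rewrite !pval_mk // fE.
  apply: pmod_eq => w aw; rewrite !pval_mk // pval0.
  by apply/ex; eexists.
Qed.

(** H^(n+2)(F) and H^(n+1)(Q) vanish together. [Hvan] recurses through [cosyz], so [cosyz] is
    applied to the whole sequence; the base case chains [H1van_lifts] for that new sequence with
    [Hvan_Q1]. *)
Lemma Hvan_shift n (F J Q : sys) (i : forall a, F a -> J a) (q : forall a, J a -> Q a) :
  short_exact i q -> sflasque J -> Hvan n.+1 F <-> Hvan n Q.
Proof.
elim: n F J Q i q => [|n IH] F J Q i q ses flJ.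
  have sesZ := short_exact_cosyz ses.
  rewrite /= (H1van_lifts sesZ (sflasque_cosyz flJ)).
  exact: (Hvan_Q1 ses flJ).
exact: (IH _ _ _ _ _ (short_exact_cosyz ses) (sflasque_cosyz flJ)).
Qed.

(** * Cohomology computed by a flasque resolution *)

Section Resolution.
Variables (F : sys) (J : nat -> sys).
Variables (aug : forall a, F a -> J 0%N a) (d : forall n a, J n a -> J n.+1 a).
Arguments d n {a} _.
Hypotheses (augL : forall a, linear (@aug a)) (dL : forall n a, linear (@d n a)).
Hypothesis aug_nat : forall a b x, le a b -> aug (smap F x : F b) = smap (J 0%N) (aug (x : F a)).
Hypothesis d_nat : forall n a b x, le a b ->
  d n (smap (J n) x : J n b) = smap (J n.+1) (d n (x : J n a)).
Hypothesis aug_inj : forall a, injective (@aug a).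
Hypothesis ex0 : forall a x, d 0 (x : J 0%N a) = 0 <-> exists y, aug y = x.
Hypothesis exS : forall n a x, d n.+1 (x : J n.+1 a) = 0 <-> exists y, d n y = x.
Hypothesis flJ : forall n, sflasque (J n).

Section KernelSystem.
Variable n : nat.
Fact ksys0 a : [set x : J n a | d n x = 0] 0.
Proof. exact: (linear_morph0 (@dL n a)). Qed.
Fact ksysL a (c : R) (u v : J n a) : d n u = 0 -> d n v = 0 -> d n (c *: u + v) = 0.
Proof. by move=> u0 v0; rewrite dL u0 v0 scaler0 addr0. Qed.
Definition ksys_ob a : lmodType R := submod_type (Submod (@ksys0 a) (@ksysL a)).

Fact ksys_map_subproof a b (ab : le a b) (x : ksys_ob a) :
  d n (smap (J n) (val x) : J n b) = 0.
Proof. by rewrite d_nat // (submod_valP x) smap0. Qed.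

(** The value 0 is a default: [smap] is total, whereas d commutes with it only for a <= b. *)
Definition ksys_map a b (x : ksys_ob a) : ksys_ob b :=
  if pselect (le a b) is left ab
  then submod_sub (S := Submod (@ksys0 b) (@ksysL b)) (ksys_map_subproof ab x) else 0.

Lemma ksys_mapE a b (x : ksys_ob a) : le a b -> val (ksys_map b x) = smap (J n) (val x).
Proof. by move=> ab; rewrite /ksys_map; case: pselect. Qed.

Fact ksys_mapL a b : linear (@ksys_map a b).
Proof.
move=> c u v; have [ab|nab] := boolP (le a b).
  by apply: val_inj; rewrite /= !ksys_mapE //= smapL.
rewrite /ksys_map; case: pselect => [ab|_]; first by rewrite ab in nab.
by rewrite scaler0 addr0.
Qed.
Fact ksys_map_id a x : @ksys_map a a x = x.
Proof. by apply: val_inj; rewrite ksys_mapE // smap_id. Qed.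
Fact ksys_map_comp a b c x : le a b -> le b c ->
  @ksys_map b c (@ksys_map a b x) = @ksys_map a c x.
Proof.
move=> ab bc; apply: val_inj.
by rewrite !ksys_mapE ?smap_comp //; apply: le_trans bc.
Qed.
Definition ksys : sys := Sys ksys_mapL ksys_map_id ksys_map_comp.

End KernelSystem.

Definition res_exact n : Prop := forall c : forall a, J n.+1 a,
  scompat c -> (forall a, d n.+1 (c a) = 0) ->
  exists2 b : forall a, J n a, scompat b & forall a, d n (b a) = c a.

Lemma res_ses n : short_exact (F := ksys n) (J := J n) (Q := ksys n.+1)
  (fun a x => val x) (fun a x => submod_sub (S := Submod (@ksys0 n.+1 a) (@ksysL n.+1 a))
     (proj2 (exS _) (ex_intro _ x erefl))).
Proof.
split.
- by [].
- by move=> a c x y; apply: val_inj; rewrite /= dL.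
- by move=> a b x ab; rewrite ksys_mapE.
- by move=> a b x ab; apply: val_inj; rewrite ksys_mapE //= d_nat.
- by move=> a; apply: val_inj.
- by move=> a y; have [x xE] := (exS (val y)).1 (submod_valP y);
    exists x; apply: val_inj.
- move=> a x; split=> [/(congr1 val) x0|[y <-]].
    by exists (submod_sub (S := Submod (@ksys0 n a) (@ksysL n a)) x0).
  by apply: val_inj; apply: (submod_valP y).
Qed.

Lemma res_ses0 : short_exact (F := F) (J := J 0%N) (Q := ksys 1)
  aug (fun a x => submod_sub (S := Submod (@ksys0 1 a) (@ksysL 1 a))
     (proj2 (exS _) (ex_intro _ x erefl))).
Proof.
split=> //.
- by move=> a c x y; apply: val_inj; rewrite /= dL.
- by move=> a b x ab; apply: val_inj; rewrite ksys_mapE //= d_nat.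
- by move=> a y; have [x xE] := (exS (val y)).1 (submod_valP y);
    exists x; apply: val_inj.
- move=> a x; split=> [/(congr1 val)/ex0//|/ex0 x0].
  exact: val_inj.
Qed.

Lemma ksys_lifts n (q : forall a, J n a -> ksys n.+1 a) :
  (forall a x, val (q a x) = d n x) -> ses_lifts q <-> res_exact n.
Proof.
move=> qE; split=> [lif c cc c0|ex u uc].
  have [|v vc vE] := lif (fun a => submod_sub (S := Submod (@ksys0 n.+1 a) (@ksysL n.+1 a)) (c0 a)).
    by move=> a b ab; apply: val_inj; rewrite /= ksys_mapE //= cc.
  by exists v => // a; rewrite -qE vE.
have [a b ab|a|b bc bE] := ex (fun a => val (u a)).
- by rewrite -ksys_mapE // -[ksys_map _ _]/(smap (ksys n.+1) (u a) : ksys n.+1 b) uc.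
- exact: (submod_valP (u a)).
- by exists b => // a; apply: val_inj; rewrite qE bE.
Qed.

(** The resolution is cut into 0 -> ksys k -> J k -> ksys k.+1 -> 0, with F in place of the first
    kernel, and dimensions are shifted. The index is off by one: [res_exact n] is exactness of
    global sections at J n.+1. *)
Lemma Hvan_resolution n : Hvan n F <-> res_exact n.
Proof.
have gen k m : Hvan m (ksys k) <-> res_exact (k + m).
  elim: m k => [|m IH] k.
    by rewrite addn0 /= (H1van_lifts (res_ses k)) //; apply: ksys_lifts.
  by rewrite (Hvan_shift _ (res_ses k)) // IH addSnnS.
case: n => [|n].
  by rewrite /= (H1van_lifts res_ses0) //; apply: ksys_lifts.
by rewrite (Hvan_shift _ res_ses0) // gen.
Qed.

End Resolution.

End Systems.
Arguments smap {R T le} s {a b} x : rename.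

(** * Sections of flat acyclic systems *)

Section ProductTensor.
Variables (R : comPzRingType) (T : finType) (F : T -> lmodType R) (P : pred T).

Fact pproj_linear y : linear (fun m : pmod F P => pval m y).
Proof. by []. Qed.
Definition pproj y : {linear pmod F P -> F y} := lin_of (@pproj_linear y).

Definition pins0 y (s : F y) : pmod F P :=
  pmk P (fun z => if y =P z is ReflectT e then ecast z (F z) e s else 0).
Fact pins_linear y : linear (@pins0 y).
Proof.
move=> a s t; apply: pmod_eq => z Pz; rewrite pvalL !pval_mk //.
by case: eqP => [e|_]; [case: z / e {Pz} | rewrite scaler0 addr0].
Qed.
Definition pins y : {linear F y -> pmod F P} := lin_of (@pins_linear y).

Lemma pval_pins y z s : P z ->
  pval (pins y s) z = if y =P z is ReflectT e then ecast z (F z) e s else 0.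
Proof. by move=> Pz; rewrite lin_ofE pval_mk. Qed.

Lemma pval_pins_id y s : P y -> pval (pins y s) y = s.
Proof.
by move=> Py; rewrite pval_pins //; case: eqP => // e; rewrite (eq_axiomK e).
Qed.

Lemma pval_pins_neq y z s : P z -> y != z -> pval (pins y s) z = 0.
Proof. by move=> Pz yz; rewrite pval_pins //; case: eqP => // e; case/eqP: yz. Qed.

Lemma pmod_sum_pins (m : pmod F P) : m = \sum_(y | P y) pins y (pval m y).
Proof.
apply: pmod_eq => z Pz; rewrite (morphD_sum (f := fun m : pmod F P => pval m z)) //.
rewrite [in RHS](bigD1 z) //= pval_pins_id // big1 ?addr0 // => y /andP[_ yz].
exact: pval_pins_neq.
Qed.

Variable A : lmodType R.

Lemma pmod_tensor_decomp (t : tensor (pmod F P) A) :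
  t = \sum_(y | P y) tmap (pins y) (idfun : {linear A -> A}) (tmap (pproj y) idfun t).
Proof.
elim/tensor_ind: t => [|m a t IH].
  by rewrite big1 // => y _; rewrite !tmap0.
rewrite {1}IH; under [RHS]eq_bigr do rewrite !tmapD.
rewrite big_split /=; congr (_ + _).
under eq_bigr do rewrite !tmap_pure.
rewrite {1}[m]pmod_sum_pins.
by rewrite (morphD_sum (f := fun m : pmod F P => pure m a)) // => x y; apply: pureDl.
Qed.

Lemma pmod_tensor_eq0 (t : tensor (pmod F P) A) :
  (forall y, P y -> tmap (pproj y) (idfun : {linear A -> A}) t = 0) -> t = 0.
Proof.
by move=> t0; rewrite [t]pmod_tensor_decomp big1 // => y Py; rewrite t0 // tmap0.
Qed.

Variables (G : T -> lmodType R) (b : forall y, F y -> A -> G y).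
Hypothesis bG : forall y, istensor (@b y).

Definition pbil (m : pmod F P) (a : A) : pmod G P := pmk P (fun y => b (pval m y) a).

Lemma pbil_balanced : balanced pbil.
Proof.
split=> [m m' a|m a a'|c m a]; apply: pmod_eq => y Py; rewrite ?pvalD !pval_mk //;
  have [[Dl Dr Z] _ _] := bG y.
- by rewrite pvalD Dl.
- by rewrite Dr.
- by rewrite -Z.
Qed.

Lemma pval_tlift_pbil y t : P y ->
  pval (tlift pbil t) y = tlift (@b y) (tmap (pproj y) (idfun : {linear A -> A}) t).
Proof.
move=> Py; have [bb _ _] := bG y.
move: t; apply: (@tensor_ext _ _ _ _ (fun t => pval (tlift pbil t) y)
  (fun t => tlift (@b y) (tmap (pproj y) (idfun : {linear A -> A}) t))) => [s t|s t|m a].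
- by rewrite (tliftD pbil_balanced) pvalD.
- by rewrite tmapD (tliftD bb).
- by rewrite tmap_pure (tlift_pure pbil_balanced) (tlift_pure bb) pval_mk.
Qed.

(** Finite products commute with tensor products: preimages found in each factor are put together by
    [pins]. *)
Lemma pbil_istensor : istensor pbil.
Proof.
apply: istensor_intro => [|t t0|n]; first exact: pbil_balanced.
  apply: pmod_tensor_eq0 => y Py; apply: (istensor_ker (bG y)).
  by rewrite -pval_tlift_pbil // t0.
have [y|u uE] := @dprod_choice T (fun y => tensor (F y) A)
    (fun y u => tlift (@b y) u = pval n y).
  by have [_ _ s] := bG y; apply: s.
exists (\sum_(y | P y) tmap (pins y) idfun (u y)); apply: pmod_eq => z Pz.
rewrite pval_tlift_pbil // -[RHS]uE; congr (tlift _ _).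
rewrite (morphD_sum (@tmapD _ _ _ _ _ _ _)) (bigD1 z) //= big1 => [|y /andP[_ yz]].
  rewrite addr0 (tmap_comp (f2 := idfun) (g2 := idfun)) // ?tmap_id // => x.
  exact: pval_pins_id.
rewrite (tmap_comp (f2 := pproj z \o pins y) (g2 := idfun)) //.
by apply: tmap_zero; left=> x; apply: pval_pins_neq.
Qed.

End ProductTensor.

Lemma flat_pmod (R : comPzRingType) (T : finType) (F : T -> lmodType R) (P : pred T) :
  (forall y, P y -> flat_mod (F y)) -> flat_mod (pmod F P).
Proof.
move=> flF A B u ui; apply: morphD_inj => [|t t0]; first exact: tmapD.
apply: pmod_tensor_eq0 => y Py; apply: (flF y Py A B u ui).
rewrite tmap0 (tmap_comp (f2 := pproj F P y) (g2 := u)) //.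
by rewrite -(tmap_comp (f := idfun) (g := u) (f' := pproj F P y) (g' := idfun)) // t0 tmap0.
Qed.

Lemma flat_mod0 (R : comPzRingType) (M : lmodType R) :
  (forall m : M, m = 0) -> flat_mod M.
Proof.
move=> M0 A B u ui; apply: morphD_inj => [|t _]; first exact: tmapD.
by elim/tensor_ind: t => // m a t ->; rewrite (M0 m) pure0l addr0.
Qed.

Section FlatAcyclic.
Variables (R : comPzRingType) (T : finType) (le : rel T).
Hypotheses (le_refl : reflexive le) (le_anti : antisymmetric le)
  (le_trans : transitive le).
Notation sys := (sys R le).
Notation cosyz := (cosyz le_anti le_trans).
Notation Hvan := (Hvan le_anti le_trans).

Section Sections.
Variable F : sys.
Fact secm0 : [set s : dprod F | scompat s] 0.
Proof. by move=> a b _; apply: smap0. Qed.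
Fact secmL (c : R) (u v : dprod F) : scompat u -> scompat v -> scompat (c *: u + v).
Proof. by move=> cu cv a b ab; rewrite dprodD dprodZ smapL cu // cv. Qed.
Definition secm : Type := submod_type (Submod secm0 secmL).
HB.instance Definition _ := GRing.Lmodule.on secm.
Definition secm_val (s : secm) a : F a := (val s : dprod F) a.
Lemma secm_compat (s : secm) : scompat (secm_val s).
Proof. exact: (submod_valP s). Qed.
Lemma secm_valL c (s t : secm) a :
  secm_val (c *: s + t) a = c *: secm_val s a + secm_val t a.
Proof. by []. Qed.
Definition secm_mk (f : forall a, F a) (fc : scompat f) : secm :=
  submod_sub (S := Submod secm0 secmL) (v := f : dprod F) fc.
Lemma secm_eq (s t : secm) : (forall a, secm_val s a = secm_val t a) -> s = t.
Proof. by move=> st; apply/val_inj/dprod_eq. Qed.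
End Sections.

Definition tensor_sys (A : lmodType R) (F G : sys) (b : forall a, F a -> A -> G a) : Prop :=
  (forall a, istensor (@b a)) /\
  forall a c x s, le a c -> smap G (b a x s) = b c (smap F x) s.

Section TensorSections.
Variables (A : lmodType R) (F G : sys) (b : forall a, F a -> A -> G a).
Hypothesis bG : tensor_sys b.

Fact secm_bil_subproof (s : secm F) (x : A) : scompat (fun a => b (secm_val s a) x).
Proof. by move=> a c ac; rewrite bG.2 // secm_compat. Qed.
Definition secm_bil (s : secm F) (x : A) : secm G := secm_mk (@secm_bil_subproof s x).

Lemma secm_bil_balanced : balanced secm_bil.
Proof.
split=> [m m' x|m x x'|c m x]; apply: secm_eq => y;
  have [[Dl Dr Z] _ _] := bG.1 y; [exact: Dl | exact: Dr | exact: Z].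
Qed.

(** [cosyz] is built from finite products and from the maps of F, and both are compatible with
    tensoring by A. *)
Lemma tensor_sys_cosyz : tensor_sys (F := cosyz F) (G := cosyz G) (A := A)
  (fun a m x => pbil (P := ltr le a) b m x).
Proof.
split=> [a|a c m x ac]; first by apply: pbil_istensor bG.1.
have bB y : {morph (fun s : F y => b s x) : u v / u - v}.
  by apply: morphDB => u v; have [[Dl _ _] _ _] := bG.1 y; apply: Dl.
apply: pmod_eq => y cy.
have ay := le_ltr_trans le_anti le_trans ac cy.
rewrite [LHS](cosyz_mapE _ cy) [RHS](pval_mk _ cy) (pval_mk _ ay).
rewrite [X in _ = b X _](cosyz_mapE _ cy) bB; congr (_ - _).
have [eac|lac] := le_eqVltr ac; last first.
  by rewrite -bG.2 ?(ltrW cy) // (pval_mk _ lac).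
by subst c; rewrite !cosyz_self !smap0; have := bB y 0 0; rewrite /= !subrr => ->.
Qed.
End TensorSections.

Definition null (n : nat) (F : sys) : Prop :=
  forall a, (#|up le a| <= n)%N -> forall s : F a, s = 0.

Lemma null_cosyz n F : null n F -> null n.+1 (cosyz F).
Proof.
move=> nF a an s; apply: pmod_eq => y ay; apply: nF.
by rewrite -ltnS (leq_trans (up_ltr le_refl le_anti le_trans ay)).
Qed.

Lemma zero_Hvan i (G : sys) : (forall a (s : G a), s = 0) -> Hvan i G.
Proof.
elim: i G => [|i IH] G G0 /=; last first.
  by apply: IH => a s; apply: pmod_eq => y _; apply: G0.
move=> z _; exists (fun=> 0) => a; apply: pmod_eq => y _.
exact: etrans (G0 _ _) (esym (G0 _ _)).
Qed.

(* By induction on the number of points with a nonzero stalk, along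
   0 -> Gamma(F) -> prod_y F(y) -> Gamma(cosyz F) -> 0. *)
Lemma flat_acyclic_sections (F : sys) :
  (forall a, flat_mod (F a)) -> (forall i, Hvan i F) ->
  flat_mod (secm F) /\
  forall (A : lmodType R) (G : sys) (b : forall a, F a -> A -> G a) (bG : tensor_sys b),
    istensor (secm_bil bG) /\ forall i, Hvan i G.
Proof.
(* Every point lies above itself, so F is [null 0]; the induction ends at [null #|T|], which means F
   = 0. *)
have [n nF] : exists n, null (#|T| - n) F.
  exists #|T| => a; rewrite subnn leqn0 => /eqP/card0_eq/(_ a).
  by rewrite !inE le_refl.
elim: n F nF => [|n IH] F nF flF hF.
  have F0 a (s : F a) : s = 0 by apply: nF; rewrite subn0 max_card.
  have S0 (s : secm F) : s = 0.
    by apply: secm_eq => a; apply: etrans (F0 _ _) (esym (F0 _ _)).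
  split=> [|A G b bG]; first exact: flat_mod0.
  have G0 a (t : G a) : t = 0.
    have [[Dl _ _] _ bs] := bG.1 a; have [u <-] := bs t.
    elim/tensor_ind: u => [|m x u IH]; first by rewrite (tlift0 _) //; case: (bG.1 a).
    rewrite (tliftD _) ?IH ?addr0; [|by case: (bG.1 a)..].
    rewrite (tlift_pure _); [|by case: (bG.1 a)].
    by apply: (addrI (b a m x)); rewrite -Dl [m + m]F0 addr0 [m]F0.
  split; last by move=> i; apply: zero_Hvan.
  apply: istensor_intro => [|u _|t]; first exact: secm_bil_balanced.
    by elim/tensor_ind: u => // m a u ->; rewrite (S0 m) pure0l addr0.
  exists 0; rewrite (tlift0 (secm_bil_balanced bG)).
  by apply: secm_eq => a; apply: etrans (G0 _ _) (esym (G0 _ _)).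
(* [cosyz F] also vanishes where F vanishes at all points strictly above, which gains one step.
   Subtraction being truncated, n >= #|T| is treated apart. *)
have nZ : null (#|T| - n) (cosyz F).
  move=> a an s; have [nT|Tn] := ltnP n #|T|.
    by apply: (null_cosyz nF); rewrite -subSn // subSS.
  move: an; rewrite (eqP Tn) leqn0 => /eqP/card0_eq/(_ a).
  by rewrite !inE le_refl.
have ltrA := le_ltr_trans le_anti le_trans.
have flP (P : pred T) : flat_mod (pmod F P) by apply: flat_pmod.
have [flZ IHZ] := IH (cosyz F) nZ (fun a => flP _) (fun i => hF i.+1).
pose Pi := pmod F predT.
pose delta0 (m : Pi) : secm (cosyz F) :=
  secm_mk (cobound_compat le_anti le_trans (pval m)).
have deltaE m a y : ltr le a y ->
    pval (secm_val (delta0 m) a) y = pval m y - smap F (pval m a).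
  exact: pval_mk.
have deltaL : linear delta0.
  move=> c u v; apply: secm_eq => a; apply: pmod_eq => y ay.
  rewrite secm_valL pvalL !deltaE // !pvalL smapL.
  by rewrite scalerBr opprD addrACA.
pose delta := lin_of deltaL.
have iL : linear (fun s : secm F => pmk predT (secm_val s) : Pi).
  by move=> c u v; apply: pmod_eq => y _; rewrite pvalL !pval_mk.
pose i := lin_of iL.
have ii : injective i.
  move=> s t st; apply: secm_eq => a.
  by have := congr1 (fun m => pval m a) st; rewrite !lin_ofE !pval_mk.
have ds y : exists x, delta x = y.
  have [m mE] := hF 0%N (secm_val y) (secm_compat y).
  exists (pmk predT m : Pi); apply: secm_eq => a; rewrite mE.
  by apply: pmod_eq => z az; rewrite [LHS](coboundE _ _ _ az) [RHS](coboundE _ _ _ az) !pval_mk.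
have ex m : delta m = 0 <-> exists s, i s = m.
  split=> [d0|[s <-]].
    have mc : scompat (pval m).
      move=> a c ac; have [eac|lac] := le_eqVltr ac; first by subst c; rewrite smap_id.
      have := congr1 (fun u : secm (cosyz F) => pval (secm_val u a) c) d0.
      by rewrite [LHS]deltaE // => /subr0_eq/esym.
    by exists (secm_mk mc); apply: pmod_eq => y _; rewrite lin_ofE pval_mk.
  apply: secm_eq => a; apply: pmod_eq => y ay.
  rewrite [LHS]deltaE // !lin_ofE !pval_mk //.
  by rewrite secm_compat ?subrr // (ltrW ay).
(* The last term of 0 -> Gamma(F) -> Pi -> Gamma(cosyz F) -> 0 is flat by induction, so i stays
   injective after tensoring. *)
have iT (A : lmodType R) : injective (tmap i (idfun : {linear A -> A})).
  exact: tensor_flat_inj ii ds ex flZ.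
have flS : flat_mod (secm F).
  move=> A B u ui; apply: morphD_inj => [|t t0]; first exact: tmapD.
  apply: iT; rewrite tmap0; apply: (flP predT A B u ui).
  rewrite tmap0 (tmap_comp (f2 := i) (g2 := u)) //.
  by rewrite -(tmap_comp (f := idfun) (g := u) (f' := i) (g' := idfun)) // t0 tmap0.
split=> // A G b bG.
have [bZ hZ] := IHZ A (cosyz G) _ (tensor_sys_cosyz bG).
have bPi : istensor (pbil (P := predT) b) by apply: pbil_istensor bG.1.
have bS := secm_bil_balanced bG.
have pbS := pbil_balanced predT bG.1.
have val_i t y : pval (tlift (pbil (P := predT) b) (tmap i idfun t)) y =
    secm_val (tlift (secm_bil bG) t) y.
  move: t; apply: (@tensor_ext _ _ _ _
    (fun t => pval (tlift (pbil (P := predT) b) (tmap i idfun t)) y)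
    (fun t => secm_val (tlift (secm_bil bG) t) y)) => [s t|s t|s x].
  - by rewrite tmapD (tliftD pbS).
  - by rewrite (tliftD bS).
  - by rewrite tmap_pure (tlift_pure pbS) (tlift_pure bS) pval_mk // lin_ofE pval_mk.
have bZS := secm_bil_balanced (tensor_sys_cosyz bG).
have val_d u a y : ltr le a y ->
    pval (secm_val (tlift (secm_bil (tensor_sys_cosyz bG)) (tmap delta idfun u)) a) y =
    pval (tlift (pbil (P := predT) b) u) y -
      smap G (pval (tlift (pbil (P := predT) b) u) a).
  move=> ay; move: u; apply: (@tensor_ext _ _ _ _ (fun u => pval (secm_val
    (tlift (secm_bil (tensor_sys_cosyz bG)) (tmap delta idfun u)) a) y)
    (fun u => pval (tlift (pbil (P := predT) b) u) y -
      smap G (pval (tlift (pbil (P := predT) b) u) a))) => [s t|s t|m x].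
  - by rewrite tmapD (tliftD bZS).
  - by rewrite (tliftD pbS) !pvalD smapD opprD addrACA.
  - have bB : {morph (fun s => b y s x) : u v / u - v}.
      by apply: morphDB => u v; have [[Dl _ _] _ _] := bG.1 y; apply: Dl.
    by rewrite tmap_pure (tlift_pure pbS) (tlift_pure bZS) !pval_mk // bG.2 ?(ltrW ay).
split=> [|[|j]]; last exact: hZ.
  apply: istensor_intro => // [t t0|s].
    apply: iT; rewrite tmap0; apply: (istensor_ker bPi).
    by apply: pmod_eq => y _; rewrite val_i t0.
  (* As a family of stalks, s comes from u in Pi (x) A. The coboundary of s is zero, so u dies in
     Gamma(cosyz F) (x) A and comes from Gamma(F) (x) A. *)
  have [_ _ /(_ (pmk predT (secm_val s)))[u uE]] := bPi.
  have [|v vE] := tensor_exactl ds (fun m => (ex m).1) (t := u).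
    apply: (istensor_ker bZ); apply: secm_eq => a; apply: pmod_eq => y ay.
    by rewrite val_d // uE !pval_mk // secm_compat ?subrr // (ltrW ay).
  by exists v; apply: secm_eq => y; rewrite -val_i vE uE pval_mk.
(* H^1(G) = 0: a section of [cosyz G] comes from Gamma(cosyz F) (x) A, onto which Pi (x) A maps. *)
move=> z zc; have [_ _ /(_ (secm_mk zc))[w wE]] := bZ.
have [u uE] := tmap_surj (g := (idfun : {linear A -> A})) ds (fun y => ex_intro _ y erefl) w.
exists (pval (tlift (pbil (P := predT) b) u)) => a; apply: pmod_eq => y ay.
by rewrite [RHS](coboundE _ _ _ ay) -val_d // uE wE.
Qed.

End FlatAcyclic.

(** * The diagonal of a schematic finite space *)

Section ProductSpace.
Variable X : topologicalType.

Lemma prod_spec_le (z z' : (X * X)%type) : finite_set [set: X] ->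
  spec_le z z' <-> prod_le z z'.
Proof.
move=> finX; split=> [zz'|zz' W [oW Wz]]; last first.
  exact: (prod_le_open (W := Opn oW) zz').
split=> W [oW Wz].
  apply: (zz' (fst @^-1` W)); split=> //.
  by apply: (continuousP fst).1 => // w; apply: cvg_fst.
apply: (zz' (snd @^-1` W)); split=> //.
by apply: (continuousP snd).1 => // w; apply: cvg_snd.
Qed.

Lemma finite_square : finite_set [set: X] -> finite_set [set: (X * X)%type].
Proof. by move=> finX; rewrite -setXTT; apply: finite_setX. Qed.

End ProductSpace.

Notation stalk_over finX O pq :=
  (rscal (stalk_map finX O pq) (stalk finX O _)^o) (only parsing).

Section Diagonal.
Variables (k : comPzRingType) (X : topologicalType).
Variables (finX : finite_set [set: X]) (O : ringSheaf X).
Variables (kappa : {rmorphism k -> O (opnT X)}).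
Notation OXX := (prod_sheaf finX kappa).
Notation delta := (diagonal_morphism finX kappa).
Notation U_ := (umin finX).
Notation finXX := (finite_square finX).
Notation D W := (opreim (@diag_continuous X) W).

Section Germ.
Variables (a b : X) (W : opn (X * X)%type).
Hypothesis Wab : minimal_at W (a, b).

Lemma minimal_square_mem : oset W (a, b).
Proof. by rewrite Wab; apply: umin_set_refl. Qed.

Lemma minimal_square_le z : oset W z -> prod_le (a, b) z.
Proof. by rewrite [oset W]Wab => /(prod_spec_le (a, b) z finX). Qed.

Definition germ (s : OXX W) : prod_stalk finX kappa (a, b) :=
  val s (exist _ (a, b) minimal_square_mem).

Lemma germM s t : germ (s * t) = germ s * germ t. Proof. by []. Qed.
Lemma germD s t : germ (s + t) = germ s + germ t. Proof. by []. Qed.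

Fact germ_surj_subproof (t : prod_stalk finX kappa (a, b)) :
  compatible (@prod_tr X finX O k kappa)
   ((fun w => prod_tr finX kappa (minimal_square_le (proj2_sig w)) t) :
      stalk_fam (prod_stalk finX kappa) W).
Proof.
apply/asboolP => w w' h.
elim/tring_ind: t => [|u v t IH]; first by rewrite !rmorph0.
rewrite !rmorphD IH; congr (_ + _).
rewrite /= !tpairing_pure /= /tinl /tinr !tpureM tpairing_pure /= /tinl /tinr.
rewrite tpureM !mulr1 !mul1r.
by congr (tpure _ _ _ _); apply: rres_comp.
Qed.

(** Over a minimal open set an element of the stalk spreads to all points through the restriction
    maps. *)
Lemma germ_surj t : exists s, germ s = t.
Proof.
exists (exist (fun s => is_true (compatible (@prod_tr X finX O k kappa) s)) _
  (germ_surj_subproof t) : OXX W).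
rewrite -[LHS]/(prod_tr finX kappa (minimal_square_le minimal_square_mem) t).
elim/tring_ind: t => [|u v t IH]; first by rewrite !rmorph0.
rewrite rmorphD IH; congr (_ + _).
rewrite /= tpairing_pure /= /tinl /tinr tpureM mulr1 mul1r.
by congr (tpure _ _ _ _); apply: rres_id.
Qed.

Lemma diag_subl : D W `<=` U_ a. Proof. by move=> y /minimal_square_le[]. Qed.
Lemma diag_subr : D W `<=` U_ b. Proof. by move=> y /minimal_square_le[]. Qed.

Fact diag_pair_subproof c : @rres X O (U_ a) (D W) diag_subl (stalk_alg finX kappa a c) =
  @rres X O (U_ b) (D W) diag_subr (stalk_alg finX kappa b c).
Proof. exact: rres_compE. Qed.

Definition diag_pair := tpairing diag_pair_subproof.

(** On the stalk at (a, b), delta^# sends u (x) v to the product of the restrictions of u and v to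
    the trace on the diagonal; this is checked at each point of the trace. *)
Lemma diag_sharp_germ (s : OXX W) : diag_sharp s = diag_pair (germ s).
Proof.
apply: is_diag_sharp_unique (diag_sharpP s) _ => y.
have yW : oset W (diag (sval y)) by apply: (svalP y).
have h := minimal_square_le yW.
have -> : val s (exist _ (diag (sval y)) (svalP y)) = prod_tr finX kappa h (germ s).
  apply/esym.
  exact: (stalk_secP s (w := exist _ (a, b) minimal_square_mem)
    (w' := exist _ (diag (sval y)) (svalP y)) h).
rewrite /diag_pair; elim/tring_ind: (germ s) => [|u v t IH]; first by rewrite !rmorph0.
rewrite !rmorphD IH; congr (_ + _).
rewrite /= !tpairing_pure /= /tinl /tinr tpureM mulr1 mul1r tpairing_pure rmorphM /=.
by congr (_ * _); apply: rres_comp.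
Qed.

End Germ.
End Diagonal.

Section SchematicConsequences.
Variables (k : comPzRingType) (X : topologicalType).
Variables (finX : finite_set [set: X]) (O : ringSheaf X).
Variables (kappa : {rmorphism k -> O (opnT X)}).
Hypothesis schX : schematic finX kappa.
Notation OXX := (prod_sheaf finX kappa).
Notation delta := (diagonal_morphism finX kappa).
Notation U_ := (umin finX).
Notation finXX := (finite_square finX).
Notation D W := (opreim (@diag_continuous X) W).

Variables (p p' x : X) (pp' : spec_le p p') (px : spec_le p x).
Let P := umin finXX (p, x).
Let Q := umin finXX (p', x).
Let hQP : Q `<=` P.
Proof.
apply: umin_sub; apply/prod_spec_le => //; split=> //=; exact: spec_le_refl.
Qed.
Let Pmin : minimal_at P (p, x) := minimal_umin finXX (p, x).
Let Qmin : minimal_at Q (p', x) := minimal_umin finXX (p', x).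
Let hD : D Q `<=` D P. Proof. by move=> y; apply: hQP. Qed.

Lemma diag_umin (a b : X) : D (umin finXX (a, b)) = opnI (U_ a) (U_ b).
Proof.
apply/opn_eq/seteqP; split=> y /=; first by move=> /prod_spec_le-/(_ finX)[].
by move=> [ay by_]; apply/prod_spec_le.
Qed.

(** U_p contains U_x because p <= x, so the trace U_p /\ U_x is U_x. *)
Let DPmin : minimal_at (D P) x.
Proof.
rewrite /minimal_at diag_umin; apply/seteqP; split=> y /=; first by case.
by move=> xy; split=> //; apply: spec_le_trans px xy.
Qed.

(* R^(n+1) delta_* O vanishes on the minimal open set of (p, x), whose trace on
   the diagonal is U_x; being quasi-coherent, it then vanishes on the minimal
   open set of (p', x), whose trace is the intersection of U_p' and U_x. *)
Lemma schematic_acyclic n : exists I : injective_resolution (struct_mod O),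
  forall c : I n.+1 (opnI (U_ p') (U_ x)), ires_d I n.+1 _ c = 0 ->
  exists b : I n (opnI (U_ p') (U_ x)), ires_d I n _ b = c.
Proof.
have [H [I [pr [epi kerp]]] qcH] := schX.2 n.+1; exists I.
rewrite -diag_umin => c c0.
(* The trace of P is minimal at x, so the resolution of O is exact on sections there and every class
   in H(P) is a coboundary. *)
have HP0 (e : H P) : e = 0.
  have [z _ <-] := locally_in_minimal (Pr := fun V => range (pr V)) Pmin (@epi P e).
  apply/kerp => w Pw; exists P, (@subset_refl _ P); split=> //; rewrite mres_id.
  have /ires_exact lz : ires_d I n.+1 (D P) (val z) = 0 := ker_secP z.
  have [b _ bE] := locally_in_minimal (Pr := fun V => range (ires_d I n V)) DPmin lz.
  by exists b.
have HQ0 (e : H Q) : e = 0.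
  have [bb _ /(_ e)[u <-]] := quasi_coherent_base_change finXX qcH hQP Pmin Qmin.
  elim/tensor_ind: u => [|m y u IH]; first exact: (tlift0 bb).
  by rewrite (tliftD bb) IH addr0 (tlift_pure bb) (HP0 y) mres0 scaler0.
pose z : ker_sheaf (direct_image_hom delta (ires_d I n.+1)) Q :=
  @ker_sec _ _ _ _ (direct_image_hom delta (ires_d I n.+1)) Q c c0.
have [b _ bE] := locally_in_minimal (Pr := coboundaries
  (fun n => direct_image_hom delta (ires_d I n)) n.+1) Qmin ((kerp Q z).1 (HQ0 _)).
by exists b.
Qed.

Section DegreeZero.
Variables (H : modSheaf OXX) (qcH : quasi_coherent H).
Variables (I : injective_resolution (struct_mod O)).
Notation dI := (fun n => direct_image_hom delta (ires_d I n)).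
Variables (pr : modHom (ker_sheaf (dI 0%N)) H) (epi : mod_epi pr).
Hypothesis kerp : forall U (z : ker_sheaf (dI 0%N) U),
  pr U z = 0 <-> locally_in (coboundaries dI 0) (val z).

Let aug0 (V : opn X) (a : O V) : ires_d I 0 V (ires_aug I V a) = 0.
Proof.
apply/ires_exact0 => y Vy; exists V, (@subset_refl _ V); split=> //.
by rewrite mres_id; exists a.
Qed.

(** Through the augmentation O -> ker d^0 the direct image delta_* O is identified with H;
    surjectivity over P comes from minimality of its trace. *)
Let om (W : opn (X * X)%type) (a : O (D W)) : H W :=
  pr W (@ker_sec _ _ _ _ (dI 0%N) W (ires_aug I (D W) a) (aug0 a)).

Let omL W (s : OXX W) (a b : O (D W)) :
  om (diag_sharp s * a + b) = s *: om a + om b.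
Proof.
rewrite /om -homL; congr (pr W _); apply: val_inj.
exact: (homL (ires_aug I) (D W) (diag_sharp s) a b).
Qed.

Let om_res (W W' : opn (X * X)%type) (h : W' `<=` W) (h' : D W' `<=` D W) a :
  mres h (om a) = om (rres h' a).
Proof.
rewrite /om -hom_res; congr (pr W' _); apply: val_inj => /=.
rewrite (hom_res (ires_aug I) h' a).
by congr (mres _ _); apply: Prop_irrelevance.
Qed.

Let omD W : {morph @om W : a b / a + b}.
Proof. by move=> a b; have := omL 1 a b; rewrite rmorph1 mul1r scale1r. Qed.

Let omZ W (s : OXX W) (a : O (D W)) : om (diag_sharp s * a) = s *: om a.
Proof. by have := omL s a 0; rewrite (morphD0 (@omD W)) !addr0. Qed.

Let om_inj W : injective (@om W).
Proof.
apply: morphD_inj => [|a /kerp la]; first exact: omD.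
apply: (ires_mono (i := I)); rewrite hom0.
have := modHom_eq0 (finX := finXX) (g := mod_id (direct_image delta (I 0%N)))
  (V := W) (s := ires_aug I (D W) a).
apply=> w Ww.
apply: (locally_in_minimal (Pr := coboundaries dI 0) (minimal_umin finXX w)).
by apply: locally_in_res la => *; apply: coboundaries_res.
Qed.

Let om_surj (e : H P) : exists a, om a = e.
Proof.
have [z _ <-] := locally_in_minimal (Pr := fun V => range (pr V)) Pmin (@epi P e).
have /ires_exact0 lz : ires_d I 0 (D P) (val z) = 0 := ker_secP z.
have [a _ aE] := locally_in_minimal (Pr := fun V => range (ires_aug I V)) DPmin lz.
by exists a; congr (pr P _); apply: val_inj.
Qed.

Notation C := (tring (stalk_map finX O pp') (stalk_map finX O px)).

Let DQl : D Q `<=` U_ p' := diag_subl finX Qmin.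
Let DQr : D Q `<=` U_ x := diag_subr finX Qmin.
Let xDP : U_ x `<=` D P. Proof. by rewrite [oset (D P)]DPmin. Qed.

Let theta_subproof c : @rres X O _ (D Q) DQl (stalk_map finX O pp' c) =
  @rres X O _ (D Q) DQr (stalk_map finX O px c).
Proof. exact: rres_compE. Qed.
Let theta : {rmorphism C -> O (D Q)} := tpairing theta_subproof.

Let lam_subproof c :
  tinl (stalk_map finX O pp') (stalk_map finX O px) (stalk_alg finX kappa p' c) =
  tinr (stalk_map finX O pp') (stalk_map finX O px) (stalk_alg finX kappa x c).
Proof.
by rewrite -(stalk_map_alg finX kappa pp') -(stalk_map_alg finX kappa px) tinl_tinr.
Qed.
Let lam : {rmorphism prod_stalk finX kappa (p', x) -> C} := tpairing lam_subproof.

Let lam_pure a b : lam (tpure _ _ a b) = tpure _ _ a b.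
Proof. by rewrite /lam /= tpairing_pure /= /tinl /tinr tpureM mulr1 mul1r. Qed.

Let theta_lam t : theta (lam t) = diag_pair Qmin t.
Proof.
rewrite /diag_pair; elim/tring_ind: t => [|a b t IH]; first by rewrite !rmorph0.
rewrite !rmorphD IH; congr (_ + _).
rewrite lam_pure /theta /= !tpairing_pure.
by congr (rres _ _ * rres _ _); apply: Prop_irrelevance.
Qed.

Let lam_surj t : exists t0, lam t0 = t.
Proof.
elim/tring_ind: t => [|a b t [t0 <-]]; first by exists 0; rewrite rmorph0.
by exists (tpure _ _ a b + t0); rewrite rmorphD lam_pure.
Qed.

(* On the image of O_p (x)_k O_x the map lam factors through the
   multiplication O_p (x)_k O_x -> O_x. *)
Let lam_germ (s : OXX P) : lam (germ Qmin (rres hQP s)) =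
  tinr (stalk_map finX O pp') (stalk_map finX O px) (rres xDP (diag_sharp s)).
Proof.
rewrite (diag_sharp_germ Pmin).
have h : prod_le (p, x) (p', x) by split=> //=; apply: spec_le_refl.
have -> : germ Qmin (rres hQP s) = prod_tr finX kappa h (germ Pmin s).
  apply/esym; exact: (stalk_secP s (w := exist _ (p, x) (minimal_square_mem Pmin))
    (w' := exist _ (p', x) (hQP (minimal_square_mem Qmin))) h).
rewrite /diag_pair; elim/tring_ind: (germ Pmin s) => [|a b t IH].
  by rewrite !rmorph0.
rewrite !rmorphD IH; congr (_ + _).
rewrite [prod_tr _ _ _ _]tpairing_pure /= /tinl /tinr tpureM mulr1 mul1r.
rewrite -[tpairing lam_subproof _]/(lam _) lam_pure tpairing_pure rmorphM /=.
apply: (etrans (y := tpure (stalk_map finX O pp') (stalk_map finX O px)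
  (stalk_map finX O pp' a * 1) b)).
  by rewrite mulr1; congr (tpure _ _ _ _); [apply: stalk_map_irr | apply: rres_id].
rewrite tpureZ; congr (tpure _ _ 1 (_ * _)); first exact/esym/rres_comp.
by rewrite (rres_comp _ _ (@subset_refl _ (U_ x))) rres_id.
Qed.

(** The inverse direction: with H(P) identified with O_x by [om], the pair (s, a) goes to the class
    of the germ of s times 1 (x) a. It is balanced by [lam_germ]. *)
Let g (s : rscal (@rres _ OXX P Q hQP) (OXX Q)^o) (e : H P) : C :=
  lam (germ Qmin (s : OXX Q)) *
  tinr (stalk_map finX O pp') (stalk_map finX O px) (rres xDP (sval (cid (om_surj e)))).

Let gE s a : g s (om a) = lam (germ Qmin (s : OXX Q)) *
  tinr (stalk_map finX O pp') (stalk_map finX O px) (rres xDP a).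
Proof. by rewrite /g; case: cid => b e; rewrite /= (om_inj e). Qed.

Let g_balanced : balanced g.
Proof.
split=> [s s' e|s e e'|c s e].
- by rewrite /g germD rmorphD mulrDl.
- have [a <-] := om_surj e; have [a' <-] := om_surj e'.
  by rewrite -omD !gE !rmorphD mulrDr.
- have [a <-] := om_surj e; rewrite -omZ !gE rscalE germM !rmorphM lam_germ.
  by rewrite mulrCA mulrA.
Qed.

(** With H(P) = O_x and H(Q) = O(D Q), base change for H presents O(D Q) as the tensor product of
    O_p' (x)_k O_x and O_x over O_p (x)_k O_x, and this is O_p' (x)_{O_p} O_x. *)
Lemma schematic_sections_zero : istensor
  (fun (a : stalk_over finX O pp')
       (b : stalk_over finX O px) =>
    @rres X O _ (D Q) DQl a * @rres X O _ (D Q) DQr b).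
Proof.
have bal : balanced (fun (a : stalk_over finX O pp')
       (b : stalk_over finX O px) =>
    @rres X O _ (D Q) DQl a * @rres X O _ (D Q) DQr b).
  split=> [a a' b|a b b'|c a b].
  - by rewrite rmorphD mulrDl.
  - by rewrite rmorphD mulrDr.
  - by rewrite !rscalE !rmorphM /= theta_subproof mulrCA mulrA.
have [bb binj bsurj] := quasi_coherent_base_change finXX qcH hQP Pmin Qmin.
apply: istensor_intro => // [t t0|c].
  have [s0 s0E] := lam_surj t; have [s sE] := germ_surj Qmin s0.
  (* t is tested on s (x) om 1: base change shows that this element is zero, and g sends it back to
     t. *)
  have : pure (s : rscal (@rres _ OXX P Q hQP) (OXX Q)^o) (om (1 : O (D P))) = 0.
    apply: binj; rewrite (tlift0 bb) (tlift_pure bb) (om_res _ hD) rmorph1 -omZ mulr1.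
    rewrite (diag_sharp_germ Qmin) sE -theta_lam s0E.
    by rewrite -[theta t]/(tlift _ t) t0 (morphD0 (@omD Q)).
  move=> /(congr1 (tlift g)); rewrite (tlift_pure g_balanced) (tlift0 g_balanced).
  by rewrite gE sE s0E !rmorph1 mulr1.
suff gen u : exists t : C, om (theta t) =
    tlift (fun (s : rscal (@rres _ OXX P Q hQP) (OXX Q)^o) m => (s : OXX Q) *: mres hQP m) u.
  by have [u uE] := bsurj (om c); have [t tE] := gen u; exists t;
    apply: (@om_inj Q); rewrite -uE -tE.
elim/tensor_ind: u => [|s e u [t tE]].
  by exists 0; rewrite rmorph0 (tlift0 bb) (morphD0 (@omD Q)).
have [a <-] := om_surj e.
exists (lam (germ Qmin (s : OXX Q)) *
  tinr (stalk_map finX O pp') (stalk_map finX O px) (rres xDP a) + t).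
rewrite rmorphD omD tE (tliftD bb) (tlift_pure bb) (om_res _ hD) -omZ; congr (om _ + _).
rewrite rmorphM theta_lam -(diag_sharp_germ Qmin); congr (_ * _).
rewrite /theta /= /tinr tpairing_pure rmorph1 mul1r.
exact: rres_comp.
Qed.

End DegreeZero.

Lemma schematic_sections (W : opn X) (hl : W `<=` U_ p') (hr : W `<=` U_ x) :
  W = opnI (U_ p') (U_ x) -> istensor
  (fun (a : stalk_over finX O pp')
       (b : stalk_over finX O px) =>
    @rres X O _ W hl a * @rres X O _ W hr b).
Proof.
rewrite -diag_umin -/Q => WE; subst W.
have [H [I [pr [epi kerp]]] qcH] := schX.2 0%N.
have := schematic_sections_zero qcH epi kerp.
by rewrite (Prop_irrelevance (diag_subl _ _) hl) (Prop_irrelevance (diag_subr _ _) hr).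
Qed.

End SchematicConsequences.

(** * Tensor products over the intersection of two minimal open sets *)

(** X need not be T0, whereas systems live on posets, so points with the same minimal open set are
    identified: T lists the minimal open sets of points of W, ordered by reverse inclusion, and [pt]
    picks representatives. *)
Lemma open_skeleton (X : topologicalType) (W : opn X) : finite_set [set: X] ->
  exists (T : finType) (le : rel T) (pt : T -> X),
  [/\ reflexive le, antisymmetric le, transitive le,
      forall a b, le a b <-> spec_le (pt a) (pt b) &
      (forall a, oset W (pt a)) /\
      forall y, oset W y -> exists a, umin_set (pt a) = umin_set y].
Proof.
move=> finX; pose S := [set umin_set y | y in oset W].
have /finite_seqP[s sE] : finite_set S.
  by apply: finite_image; apply: sub_finite_set finX.
have ptP (a : seq_sub s) : exists y, oset W y /\ umin_set y = val a.
  have : S (val a) by rewrite sE; apply: valP.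
  by move=> [y Wy ya]; exists y.
pose pt a := sval (cid (ptP a)).
have [ptW ptE] : (forall a, oset W (pt a)) /\ forall a, umin_set (pt a) = val a.
  by split=> a; rewrite /pt; case: cid => y [].
exists (seq_sub s), (fun a b => `[< val b `<=` val a >]), pt; split.
- by move=> a; apply/asboolP.
- move=> a b /andP[/asboolP ba /asboolP ab]; apply: val_inj.
  by apply/seteqP.
- by move=> b a c /asboolP ba /asboolP cb; apply/asboolP/(subset_trans cb ba).
- move=> a b; rewrite -!ptE; split=> [/asboolP|ab]; first by apply; apply: umin_set_refl.
  by apply/asboolP => z; apply: (spec_le_umin finX ab).
- split=> // y Wy; have ys : umin_set y \in s.
    by have : S (umin_set y) by [exists y]; rewrite sE.
  by exists (SeqSub ys); rewrite ptE.
Qed.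

(** * The stalks of a sheaf as a system on a finite poset *)

Section SheafSystem.
Variables (X : topologicalType) (finX : finite_set [set: X]) (O : ringSheaf X).
Variables (x : X) (T : finType) (le : rel T) (pt : T -> X).
Hypotheses (le_refl : reflexive le) (le_anti : antisymmetric le)
  (le_trans : transitive le).
Hypothesis leE : forall a b, le a b <-> spec_le (pt a) (pt b).
Variable W : opn X.
Hypothesis ptW : forall a, oset W (pt a).
Hypothesis pt_cover : forall y, oset W y -> exists a, umin_set (pt a) = umin_set y.
Hypothesis ptx : forall a, spec_le x (pt a).
Notation U_ := (umin finX).
Notation R := (O (U_ x)).

Definition pt_sub a : U_ (pt a) `<=` U_ x := spec_le_umin finX (ptx a).

Section System.
Variable F : modSheaf O.

(** All stalks are viewed over the single ring O_x, every point of the poset lying above x. *)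
Definition msys_ob (a : T) : lmodType R :=
  rscal (@rres X O _ _ (@pt_sub a)) (F (U_ (pt a))).

Definition msys_map (a b : T) (s : msys_ob a) : msys_ob b :=
  if pselect (spec_le (pt a) (pt b)) is left h
  then mres (spec_le_umin finX h) (s : F (U_ (pt a))) else 0.

Lemma msys_mapE a b (h : U_ (pt b) `<=` U_ (pt a)) (s : msys_ob a) :
  msys_map b s = mres h (s : F (U_ (pt a))) :> F (U_ (pt b)).
Proof.
rewrite /msys_map; case: pselect => [h'|[]]; last by apply: h; apply: umin_refl.
by congr (mres _ _); apply: Prop_irrelevance.
Qed.

Fact msys_mapL a b : linear (@msys_map a b).
Proof.
move=> c s t; rewrite /msys_map; case: pselect => [h|_]; last by rewrite scaler0 addr0.
by rewrite !rscalE mresL (rres_comp _ _ (@pt_sub b)).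
Qed.
Fact msys_map_id a s : @msys_map a a s = s.
Proof. by rewrite (msys_mapE (@subset_refl _ _)) mres_id. Qed.
Fact msys_map_comp a b c s : le a b -> le b c ->
  @msys_map b c (@msys_map a b s) = @msys_map a c s.
Proof.
move=> /leE ab /leE bc.
rewrite (msys_mapE (spec_le_umin finX bc)) (msys_mapE (spec_le_umin finX ab)).
rewrite (msys_mapE (spec_le_umin finX (spec_le_trans ab bc))).
exact: mres_comp.
Qed.
Definition msys : sys R le := Sys msys_mapL msys_map_id msys_map_comp.

Lemma msys_glue (A : pred T) (V : opn X)
    (hV : forall a, A a -> U_ (pt a) `<=` V) (m : forall a, msys a) :
  (forall y, oset V y -> exists2 a, A a & umin_set (pt a) = umin_set y) ->
  (forall a b, A a -> A b -> le a b -> smap msys (m a) = m b) ->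
  exists s : F V, forall a (Aa : A a), mres (hV a Aa) s = m a.
Proof.
move=> cov mc.
pose I := {a | A a}.
have [||s [sE _]] := @mglue X O F V I (fun i => U_ (pt (sval i)))
    (fun i => hV _ (proj2_sig i)) _ (fun i => m (sval i)); last first.
- by exists s => a Aa; have := sE (exist _ a Aa).
- move=> [a Aa] [b Ab] Z /= hi hj.
  apply: (msep_umin (finX := finX)) => y Zy.
  have Vy : oset V y by apply: (hV a Aa); apply: hi.
  have [c Ac cy] := cov y Vy.
  have ac : spec_le (pt a) (pt c).
    apply: spec_le_trans (hi y Zy) _; rewrite /spec_le -cy; exact: umin_set_refl.
  have bc : spec_le (pt b) (pt c).
    apply: spec_le_trans (hj y Zy) _; rewrite /spec_le -cy; exact: umin_set_refl.
  have hc : U_ y `<=` U_ (pt c) by rewrite /= cy.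
  rewrite !(mres_comp _ _ (subset_trans hc (spec_le_umin finX ac))).
  rewrite !(mres_comp _ _ (subset_trans hc (spec_le_umin finX bc))).
  rewrite -(mres_comp (spec_le_umin finX ac) hc) -(mres_comp (spec_le_umin finX bc) hc).
  congr (mres _ _); rewrite -!msys_mapE.
  by rewrite -[LHS]/(smap msys (m a) : msys c) -[RHS]/(smap msys (m b) : msys c) !mc //; apply/leE.
- move=> y Vy; have [a Aa ay] := cov y Vy; exists (exist _ a Aa) => //=.
  by rewrite ay; apply: umin_set_refl.
Qed.

(** A compatible family over the points strictly above a glues over the union V of their minimal
    open sets, and then extends from V to the minimal open set at a. *)
Lemma msys_sflasque : flasque F -> sflasque msys.
Proof.
move=> flF a m mc.
pose V0 := \bigcup_(b in [set b | ltr le a b]) oset (U_ (pt b)).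
have oV : open V0 by apply: bigcup_open => b _; apply: oset_open.
pose V := Opn oV.
have hV b : ltr le a b -> U_ (pt b) `<=` V by move=> ab y by_; exists b.
have VU : V `<=` U_ (pt a).
  by move=> y [b /= /andP[/leE ab _]]; apply: (spec_le_umin finX ab).
have [|b c|s sE] := msys_glue hV (m := m).
- move=> y [b /= ab by_].
  have [c cy] := pt_cover (spec_le_open by_ (ptW b)).
  exists c => //; apply: (ltr_le_trans le_anti le_trans) ab _.
  by apply/leE; apply: (spec_le_trans by_); rewrite /spec_le -cy; apply: umin_set_refl.
- by move=> ab ac; apply: mc.
have [t tE] := flF _ _ VU s.
exists t => b ab; rewrite -(sE b ab) -tE (mres_comp _ _ (subset_trans (hV b ab) VU)).
exact: msys_mapE.
Qed.

Definition msys_res (s : F W) (a : T) : msys a :=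
  mres (umin_sub finX (ptW a)) s.

Lemma msys_res_compat s : scompat (msys_res s).
Proof.
move=> a b /leE ab.
rewrite -[LHS]/(msys_map b (msys_res s a)) (msys_mapE (spec_le_umin finX ab)).
exact: mres_comp.
Qed.

Lemma msys_res_surj (m : forall a, msys a) : scompat m ->
  exists s, forall a, msys_res s a = m a.
Proof.
move=> mc; have [||s sE] := @msys_glue predT W (fun a _ => umin_sub finX (ptW a)) m.
- by move=> y /pt_cover[a ay]; exists a.
- by move=> a b _ _; apply: mc.
- by exists s => a; apply: sE.
Qed.

Lemma msys_res_inj s t : (forall a, msys_res s a = msys_res t a) -> s = t.
Proof.
move=> st; apply: (msep (hV := fun a => umin_sub finX (ptW a))); last exact: st.
by move=> y /pt_cover[a ay]; exists a => //=; rewrite ay; apply: umin_set_refl.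
Qed.

End System.

Definition msys_hom (F G : modSheaf O) (f : modHom F G) a : msys F a -> msys G a :=
  f (U_ (pt a)).

Lemma msys_homL F G (f : modHom F G) a : linear (@msys_hom F G f a).
Proof. by move=> c s t; apply: homL. Qed.

Lemma msys_hom_nat F G (f : modHom F G) a b s : le a b ->
  msys_hom f (smap (msys F) s : msys F b) = smap (msys G) (msys_hom f (s : msys F a)).
Proof.
move=> /leE ab; rewrite -[RHS]/(msys_map (F := G) b (msys_hom f s)).
rewrite (msys_mapE (spec_le_umin finX ab)) -hom_res; congr (f _ _).
exact: msys_mapE.
Qed.

Lemma msys_hom_res F G (f : modHom F G) s a :
  msys_hom f (msys_res s a) = msys_res (f W s) a.
Proof. exact: hom_res. Qed.

(** Exactness at one stalk only: the direct image of a resolution need not be a resolution at points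
    outside U. *)
Record stalk_resolution (M : modSheaf O) (K : nat -> modSheaf O)
    (aug : modHom M (K 0%N)) (d : forall n, modHom (K n) (K n.+1)) (y : X) : Prop :=
  StalkResolution {
    sr_inj : injective (aug (U_ y));
    sr_ex0 : forall s, d 0%N (U_ y) s = 0 <-> exists t, aug (U_ y) t = s;
    sr_exS : forall n s, d n.+1 (U_ y) s = 0 <-> exists t, d n (U_ y) t = s }.

(** Used in both directions: it reads [Hvan] for O off the unspecified resolution given by
    schematicity, and converts [Hvan] for M into exactness of K(W). *)
Lemma msys_resolution (M : modSheaf O) (K : nat -> modSheaf O)
    (aug : modHom M (K 0%N)) (d : forall n, modHom (K n) (K n.+1)) n :
  (forall a, stalk_resolution aug d (pt a)) -> (forall n, flasque (K n)) ->
  Hvan le_anti le_trans n (msys M) <->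
  forall c : K n.+1 W, d n.+1 W c = 0 -> exists b, d n W b = c.
Proof.
move=> sr flK.
rewrite (@Hvan_resolution _ _ _ le_refl le_anti le_trans (msys M) (fun n => msys (K n))
  (fun a => @msys_hom _ _ aug a) (fun n a => @msys_hom _ _ (d n) a)); first last.
- by move=> m; apply: msys_sflasque.
- by move=> m a s; apply: sr_exS.
- by move=> a s; apply: (sr_ex0 (sr a)).
- by move=> a; apply: (sr_inj (sr a)).
- by move=> m a b s; apply: msys_hom_nat.
- by move=> a b s; apply: msys_hom_nat.
- by move=> m a; apply: msys_homL.
- by move=> a; apply: msys_homL.
split=> [ex c c0|ex c cc c0].
  have [a|b bc bE] := ex _ (msys_res_compat c).
    by rewrite msys_hom_res c0 /msys_res mres0.
  have [t tE] := msys_res_surj bc; exists t; apply: msys_res_inj => a.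
  by rewrite -msys_hom_res tE.
have [s sE] := msys_res_surj cc.
have [|b bE] := ex s.
  apply: msys_res_inj => a; rewrite -msys_hom_res sE c0.
  by rewrite /msys_res mres0.
exists (msys_res b); first exact: msys_res_compat.
by move=> a; rewrite msys_hom_res bE.
Qed.

End SheafSystem.

Lemma exact_at_minimal (X : topologicalType) (O : ringSheaf X) (A B C : modSheaf O)
    (f : modHom A B) (g : modHom B C) (P : opn X) x (s : B P) :
  minimal_at P x -> exact_at f g -> g P s = 0 <-> exists t, f P t = s.
Proof.
move=> Px ex; split=> [/ex lz|[t tE]].
  by have [t _ tE] := locally_in_minimal (Pr := fun V => range (f V)) Px lz; exists t.
by apply/ex => y Py; exists P, (@subset_refl _ P); split=> //; rewrite mres_id; exists t.
Qed.

Lemma resolution_stalk (X : topologicalType) (finX : finite_set [set: X])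
    (O : ringSheaf X) (M : modSheaf O) (I : injective_resolution M) y :
  stalk_resolution finX (ires_aug I) (ires_d I) y.
Proof.
split; first exact: ires_mono.
- by move=> s; apply: (exact_at_minimal s (minimal_umin finX y) (@ires_exact0 _ _ _ I)).
- by move=> n s; apply: (exact_at_minimal s (minimal_umin finX y) (@ires_exact _ _ _ I n)).
Qed.

Lemma tmap_injl (R : comPzRingType) (M M' A : lmodType R) (f : {linear M -> M'}) :
  injective f -> (forall y, exists x, f x = y) ->
  injective (tmap f (idfun : {linear A -> A})).
Proof.
move=> fi fs; apply: morphD_inj => [|t t0]; first exact: tmapD.
have Z0 : [set 0] (0 : tensor M A) by [].
have ZB u v : [set 0] u -> [set 0] v -> [set 0] (u - v : tensor M A).
  by move=> /= -> ->; rewrite subr0.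
apply: (@tensor_ker _ _ _ _ _ f (idfun : {linear A -> A}) (ZSubgroup Z0 ZB) fs _ _ _ t t0).
- by move=> y; exists y.
- move=> m a m0; have -> : m = 0 by apply: fi; rewrite m0 linear0.
  exact: pure0l.
- by move=> m a /= ->; apply: pure0r.
Qed.

Section TensorOnIntersection.
Variables (X : topologicalType) (finX : finite_set [set: X]) (O : ringSheaf X).
Notation U_ := (umin finX).
Hypothesis flO : finite_space finX O.
Variables (p p' x : X) (pp' : spec_le p p') (px : spec_le p x).
Variables (W : opn X) (hl : W `<=` U_ p') (hr : W `<=` U_ x).
Hypothesis sectionsW : istensor
  (fun (a : stalk_over finX O pp')
       (b : stalk_over finX O px) =>
    @rres X O _ W hl a * @rres X O _ W hr b).
Hypothesis acyclicW : forall n, exists I : injective_resolution (struct_mod O),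
  forall c : I n.+1 W, ires_d I n.+1 _ c = 0 -> exists b : I n W, ires_d I n _ b = c.
Variables (M : modSheaf O) (K : nat -> modSheaf O).
Variables (aug : modHom M (K 0%N)) (d : forall n, modHom (K n) (K n.+1)).
Hypothesis srK : forall y, spec_le x y -> stalk_resolution finX aug d y.
Hypothesis flK : forall n, flasque (K n).
Hypothesis bcM : forall y (xy : spec_le x y), base_change M (spec_le_umin finX xy).
Notation R := (O (U_ x)).

Definition secW_mod : lmodType R := rscal (@rres X O _ W hr) ((O W)^o).

Definition secW_bil (s : secW_mod) (m : M (U_ x)) : M W := (s : O W) *: mres hr m.

Lemma secW_bil_balanced : balanced secW_bil.
Proof. by apply: bc_balanced => c u v; apply: mresL. Qed.

(** O and M give systems F and G on the skeleton of W. Base change from x says G = F (x) M_x, and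
    the stalks of F are flat over O_x, so [flat_acyclic_sections] applies. *)
Lemma sections_and_exactness :
  istensor secW_bil /\
  forall n (c : K n.+1 W), d n.+1 W c = 0 -> exists b, d n W b = c.
Proof.
have [T [le [pt [le_refl le_anti le_trans leE [ptW pt_cover]]]]] := open_skeleton W finX.
have ptx a : spec_le x (pt a) by apply: hr.
pose F := msys finX leE ptx (struct_mod O); pose G := msys finX leE ptx M.
have flF a : flat_mod (F a) := @flO _ _ (ptx a).
have vanF i : Hvan le_anti le_trans i F.
  have [I exI] := acyclicW i.
  apply/(msys_resolution le_refl le_anti le_trans leE ptW pt_cover ptx
    (aug := ires_aug I) (d := ires_d I)) => //.
  - by move=> a; apply: resolution_stalk.
  - by move=> n; apply: (injective_flasque finX (@ires_inj _ _ _ I n)).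
pose b a (s : F a) (m : M (U_ x)) : G a :=
  (s : O (U_ (pt a))) *: mres (spec_le_umin finX (ptx a)) m.
have bG : tensor_sys (F := F) (G := G) (A := M (U_ x)) b.
  split=> [a|a c s m /leE ac]; first exact: (@bcM _ (ptx a)).
  rewrite -[LHS]/(msys_map c (b a s m)) (msys_mapE (spec_le_umin finX ac)).
  rewrite /b mresZ (mres_comp _ _ (spec_le_umin finX (ptx c))).
  apply: (congr1 (fun o : O (U_ (pt c)) => o *: mres (spec_le_umin finX (ptx c)) m)).
  apply/esym; exact: (msys_mapE (F := struct_mod O) (spec_le_umin finX ac)).
have [_ /(_ _ G b bG)[bS vanG]] := flat_acyclic_sections le_refl flF vanF.
split=> [|n]; last first.
  apply/(msys_resolution le_refl le_anti le_trans leE ptW pt_cover ptx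
    (aug := aug) (d := d)) => // a; exact: srK.
(* O(W) is identified with the module of compatible families of F. *)
pose rho0 (s : secW_mod) : secm F :=
  secm_mk (msys_res_compat finX leE ptW ptx (F := struct_mod O) s).
have rhoL : linear rho0.
  move=> c s t; apply: secm_eq => a.
  have := rmorphD (@rres X O W _ (umin_sub finX (ptW a))) (rres hr c * (s : O W)) t.
  by rewrite rmorphM (rres_comp _ _ (spec_le_umin finX (ptx a))).
pose rho := lin_of rhoL.
have rho_inj : injective rho.
  move=> s t st; apply: (msys_res_inj pt_cover (ptW := ptW) (ptx := ptx)
    (F := struct_mod O) (finX := finX) (leE := leE)) => a.
  by have := congr1 (fun u : secm F => secm_val u a) st.
have rho_surj t : exists s, rho s = t.
  have [s sE] := msys_res_surj ptW pt_cover (secm_compat t).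
  by exists s; apply: secm_eq => a; apply: sE.
have secW0 := secW_bil_balanced.
have bal := secm_bil_balanced bG.
have rhoE u a : secm_val (tlift (secm_bil bG) (tmap rho idfun u)) a =
    msys_res finX leE ptW ptx (F := M) (tlift secW_bil u) a.
  move: u; apply: (@tensor_ext _ _ _ _
    (fun u => secm_val (tlift (secm_bil bG) (tmap rho idfun u)) a)
    (fun u => msys_res finX leE ptW ptx (F := M) (tlift secW_bil u) a)) => [u v|u v|s m].
  - by rewrite tmapD (tliftD bal).
  - by rewrite (tliftD secW0) /msys_res mresD.
  - rewrite tmap_pure (tlift_pure bal) (tlift_pure secW0) /msys_res /secW_bil mresZ.
    by rewrite (mres_comp _ _ (spec_le_umin finX (ptx a))).
apply: istensor_intro => // [u u0|n].
  apply: (tmap_injl rho_inj rho_surj); rewrite tmap0.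
  apply: (istensor_ker bS); apply: secm_eq => a.
  by rewrite rhoE u0 /msys_res mres0.
have [_ _ /(_ (secm_mk (msys_res_compat finX leE ptW ptx (F := M) n)))[u' uE']] := bS.
have [u uE] := tmap_surj (g := (idfun : {linear M (U_ x) -> M (U_ x)})) rho_surj
  (fun y => ex_intro _ y erefl) u'.
exists u; apply: (msys_res_inj pt_cover (ptW := ptW) (ptx := ptx) (F := M)
  (finX := finX) (leE := leE)) => a.
by rewrite -rhoE uE uE'.
Qed.

Definition intersection_bil (a : stalk_over finX O pp')
  (m : rscal (stalk_map finX O px) (M (U_ x))) : M W :=
  @rres X O _ W hl a *: mres hr (m : M (U_ x)).

Lemma intersection_bil_balanced : balanced intersection_bil.
Proof.
split=> [a a' m|a m m'|c a m]; rewrite /intersection_bil.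
- by rewrite rmorphD scalerDl.
- by rewrite mresD scalerDr.
- rewrite !rscalE mresZ scalerA rmorphM /= mulrC; congr (_ * _ *: _).
  exact: rres_compE.
Qed.

Let theta := tlift (fun (a : stalk_over finX O pp')
  (b : stalk_over finX O px) =>
    @rres X O _ W hl a * @rres X O _ W hr b).
Let Bx : lmodType (stalk finX O p) := stalk_over finX O px.
Let Mx : lmodType (stalk finX O p) := rscal (stalk_map finX O px) (M (U_ x)).
Let Ap : lmodType (stalk finX O p) := stalk_over finX O pp'.

Let smul_linear (m : M (U_ x)) : linear ((fun b : Bx => (b : R) *: m) : Bx -> Mx).
Proof. by move=> c b b'; rewrite !rscalE scalerDl scalerA. Qed.
Let smul m : {linear Bx -> Mx} := lin_of (smul_linear m).
Let bmul_linear (c : R) : linear ((fun b : Bx => c * (b : R)) : Bx -> Bx).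
Proof. by move=> e b b'; rewrite !rscalE mulrDr mulrCA. Qed.
Let bmul c : {linear Bx -> Bx} := lin_of (bmul_linear c).
Let idA : {linear Ap -> Ap} := idfun.

Let thetaD : {morph theta : s t / s + t}.
Proof. by apply: tliftD; case: sectionsW. Qed.
Let theta_pure a b : theta (pure (a : Ap) (b : Bx)) = rres hl a * rres hr b.
Proof. by rewrite /theta tlift_pure //; case: sectionsW. Qed.
Let theta_inj : injective theta. Proof. by case: sectionsW. Qed.

Let theta_bmul c t : theta (tmap idA (bmul c) t) = rres hr c * theta t.
Proof.
move: t; apply: (@tensor_ext _ _ _ _ (fun t => theta (tmap idA (bmul c) t))
  (fun t => rres hr c * theta t)) => [s t|s t|a b].
- by rewrite tmapD thetaD.
- by rewrite thetaD mulrDr.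
- have -> : rres hr c * theta (pure a b) = rres hl a * rres hr (c * (b : R)).
    by rewrite theta_pure rmorphM mulrCA.
  by rewrite tmap_pure theta_pure.
Qed.

(** O_p' (x)_{O_p} M_x = (O_p' (x)_{O_p} O_x) (x)_{O_x} M_x = O(W) (x)_{O_x} M_x = M(W). *)
Lemma intersection_istensor : istensor intersection_bil.
Proof.
have [bW _] := sections_and_exactness.
have secW0 := secW_bil_balanced; have int0 := intersection_bil_balanced.
have /choice[th thK] : forall o : O W, exists t, theta t = o.
  by move=> o; case: sectionsW => _ _ /(_ o).
have thE t : th (theta t) = t by apply: theta_inj; rewrite thK.
have thD : {morph th : u v / u + v}.
  by move=> u v; apply: theta_inj; rewrite thetaD !thK.
(* From O(W) (x) M_x back to O_p' (x) M_x: write s as a sum of a (x) b through the inverse [th] of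
   theta, and send it with m to the sum of a (x) b m. *)
pose back (s : secW_mod) (m : M (U_ x)) : tensor Ap Mx := tmap idA (smul m) (th s).
have back0 : balanced back.
  split=> [s s' m|s m m'|c s m]; rewrite /back.
  - by rewrite thD tmapD.
  - move: (th s); apply: tensor_ext => [u v|u v|a b].
    + exact: tmapD.
    + by rewrite !tmapD addrACA.
    + by rewrite !tmap_pure -pureDr; congr (pure _ _); exact (scalerDr (b : R) m m').
  - have -> : th (c *: s) = tmap idA (bmul c) (th s).
      by apply: theta_inj; rewrite theta_bmul !thK.
    rewrite (tmap_comp (f2 := idA) (g2 := smul (c *: m))) // => b.
    by rewrite !lin_ofE scalerA mulrC.
have fwd0 : balanced (fun (a : Ap) (m : Mx) =>
    @pure R secW_mod (M (U_ x)) (rres hl a : O W) m).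
  split=> [a a' m|a m m'|c a m].
  - by rewrite rmorphD -pureDl.
  - exact: pureDr.
  - rewrite !rscalE -pureZ; congr (pure _ _).
    rewrite rmorphM; congr (_ * _); exact: rres_compE.
apply: istensor_intro => // [u u0|n].
  pose u1 := tlift (fun (a : Ap) (m : Mx) =>
    @pure R secW_mod (M (U_ x)) (rres hl a : O W) m) u.
  have u10 : u1 = 0.
    apply: (istensor_ker bW); rewrite -[RHS]u0 /u1.
    move: (u); apply: (@tensor_ext _ _ _ _ (fun u => tlift secW_bil (tlift _ u))
      (fun u => tlift intersection_bil u)) => [s t|s t|a m].
    - by rewrite (tliftD fwd0) (tliftD secW0).
    - exact: tliftD.
    - by rewrite (tlift_pure fwd0) (tlift_pure secW0) (tlift_pure int0).
  have <- : tlift back u1 = u; last by rewrite u10 (tlift0 back0).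
  rewrite /u1; move: (u); apply: (@tensor_ext _ _ _ _ (fun u => tlift back (tlift _ u))
    (fun u => u)) => [s t|//|a m].
    by rewrite (tliftD fwd0) (tliftD back0).
  rewrite (tlift_pure fwd0) (tlift_pure back0) /back.
  have -> : th (rres hl a) = pure (a : Ap) (1 : Bx).
    by apply: theta_inj; rewrite thK theta_pure rmorph1 mulr1.
  rewrite tmap_pure; apply: (congr1 (fun z : Mx => pure (a : Ap) z)).
  exact: (scale1r (m : M (U_ x))).
have [_ _ /(_ n)[u <-]] := bW.
elim/tensor_ind: u => [|s m u [v vE]].
  by exists 0; rewrite (tlift0 int0) (tlift0 secW0).
rewrite (tliftD secW0) (tlift_pure secW0) -vE.
suff [w <-] : exists w, tlift intersection_bil w = secW_bil s m.
  by exists (w + v); rewrite (tliftD int0).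
exists (tmap idA (smul m) (th s)); rewrite -[in RHS](thK s).
move: (th s); apply: (@tensor_ext _ _ _ _
  (fun t => tlift intersection_bil (tmap idA (smul m) t))
  (fun t => secW_bil (theta t) m)) => [t t'|t t'|a b].
- by rewrite tmapD (tliftD int0).
- by rewrite thetaD (balDl secW0).
- rewrite tmap_pure (tlift_pure int0) theta_pure /intersection_bil /secW_bil.
  by rewrite -scalerA -mresZ.
Qed.

End TensorOnIntersection.

(** * Mayer-Vietoris induction *)

Lemma open_upward (X : topologicalType) (A : set X) : finite_set [set: X] ->
  (forall y z, A y -> spec_le y z -> A z) -> open A.
Proof.
move=> finX Aup; have -> : A = \bigcup_(y in A) umin_set y.
  apply/seteqP; split=> [y Ay|z [y Ay yz]]; last exact: Aup yz.
  by exists y => //; apply: umin_set_refl.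
by apply: bigcup_open => y _; apply: umin_set_open.
Qed.

Section MayerVietoris.
Variables (X : topologicalType) (finX : finite_set [set: X]).
Variables (D : nat -> opn X -> zmodType) (dd : forall n V, D n V -> D n.+1 V).
Variable rs : forall n V W, oset W `<=` oset V -> D n V -> D n W.
Arguments dd n {V} _.
Arguments rs {n V W} _ _.
Hypothesis ddD : forall n V, {morph @dd n V : x y / x + y}.
Hypothesis rsD : forall n V W (h : oset W `<=` oset V), {morph @rs n V W h : x y / x + y}.
Hypothesis dd_rs : forall n V W (h : oset W `<=` oset V) s,
  dd n (rs h s) = rs h (dd n s).
Hypothesis dd_dd : forall n V s, dd n.+1 (dd n (s : D n V)) = 0.
Hypothesis rs_comp : forall n V W Z (h : oset W `<=` oset V) (h' : oset Z `<=` oset W)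
  (h2 : oset Z `<=` oset V) (s : D n V), rs h' (rs h s) = rs h2 s.
Hypothesis rs_empty : forall n V (s : D n V), (forall y, ~ oset V y) -> s = 0.
Hypothesis rs_sep : forall n V V1 V2 (h1 : oset V1 `<=` oset V) (h2 : oset V2 `<=` oset V)
  (s : D n V), V `<=` V1 `|` V2 -> rs h1 s = 0 -> rs h2 s = 0 -> s = 0.
Hypothesis rs_glue : forall n V V1 V2 (h1 : oset V1 `<=` oset V) (h2 : oset V2 `<=` oset V)
  (s1 : D n V1) (s2 : D n V2), V `<=` V1 `|` V2 ->
  rs (@opnIl _ V1 V2) s1 = rs (@opnIr _ V1 V2) s2 ->
  exists s : D n V, rs h1 s = s1 /\ rs h2 s = s2.
Hypothesis rs_surj : forall n V W (h : oset W `<=` oset V) (s : D n W),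
  exists t, rs h t = s.

Definition complex_exact (V : opn X) : Prop :=
  (forall c : D 0 V, dd 0 c = 0 -> c = 0) /\
  forall n (c : D n.+1 V), dd n.+1 c = 0 -> exists b, dd n b = c.

(** Primitives b1 and b2 over V1 and V2 differ on the intersection by a cocycle e = d f. As
    restrictions are onto, f extends to V1, and correcting b1 by the differential of the extension
    makes the primitives glue. *)
Lemma mayer_vietoris (V V1 V2 : opn X) : V1 `<=` V -> V2 `<=` V -> V `<=` V1 `|` V2 ->
  complex_exact V1 -> complex_exact V2 -> complex_exact (opnI V1 V2) ->
  complex_exact V.
Proof.
move=> h1 h2 cov [ex1 exS1] [ex2 exS2] [ex12 exS12].
have dd0 n W : dd n (0 : D n W) = 0 := morphD0 (@ddD n W).
have rs0 n A B (h : oset B `<=` oset A) : rs h (0 : D n A) = 0 := morphD0 (@rsD n A B h).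
have rsB n A B (h : oset B `<=` oset A) := morphDB (@rsD n A B h).
have ddB n A := morphDB (@ddD n A).
split=> [c c0|n c c0].
  by apply: (rs_sep (h1 := h1) (h2 := h2)) => //; [apply: ex1 | apply: ex2];
    rewrite dd_rs c0 rs0.
have [b1 b1E] : exists b, dd n b = rs h1 c by apply: exS1; rewrite dd_rs c0 rs0.
have [b2 b2E] : exists b, dd n b = rs h2 c by apply: exS2; rewrite dd_rs c0 rs0.
suff [b1' [b1'E agree]] : exists b1', dd n b1' = rs h1 c /\
    rs (@opnIl _ V1 V2) b1' = rs (@opnIr _ V1 V2) b2.
  have [b [bE1 bE2]] := rs_glue h1 h2 cov agree.
  exists b; apply/subr0_eq.
  by apply: (rs_sep (h1 := h1) (h2 := h2)) => //;
    rewrite rsB -dd_rs ?bE1 ?bE2 ?b1'E ?b2E subrr.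
pose e := rs (@opnIl _ V1 V2) b1 - rs (@opnIr _ V1 V2) b2.
have e0 : dd n e = 0.
  rewrite ddB !dd_rs b1E b2E.
  by rewrite !(rs_comp _ _ (subset_trans (@opnIl _ V1 V2) h1)) subrr.
(* In degree 0 the cocycle e is zero already and b1 is kept. *)
case: n => [|n] in c c0 b1 b1E b2 b2E e e0 *.
  by exists b1; split=> //; apply/subr0_eq; apply: ex12.
have [f fE] := exS12 n e e0.
have [f1 f1E] := rs_surj (@opnIl _ V1 V2) f.
exists (b1 - dd n f1); split; first by rewrite ddB dd_dd subr0.
by rewrite rsB -dd_rs f1E fE /e opprB addrCA subrr addr0.
Qed.

(* If U_y is maximal among the minimal open sets in V, the points of V outside
   the class of y form an open set V2, and V is covered by U_y and V2. *)
Lemma exact_of_stalks (V : opn X) :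
  (forall y, oset V y -> complex_exact (umin finX y)) -> complex_exact V.
Proof.
have /finite_seqP[E EX] := finX.
(* The number of entries of the enumeration E lying in W; repetitions do no harm, since only strict
   inclusions are to be detected. *)
pose m (W : opn X) := count (fun y => `[< oset W y >]) E.
have m_lt (A B : opn X) y : A `<=` B -> oset B y -> ~ oset A y -> (m A < m B)%N.
  move=> AB By nAy.
  have : y \in E by have : [set: X] y by []; rewrite EX.
  rewrite /m; elim: E {EX m} => // z E IH; rewrite inE => /orP[/eqP <-|/IH lt] /=.
    rewrite (asboolT By) (asboolF nAy) add0n add1n ltnS.
    by apply: sub_count => w /asboolP Aw; apply/asboolP; apply: AB.
  rewrite -addnS; apply: leq_add lt.
  by case: asboolP => // Az; rewrite (asboolT (AB _ Az)).
have [n] := ubnP (m V); elim: n V => // n IH V /ltnSE mV exV.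
have [V0|/existsNP[y0 /contrapT Vy0]] := pselect (forall y, ~ oset V y).
  split=> [c _|k c _]; first exact: rs_empty.
  by exists 0; rewrite (morphD0 (@ddD _ _)); apply/esym/rs_empty.
have exm : exists k, `[< exists y, oset V y /\ m (umin finX y) = k >].
  by exists (m (umin finX y0)); apply/asboolP; exists y0.
have mE k : `[< exists y, oset V y /\ m (umin finX y) = k >] -> (k <= size E)%N.
  by move=> /asboolP[y [_ <-]]; apply: count_size.
case: (ex_maxnP exm mE) => k /asboolP[y [Vy yk]] kmax.
have ymin z : oset V z -> spec_le z y -> spec_le y z.
  move=> Vz zy; apply: contrapT => nyz.
  have := kmax (m (umin finX z)); rewrite (asboolT (ex_intro _ z (conj Vz erefl))).
  move=> /(_ isT); rewrite -yk leqNgt => /negP; apply.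
  by apply: (m_lt _ _ z) => //; [apply: spec_le_umin | apply: umin_refl].
have oV2 : open [set z | oset V z /\ ~ spec_le z y].
  apply: open_upward => // z w [Vz nzy] zw; split; first exact: spec_le_open zw Vz.
  by apply: contra_not nzy => wy; apply: spec_le_trans zw wy.
pose V2 := Opn oV2.
have V2V : V2 `<=` V by move=> z [].
have nV2y : ~ oset V2 y by case=> _; apply; apply: umin_set_refl.
have V2lt : (m V2 < n)%N by apply: leq_trans mV; apply: (m_lt _ _ y).
apply: (@mayer_vietoris V (umin finX y) V2) => //.
- exact: umin_sub.
- by move=> z Vz; have [zy|nzy] := pselect (spec_le z y); [left; apply: ymin | right].
- exact: exV.
- by apply: IH => // z /V2V; apply: exV.
- apply: IH => [|z [_ /V2V]]; last exact: exV.
  by apply: leq_trans mV; apply: (m_lt _ _ y) => // [z [_ /V2V]//|[]].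
Qed.

End MayerVietoris.

(** * The cone of the base change map *)

Section PairTensor.
Variables (R : comPzRingType) (N A B : lmodType R).

Fact pair_fst_linear : linear (fun z : (A * B)%type => z.1). Proof. by []. Qed.
Fact pair_snd_linear : linear (fun z : (A * B)%type => z.2). Proof. by []. Qed.
Fact pair_inl_linear : linear (fun a : A => (a, 0) : (A * B)%type).
Proof.
by move=> c a a'; rewrite -[RHS]/(c *: a + a', c *: 0 + 0) scaler0 addr0.
Qed.
Fact pair_inr_linear : linear (fun b : B => (0, b) : (A * B)%type).
Proof.
by move=> c a a'; rewrite -[RHS]/(c *: 0 + 0, c *: a + a') scaler0 addr0.
Qed.
Definition pair_fst : {linear (A * B)%type -> A} := lin_of pair_fst_linear.
Definition pair_snd : {linear (A * B)%type -> B} := lin_of pair_snd_linear.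
Definition pair_inl : {linear A -> (A * B)%type} := lin_of pair_inl_linear.
Definition pair_inr : {linear B -> (A * B)%type} := lin_of pair_inr_linear.
Notation idN := (idfun : {linear N -> N}).

Lemma tensor_pair_decomp (z : tensor N (A * B)%type) :
  z = tmap idN pair_inl (tmap idN pair_fst z) + tmap idN pair_inr (tmap idN pair_snd z).
Proof.
elim/tensor_ind: z => [|n [a b] z IH]; first by rewrite !tmap0 addr0.
rewrite {1}IH !tmapD !tmap_pure addrACA -pureDr; congr (pure _ _ + _).
by rewrite !lin_ofE /= -[RHS]/(a + 0, 0 + b) addr0 add0r.
Qed.

Lemma tensor_pair_eq0 (z : tensor N (A * B)%type) :
  tmap idN pair_fst z = 0 -> tmap idN pair_snd z = 0 -> z = 0.
Proof. by move=> z1 z2; rewrite [z]tensor_pair_decomp z1 z2 !tmap0 addr0. Qed.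

End PairTensor.

Section TwoOpens.
Variables (X : topologicalType) (O : ringSheaf X) (F : modSheaf O).
Variables (V V1 V2 : opn X) (h1 : V1 `<=` V) (h2 : V2 `<=` V).
Hypothesis cov : V `<=` V1 `|` V2.

Lemma msep2 (s : F V) : mres h1 s = 0 -> mres h2 s = 0 -> s = 0.
Proof.
move=> s1 s2; apply: (@msep _ _ _ _ bool (fun i => if i then V1 else V2)
  (fun i => if i as i return (if i then V1 else V2) `<=` V then h1 else h2)).
  by move=> y /cov[]; [exists true | exists false].
by case; rewrite mres0.
Qed.

(** Z is only asked to contain V1 /\ V2: the trace of an intersection is not syntactically the
    intersection of the traces. *)
Lemma mglue2 (s1 : F V1) (s2 : F V2) (Z : opn X) (hz1 : Z `<=` V1) (hz2 : Z `<=` V2) :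
  V1 `&` V2 `<=` Z -> mres hz1 s1 = mres hz2 s2 ->
  exists s, mres h1 s = s1 /\ mres h2 s = s2.
Proof.
move=> ZE e.
have [||s [sE _]] := @mglue _ _ F V bool (fun i => if i then V1 else V2)
  (fun i => if i as i return (if i then V1 else V2) `<=` V then h1 else h2) _
  (fun i => if i as i return F (if i then V1 else V2) then s1 else s2); last first.
- by exists s; split; [apply: (sE true) | apply: (sE false)].
- have eW (W : opn X) (hi : W `<=` V1) (hj : W `<=` V2) : mres hi s1 = mres hj s2.
    have hW : W `<=` Z by move=> y Wy; apply: ZE; split; [apply: hi | apply: hj].
    by rewrite -(mres_comp hz1 hW) -(mres_comp hz2 hW) e.
  move=> [] [] W hi hj; [|exact: eW|by rewrite (eW W hj hi)|];
    by rewrite (Prop_irrelevance hi hj).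
- by move=> y /cov[]; [exists true | exists false].
Qed.

Lemma msec_empty (s : F V) : (forall y, ~ oset V y) -> s = 0.
Proof.
by move=> V0; apply: (@msep _ _ _ _ False (fun i => match i with end)
  (fun i => match i with end)) => [y /V0|[]].
Qed.

End TwoOpens.

Section Cone.
Variables (X : topologicalType) (finX : finite_set [set: X]) (O : ringSheaf X).
Notation U_ := (umin finX).
Hypothesis flO : finite_space finX O.
Variables (p p' : X) (pp' : spec_le p p').
Variables (K : nat -> modSheaf O) (d : forall n, modHom (K n) (K n.+1)).
Hypothesis dd0 : forall n V s, d n.+1 V (d n V s) = 0.
Hypothesis flK : forall n, flasque (K n).

Notation Rp := (stalk finX O p).
Let Ap : lmodType Rp := stalk_over finX O pp'.
Let idA : {linear Ap -> Ap} := idfun.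
Let flA : flat_mod Ap. Proof. exact: (@flO _ _ pp'). Qed.

Definition lmodp (F : modSheaf O) (Z : opn X) (hZ : Z `<=` U_ p) : lmodType Rp :=
  rscal (@rres X O _ _ hZ) (F Z).

Fact homp_linear (F G : modSheaf O) (f : modHom F G) (Z : opn X) (hZ : Z `<=` U_ p) :
  linear (f Z : lmodp F hZ -> lmodp G hZ).
Proof. by move=> c s t; apply: homL. Qed.
Definition homp F G (f : modHom F G) (Z : opn X) (hZ : Z `<=` U_ p) :
  {linear lmodp F hZ -> lmodp G hZ} := lin_of (@homp_linear F G f Z hZ).

Fact resp_linear (F : modSheaf O) (Z Y : opn X) (hZ : Z `<=` U_ p) (hY : Y `<=` U_ p)
  (h : Y `<=` Z) : linear (mres h : lmodp F hZ -> lmodp F hY).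
Proof. by move=> c s t; rewrite !rscalE mresL (rres_comp _ _ hY). Qed.
Definition resp F (Z Y : opn X) (hZ : Z `<=` U_ p) (hY : Y `<=` U_ p) (h : Y `<=` Z) :
  {linear lmodp F hZ -> lmodp F hY} := lin_of (@resp_linear F Z Y hZ hY h).

Definition restrict_bil (F : modSheaf O) (Z Z' : opn X) (hZ : Z `<=` U_ p)
    (hZ' : Z' `<=` U_ p') (h : Z' `<=` Z) (a : Ap) (s : lmodp F hZ) : F Z' :=
  @rres X O _ _ hZ' a *: mres h (s : F Z).

Section Phi.
Variables (Z Z' : opn X) (hZ : Z `<=` U_ p) (hZ' : Z' `<=` U_ p') (h : Z' `<=` Z).

Lemma restrict_bil_balanced F : balanced (@restrict_bil F Z Z' hZ hZ' h).
Proof.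
split=> [a a' m|a m m'|c a m]; rewrite /restrict_bil.
- by rewrite rmorphD scalerDl.
- by rewrite mresD scalerDr.
- rewrite !rscalE mresZ scalerA rmorphM /= mulrC; congr (_ * _ *: _).
  exact: rres_compE.
Qed.

Definition phi F : tensor Ap (lmodp F hZ) -> F Z' := tlift (@restrict_bil F Z Z' hZ hZ' h).

Lemma phiD F : {morph @phi F : s t / s + t}.
Proof. exact: (tliftD (restrict_bil_balanced F)). Qed.
Lemma phi_pure F a s : phi (pure a s) = @restrict_bil F Z Z' hZ hZ' h a s.
Proof. exact: (tlift_pure (restrict_bil_balanced F)). Qed.

Lemma phi_hom F G (f : modHom F G) t : phi (tmap idA (homp f hZ) t) = f Z' (phi t).
Proof.
move: t; apply: (@tensor_ext _ _ _ _ (fun t => phi (tmap idA (homp f hZ) t))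
  (fun t => f Z' (phi t))) => [s t|s t|a s].
- by rewrite tmapD phiD.
- by rewrite phiD (linear_morphD (homL f Z')).
- rewrite tmap_pure !phi_pure /restrict_bil (linear_scale (homL f Z')) hom_res.
  by [].
Qed.

(* The cone of the chain map [phi : O_p' (x) K(Z) -> K(Z')]. *)
Definition cone_ob (n : nat) : zmodType :=
  if n is m.+1 then (tensor Ap (lmodp (K m.+1) hZ) * K m Z')%type
  else tensor Ap (lmodp (K 0%N) hZ).

Definition cone_d (n : nat) : cone_ob n -> cone_ob n.+1 :=
  match n with
  | 0 => fun t => (tmap idA (homp (d 0) hZ) t, phi t)
  | m.+1 => fun c => (tmap idA (homp (d m.+1) hZ) c.1, phi c.1 - d m Z' c.2)
  end.

(** Acyclicity of the cone: [phi] induces isomorphisms on cohomology. *)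
Definition cone_exact : Prop :=
  (forall c : cone_ob 0, cone_d c = 0 -> c = 0) /\
  forall n (c : cone_ob n.+1), cone_d c = 0 -> exists b : cone_ob n, cone_d b = c.

Lemma cone_dD n : {morph @cone_d n : x y / x + y}.
Proof.
case: n => [|n] s t /=; first by rewrite tmapD phiD.
by rewrite tmapD phiD (linear_morphD (homL (d n) Z')) opprD addrACA.
Qed.

Let hd0 n t : tmap idA (homp (d n.+1) hZ) (tmap idA (homp (d n) hZ) t) = 0.
Proof.
rewrite (tmap_comp (f2 := idA) (g2 := homp (d n.+1) hZ \o homp (d n) hZ)) //.
by apply: tmap_zero; right=> s; apply: dd0.
Qed.

Lemma cone_dd n (t : cone_ob n) : cone_d (cone_d t) = 0.
Proof.
case: n t => [|n] t /=.
  by rewrite hd0 phi_hom subrr.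
by rewrite hd0 phi_hom (morphDB (linear_morphD (homL (d n.+1) Z'))) dd0 subr0 subrr.
Qed.

End Phi.

Section PhiRes.
Variables (Z Z' Y Y' : opn X) (hZ : Z `<=` U_ p) (hZ' : Z' `<=` U_ p') (h : Z' `<=` Z).
Variables (hY : Y `<=` U_ p) (hY' : Y' `<=` U_ p') (hy : Y' `<=` Y).
Variables (r : Y `<=` Z) (r' : Y' `<=` Z').

Lemma phi_res F t : phi hY' hy (tmap idA (resp F hZ hY r) t) = mres r' (phi hZ' h t).
Proof.
move: t; apply: (@tensor_ext _ _ _ _ (fun t => phi hY' hy (tmap idA (resp F hZ hY r) t))
  (fun t => mres r' (phi hZ' h t))) => [s t|s t|a s].
- by rewrite tmapD phiD.
- by rewrite phiD mresD.
- rewrite tmap_pure !phi_pure /restrict_bil mresZ -[resp F hZ hY r s]/(mres r (s : F Z)).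
  by rewrite (rres_comp _ _ hY') !(mres_comp _ _ (subset_trans r' h)).
Qed.

Definition cone_res (n : nat) : cone_ob Z' hZ n -> cone_ob Y' hY n :=
  match n with
  | 0 => fun t => tmap idA (resp (K 0%N) hZ hY r) t
  | m.+1 => fun c => (tmap idA (resp (K m.+1) hZ hY r) c.1, mres r' c.2)
  end.

Lemma cone_resD n : {morph @cone_res n : x y / x + y}.
Proof.
by case: n => [|n] s t /=; rewrite ?tmapD // mresD.
Qed.

Lemma cone_d_res n t : cone_d hY' hy (@cone_res n t) = @cone_res n.+1 (cone_d hZ' h t).
Proof.
have e m u : tmap idA (homp (d m) hY) (tmap idA (resp (K m) hZ hY r) u) =
    tmap idA (resp (K m.+1) hZ hY r) (tmap idA (homp (d m) hZ) u).
  rewrite (tmap_comp (f2 := idA) (g2 := homp (d m) hY \o resp (K m) hZ hY r)) //.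
  rewrite (tmap_comp (f2 := idA) (g2 := homp (d m) hY \o resp (K m) hZ hY r)) // => s.
  by rewrite /= hom_res.
case: n t => [|n] t /=; first by rewrite e phi_res.
by rewrite e phi_res hom_res (morphDB (@mresD _ _ _ _ _ r')).
Qed.

Lemma cone_res_surj n t : exists s, @cone_res n s = t.
Proof.
have ts m u : exists s, tmap idA (resp (K m) hZ hY r) s = u.
  apply: tmap_surj => y; first by exists y.
  by have [s sE] := flK r (y : K m Y); exists s.
case: n t => [|n] t; first exact: ts.
have [s sE] := ts n.+1 t.1; have [w wE] := flK r' t.2.
by exists (s, w); rewrite /= sE wE; case: t {sE wE}.
Qed.

Lemma cone_res_inj : (forall n (s : K n Z), mres r s = 0 -> s = 0) ->
  (forall n (s : K n Z'), mres r' s = 0 -> s = 0) ->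
  forall n t, @cone_res n t = 0 -> t = 0.
Proof.
move=> i1 i2.
have ti m u : tmap idA (resp (K m) hZ hY r) u = 0 -> u = 0.
  move=> u0; apply: (flA (u := resp (K m) hZ hY r)); last by rewrite u0 tmap0.
  apply: (morphD_inj (f := resp (K m) hZ hY r)) => [x y|x]; first exact: linearD.
  exact: i1.
case=> [|n] t /=; first exact: ti.
by case: t => t w [/ti -> /i2 ->].
Qed.

End PhiRes.

End Cone.

(** * Acyclicity of the cone, from stalks to U_p *)

Section ConeExactness.
Variables (X : topologicalType) (finX : finite_set [set: X]) (O : ringSheaf X).
Notation U_ := (umin finX).
Hypothesis flO : finite_space finX O.
Variables (p p' : X) (pp' : spec_le p p').
Notation Rp := (stalk finX O p).
Notation Ap := (stalk_over finX O pp' : lmodType Rp).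
Notation idA := (idfun : {linear stalk_over finX O pp' -> stalk_over finX O pp'}).
Let flA : flat_mod Ap. Proof. exact: (@flO _ _ pp'). Qed.

Section Tensor2.
Variables (F : modSheaf O) (Z Z1 Z2 : opn X) (hZ : Z `<=` U_ p).
Variables (hZ1 : Z1 `<=` U_ p) (hZ2 : Z2 `<=` U_ p) (r1 : Z1 `<=` Z) (r2 : Z2 `<=` Z).
Hypothesis cov : Z `<=` Z1 `|` Z2.

Let pair_res0 (s : lmodp F hZ) : (lmodp F hZ1 * lmodp F hZ2)%type :=
  (resp F hZ hZ1 r1 s, resp F hZ hZ2 r2 s).
Let pair_res_linear : linear pair_res0.
Proof. by move=> c s t; rewrite /pair_res0 !linearP. Qed.
Let pair_res := lin_of pair_res_linear.

Lemma tensor_sep2 (t : tensor Ap (lmodp F hZ)) :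
  tmap idA (resp F hZ hZ1 r1) t = 0 -> tmap idA (resp F hZ hZ2 r2) t = 0 -> t = 0.
Proof.
move=> t1 t2; apply: (flA (u := pair_res)).
  apply: (morphD_inj (f := pair_res)) => [x y|x x0]; first exact: linearD.
  exact: (msep2 cov (congr1 (fun z => z.1) x0) (congr1 (fun z => z.2) x0)).
rewrite tmap0; apply: tensor_pair_eq0.
  by rewrite (tmap_comp (f2 := idA) (g2 := resp F hZ hZ1 r1)).
by rewrite (tmap_comp (f2 := idA) (g2 := resp F hZ hZ2 r2)).
Qed.

Variables (Z12 : opn X) (hZ12 : Z12 `<=` U_ p) (q1 : Z12 `<=` Z1) (q2 : Z12 `<=` Z2).
Hypothesis Z12E : Z1 `&` Z2 `<=` Z12.

Let dif0 (z : (lmodp F hZ1 * lmodp F hZ2)%type) : lmodp F hZ12 :=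
  resp F hZ1 hZ12 q1 z.1 - resp F hZ2 hZ12 q2 z.2.
Let dif_linear : linear dif0.
Proof.
move=> c s t; rewrite /dif0 -[(c *: s + t).1]/(c *: s.1 + t.1).
rewrite -[(c *: s + t).2]/(c *: s.2 + t.2).
rewrite -[resp F hZ1 hZ12 q1 (c *: s.1 + t.1)]/(mres q1 (c *: s.1 + t.1 : lmodp F hZ1)).
rewrite -[resp F hZ2 hZ12 q2 (c *: s.2 + t.2)]/(mres q2 (c *: s.2 + t.2 : lmodp F hZ2)).
have -> := @resp_linear _ finX O p F _ _ hZ1 hZ12 q1 c s.1 t.1.
have -> := @resp_linear _ finX O p F _ _ hZ2 hZ12 q2 c s.2 t.2.
by rewrite scalerBr opprD addrACA.
Qed.
Let dif := lin_of dif_linear.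

(** The gluing sequence 0 -> F(Z) -> F(Z1) x F(Z2) -> F(Z12) stays exact after tensoring with the
    flat module O_p'. *)
Lemma tensor_glue2 (t1 : tensor Ap (lmodp F hZ1)) (t2 : tensor Ap (lmodp F hZ2)) :
  tmap idA (resp F hZ1 hZ12 q1) t1 = tmap idA (resp F hZ2 hZ12 q2) t2 ->
  exists t, tmap idA (resp F hZ hZ1 r1) t = t1 /\ tmap idA (resp F hZ hZ2 r2) t = t2.
Proof.
move=> e; pose z := tmap idA (pair_inl _ _) t1 + tmap idA (pair_inr _ _) t2 :
  tensor Ap (lmodp F hZ1 * lmodp F hZ2)%type.
have z1 : tmap idA (pair_fst _ _) z = t1.
  rewrite tmapD (tmap_comp (f2 := idA) (g2 := idfun)) // tmap_id //.
  rewrite (tmap_comp (f2 := idA) (g2 := pair_fst _ _ \o pair_inr _ _)) //.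
  by rewrite tmap_zero ?addr0 //; right.
have z2 : tmap idA (pair_snd _ _) z = t2.
  rewrite tmapD addrC (tmap_comp (f2 := idA) (g2 := idfun)) // tmap_id //.
  rewrite (tmap_comp (f2 := idA) (g2 := pair_snd _ _ \o pair_inl _ _)) //.
  by rewrite tmap_zero ?addr0 //; right.
have [s sE] : exists s, tmap idA pair_res s = z.
  apply: (flat_exact (v := dif) flA) => [[a b] /subr0_eq ab|].
    have [s [sa sb]] := mglue2 r1 r2 cov Z12E ab.
    by exists s; rewrite /pair_res lin_ofE /pair_res0 !lin_ofE sa sb.
  have difE (y : tensor Ap (lmodp F hZ1 * lmodp F hZ2)%type) : tmap idA dif y =
      tmap idA (resp F hZ1 hZ12 q1) (tmap idA (pair_fst _ _) y) -
      tmap idA (resp F hZ2 hZ12 q2) (tmap idA (pair_snd _ _) y).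
    elim/tensor_ind: y => [|a y z' IH]; first by rewrite !tmap0 subr0.
    by rewrite !tmapD IH !tmap_pure opprD addrACA -pureBr.
  by rewrite difE z1 z2 e subrr.
exists s; rewrite -z1 -z2 -sE; split.
  by rewrite (tmap_comp (f2 := idA) (g2 := resp F hZ hZ1 r1)).
by rewrite (tmap_comp (f2 := idA) (g2 := resp F hZ hZ2 r2)).
Qed.

End Tensor2.

Variables (M : modSheaf O) (K : nat -> modSheaf O).
Variables (aug : modHom M (K 0%N)) (d : forall n, modHom (K n) (K n.+1)).
Hypothesis flK : forall n, flasque (K n).
Hypothesis dd0 : forall n V s, d n.+1 V (d n V s) = 0.

Section Local.
Variables (Z Z' : opn X) (hZ : Z `<=` U_ p) (hZ' : Z' `<=` U_ p') (h : Z' `<=` Z).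
Hypothesis ex0 : forall s, d 0%N Z s = 0 <-> exists t, aug Z t = s.
Hypothesis exS : forall n s, d n.+1 Z s = 0 <-> exists t, d n Z t = s.
Hypothesis bcZ : istensor (@restrict_bil _ finX O p p' pp' M Z Z' hZ hZ' h).
Hypothesis aug_inj' : injective (aug Z').
Hypothesis ex0' : forall s, d 0%N Z' s = 0 -> exists t, aug Z' t = s.
Hypothesis exS' : forall n s, d n.+1 Z' s = 0 -> exists t, d n Z' t = s.

(** The complexes over Z and Z' resolve M(Z) and M(Z'). By flatness the first remains a resolution
    after tensoring, and between the resolved modules the map is bijective by [bcZ]. *)
Lemma cone_exact_local : cone_exact pp' d hZ hZ' h.
Proof.
split=> [t|n [t w]] /= e.
  have t0 := congr1 (fun z => z.1) e; have t1 := congr1 (fun z => z.2) e.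
  have [t' t'E] := flat_exact (u := homp aug hZ) (v := homp (d 0%N) hZ) flA (fun s => (ex0 s).1) t0.
  rewrite -t'E; suff -> : t' = 0 by rewrite tmap0.
  apply: (istensor_ker bcZ); apply: aug_inj'; rewrite hom0.
  by rewrite -[RHS]t1 -t'E phi_hom.
have t0 : tmap idA (homp (d n.+1) hZ) t = 0 := congr1 (fun z => z.1) e.
have /subr0_eq t1 : phi hZ' h t - d n Z' w = 0 := congr1 (fun z => z.2) e.
have [s sE] := flat_exact (u := homp (d n) hZ) (v := homp (d n.+1) hZ) flA
  (fun s => (@exS n s).1) t0.
have w0 : d n Z' (phi hZ' h s - w) = 0.
  by rewrite (morphDB (linear_morphD (homL (d n) Z'))) -phi_hom sE t1 subrr.
(* In degree 0 the cocycle [phi s - w] comes from M(Z'), hence from O_p' (x) M(Z), and s is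
   corrected accordingly; in higher degrees it is a boundary over Z'. *)
case: n => [|n] in t w e t0 t1 s sE w0 *.
  have [m mE] := ex0' w0; have [_ _ /(_ m)[t' t'E]] := bcZ.
  exists (s - tmap idA (homp aug hZ) t') => /=; congr (_, _).
    rewrite (morphDB (@tmapD _ _ _ _ _ _ _)) sE.
    rewrite (tmap_comp (f2 := idA) (g2 := homp (d 0%N) hZ \o homp aug hZ)) //.
    by rewrite tmap_zero ?subr0 //; right=> y; apply/ex0; exists y.
  rewrite (morphDB (@phiD _ _ _ _ _ _ _ _ _ _ _ _)) phi_hom.
  rewrite -[phi hZ' h t']/(tlift _ t') t'E mE opprB addrCA subrr addr0.
  by [].
have [w' w'E] := exS' w0.
by exists (s, w'); rewrite /= sE w'E opprB addrCA subrr addr0.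
Qed.

End Local.

Section Global.
Variable U : opn X.
Hypothesis srU : forall y, oset U y -> stalk_resolution finX aug d y.
Hypothesis supU : forall n (Z Y : opn X) (h : Y `<=` Z) (s : K n Z),
  Z `&` U `<=` Y -> mres h s = 0 -> s = 0.
Hypothesis bcU : forall y (py : spec_le p y), oset U y ->
  istensor (@restrict_bil _ finX O p p' pp' M (U_ y) (opnI (U_ p') (U_ y))
    (spec_le_umin finX py) (@opnIl _ _ _) (@opnIr _ _ _)).
Hypothesis exU : forall y, oset U y -> spec_le p y ->
  forall n (c : K n.+1 (opnI (U_ p') (U_ y))), d n.+1 _ c = 0 -> exists b, d n _ b = c.

Lemma aug_inj_on (W : opn X) : W `<=` U -> injective (aug W).
Proof.
move=> WU; apply: morphD_inj (linear_morphD (homL aug W)) _ => s s0.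
apply: (msep_umin (finX := finX)) => y Wy.
by apply: (sr_inj (srU (WU y Wy))); rewrite hom_res s0 !mres0 hom0.
Qed.

(** Preimages exist at the stalks and are unique because the augmentation is injective, so they
    glue. *)
Lemma aug_exact_on (W : opn X) s : W `<=` U -> d 0%N W s = 0 -> exists t, aug W t = s.
Proof.
move=> WU s0.
have [w|t tE] := @dprod_choice {x | oset W x} (fun w => M (U_ (sval w)))
    (fun w t => aug _ t = mres (umin_sub finX (proj2_sig w)) s).
  apply/(sr_ex0 (srU (WU _ (proj2_sig w)))).
  by rewrite hom_res s0 mres0.
have [|t0 [t0E _]] := @mglue _ _ M W _ _
    (fun w : {x | oset W x} => umin_sub finX (proj2_sig w)) (@umin_coverE _ finX W) t.
  move=> i j Z hi hj; apply: (@aug_inj_on Z).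
    by apply: subset_trans hi _; apply: subset_trans (umin_sub finX (proj2_sig i)) WU.
  rewrite !hom_res !tE.
  by rewrite !(mres_comp _ _ (subset_trans hi (umin_sub finX (proj2_sig i)))).
exists t0; apply: (msep_umin (finX := finX)) => y Wy.
by rewrite -hom_res (t0E (exist _ y Wy)); apply: (tE (exist _ y Wy)).
Qed.

Lemma cone_exact_stalk y (Z Z' : opn X) hZ hZ' h : oset U y -> spec_le p y ->
  Z = U_ y -> Z' = opnI (U_ p') (U_ y) -> @cone_exact _ finX O p p' pp' K d Z Z' hZ hZ' h.
Proof.
move=> Uy py eZ eZ'; subst Z Z'.
have WU : opnI (U_ p') (U_ y) `<=` U.
  by apply: subset_trans (@opnIr _ _ _) _; apply: umin_sub.
have sr := srU Uy.
apply: cone_exact_local.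
- exact: (sr_ex0 sr).
- by move=> n s; apply: (sr_exS sr).
- have := bcU py Uy.
  by rewrite (Prop_irrelevance (spec_le_umin finX py) hZ)
    (Prop_irrelevance (@opnIl _ _ _) hZ') (Prop_irrelevance (@opnIr _ _ _) h).
- exact: aug_inj_on.
- by move=> s; apply: aug_exact_on.
- exact: exU.
Qed.

(** Mayer-Vietoris takes a complex for every open V; the traces on U_p and U_p' provide one, with
    O_p acting on the first and O_p' on the second. *)
Let Zp V := opnI V (U_ p).
Let Zp' V := opnI V (U_ p').
Let hZp V : Zp V `<=` U_ p := @opnIr _ V (U_ p).
Let hZp' V : Zp' V `<=` U_ p' := @opnIr _ V (U_ p').
Let hI V : Zp' V `<=` Zp V.
Proof. by move=> y [Vy yp]; split=> //; apply: (spec_le_umin finX pp'). Qed.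
Let mZp (V W : opn X) (h : W `<=` V) : Zp W `<=` Zp V.
Proof. by move=> y [Vy yp]; split=> //; apply: h. Qed.
Let mZp' (V W : opn X) (h : W `<=` V) : Zp' W `<=` Zp' V.
Proof. by move=> y [Vy yp]; split=> //; apply: h. Qed.

Let D n V : zmodType := cone_ob pp' K (Zp' V) (@hZp V) n.
Let dd n V : D n V -> D n.+1 V := cone_d d (@hZp' V) (@hI V) (n := n).
Let rs n V W (h : oset W `<=` oset V) : D n V -> D n W :=
  cone_res (@hZp W) (mZp h) (mZp' h) (n := n).

Lemma cone_exact_on (V : opn X) : V `<=` U -> (forall y, oset V y -> spec_le p y) ->
  cone_exact pp' d (@hZp V) (@hZp' V) (@hI V).
Proof.
move=> VU Vp; apply: (@exact_of_stalks X finX D dd rs) => [||||||||n|y Vy].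
- by move=> n W; apply: cone_dD.
- by move=> n W W' h; apply: cone_resD.
- by move=> n W W' h s; apply: cone_d_res.
- by move=> n W s; apply: cone_dd.
- have tc n (W W' W2 : opn X) (h : W' `<=` W) (h' : W2 `<=` W') (h2 : W2 `<=` W) t :
      tmap idA (resp (K n) (@hZp W') (@hZp W2) (mZp h'))
        (tmap idA (resp (K n) (@hZp W) (@hZp W') (mZp h)) t) =
      tmap idA (resp (K n) (@hZp W) (@hZp W2) (mZp h2)) t.
    by apply: tmap_comp => // s; apply: mres_comp.
  move=> [|n] W W' W2 h h' h2 s; first exact: tc.
  rewrite /rs /= (tc _ _ _ _ _ _ h2); congr (_, _); exact: mres_comp.
- have te n (W : opn X) (t : tensor Ap (lmodp (K n) (@hZp W))) :
      (forall y, ~ oset W y) -> t = 0.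
    move=> W0; elim/tensor_ind: t => // a s t ->; rewrite addr0.
    rewrite (_ : s = 0) ?pure0r //; apply: msec_empty => y [Wy _]; exact: W0 Wy.
  move=> [|n] W s W0; first exact: te.
  case: s => t w; rewrite (te _ _ t W0) (_ : w = 0) //.
  by apply: msec_empty => y [Wy _]; apply: W0 Wy.
- have cv A (W W1 W2 : opn X) : W `<=` W1 `|` W2 -> opnI W A `<=` opnI W1 A `|` opnI W2 A.
    by move=> c y [/c[]]; [left | right].
  move=> [|n] W W1 W2 h1 h2 s c s1 s2.
    exact: (tensor_sep2 (cv _ _ _ _ c) s1 s2).
  case: s s1 s2 => t w [t1 w1] [t2 w2].
  by rewrite (tensor_sep2 (cv _ _ _ _ c) t1 t2) (msep2 (cv _ _ _ _ c) w1 w2).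
- have cv A (W W1 W2 : opn X) : W `<=` W1 `|` W2 -> opnI W A `<=` opnI W1 A `|` opnI W2 A.
    by move=> c y [/c[]]; [left | right].
  have cap A (W1 W2 : opn X) : opnI W1 A `&` opnI W2 A `<=` opnI (opnI W1 W2) A.
    by move=> y [[? ?] []].
  move=> [|n] W W1 W2 h1 h2 s1 s2 c e.
    have [t tE] := tensor_glue2 (@hZp W) (mZp h1) (mZp h2) (cv _ _ _ _ c) (@cap _ W1 W2) e.
    by exists t.
  have e1 := congr1 (fun z => z.1) e; have e2 := congr1 (fun z => z.2) e.
  have [t [t1 t2]] := tensor_glue2 (@hZp W) (mZp h1) (mZp h2) (cv _ _ _ _ c) (@cap _ W1 W2) e1.
  have [w [w1 w2]] := mglue2 (mZp' h1) (mZp' h2) (cv _ _ _ _ c) (@cap _ W1 W2) e2.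
  exists (t, w); rewrite /rs /= t1 t2 w1 w2; split.
    by case: s1 {e e1 e2 t1 w1}.
  by case: s2 {e e1 e2 t2 w2}.
- move=> W W' h s.
  by have [t tE] := cone_res_surj flK (@hZp W) (hY := @hZp W') (mZp h) (mZp' h) s; exists t.
- apply: (@cone_exact_stalk y) => //; [exact: VU | exact: Vp | |].
  + apply/opn_eq/seteqP; split=> z; first by case.
    by move=> yz; split=> //; apply: (spec_le_umin finX (Vp y Vy)).
  + by apply/opn_eq/seteqP; split=> z [].
Qed.

(** Restriction identifies the cone over U_p with the one over U /\ U_p: it is injective by [supU]
    and flatness, surjective by flasqueness. *)
Lemma cone_exact_stalks (hZ : U_ p `<=` U_ p) (hZ' : U_ p' `<=` U_ p') :
  cone_exact pp' d hZ hZ' (spec_le_umin finX pp').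
Proof.
pose V := opnI U (U_ p).
have VU : V `<=` U by move=> y [].
have Vp (y : X) : oset V y -> spec_le p y by case.
have [ex1 exS1] := cone_exact_on VU Vp.
have r : Zp V `<=` U_ p by move=> y [[]].
have r' : Zp' V `<=` U_ p' by move=> y [].
have i1 n (s : K n (U_ p)) : mres r s = 0 -> s = 0.
  by apply: supU => y [].
have i2 n (s : K n (U_ p')) : mres r' s = 0 -> s = 0.
  by apply: supU => y [yp' Uy]; split=> //; split=> //; apply: (spec_le_umin finX pp').
have inj n := @cone_res_inj _ _ _ flO _ _ pp' _ _ _ _ _ hZ (@hZp V) r r' i1 i2 n.
have resD n := @cone_resD _ finX O p p' pp' K _ _ _ _ hZ (@hZp V) r r' n.
have dres n := @cone_d_res _ finX O p p' pp' K d _ _ _ _ hZ hZ' (spec_le_umin finX pp')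
  (@hZp V) (@hZp' V) (@hI V) r r' n.
split=> [c c0|n c c0].
  by apply: inj; apply: ex1; rewrite dres c0 (morphD0 (@resD 1%N)).
have [b' b'E] : exists b', cone_d d (@hZp' V) (@hI V) b' = cone_res (@hZp V) r r' c.
  by apply: exS1; rewrite dres c0 (morphD0 (@resD n.+2)).
have [b bE] := cone_res_surj flK hZ r r' b'.
exists b; apply/subr0_eq/inj.
by rewrite (morphDB (@resD n.+1)) -dres bE b'E subrr.
Qed.

End Global.
End ConeExactness.

(** * Transport of tensor products along isomorphisms and surjections *)

Section TensorTransport.
Variables (R : comPzRingType) (T : zmodType).

Lemma istensor_iso (M A M' A' : lmodType R) (b : M -> A -> T) (b' : M' -> A' -> T)
    (g1 : {linear M' -> M}) (g2 : {linear A' -> A})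
    (k1 : {linear M -> M'}) (k2 : {linear A -> A'}) :
  cancel g1 k1 -> cancel k1 g1 -> cancel g2 k2 -> cancel k2 g2 ->
  (forall m a, b' m a = b (g1 m) (g2 a)) -> istensor b -> istensor b'.
Proof.
move=> gk1 kg1 gk2 kg2 b'E [bb bi bs].
have bb' : balanced b'.
  split=> [m m' a|m a a'|c m a]; rewrite !b'E.
  - by rewrite linearD (balDl bb).
  - by rewrite linearD (balDr bb).
  - by rewrite !linearZ (balZ bb).
have E : forall u, tlift b' u = tlift b (tmap g1 g2 u).
  apply: tensor_ext => [x y|x y|m a]; first exact: tliftD.
    by rewrite tmapD (tliftD bb).
  by rewrite tmap_pure (tlift_pure bb) (tlift_pure bb') b'E.
have cK : cancel (tmap g1 g2) (tmap k1 k2).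
  move=> u; rewrite (tmap_comp (f2 := idfun) (g2 := idfun)) // tmap_id //.
have Kc : cancel (tmap k1 k2) (tmap g1 g2).
  move=> u; rewrite (tmap_comp (f2 := idfun) (g2 := idfun)) // tmap_id //.
split=> // [u v|t]; first by rewrite !E => /bi /(can_inj cK).
by have [u <-] := bs t; exists (tmap k1 k2 u); rewrite E Kc.
Qed.

(** When f is onto, balancedness over R and over R' is the same condition, so the two tensor
    products coincide. *)
Lemma istensor_rscal (R' : comPzRingType) (f : {rmorphism R -> R'}) (M A : lmodType R')
    (b : M -> A -> T) : (forall c', exists c, f c = c') -> istensor b ->
  istensor (b : rscal f M -> rscal f A -> T).
Proof.
move=> fs [bb bi bs].
have bb' : balanced (b : rscal f M -> rscal f A -> T).
  by split=> [m m' a|m a a'|c m a]; [apply: balDl bb _ _ _ | apply: balDr bb _ _ _ |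
    apply: balZ bb _ _ _].
pose up := @pure R' M A : rscal f M -> rscal f A -> tensor M A.
pose dn := @pure R (rscal f M) (rscal f A) : M -> A -> tensor (rscal f M) (rscal f A).
have upb : balanced up by split=> [m m' a|m a a'|c m a];
  [apply: pureDl | apply: pureDr | apply: pureZ].
have dnb : balanced dn.
  split=> [m m' a|m a a'|c' m a]; [exact: pureDl | exact: pureDr |].
  by have [c <-] := fs c'; apply: (@pureZ R (rscal f M) (rscal f A) c).
have K1 : forall u, tlift dn (tlift up u) = u.
  apply: tensor_ext => [x y|//|m a]; first by rewrite (tliftD upb) (tliftD dnb).
  by rewrite (tlift_pure upb) (tlift_pure dnb).
have K2 : forall u, tlift up (tlift dn u) = u.
  apply: tensor_ext => [x y|//|m a]; first by rewrite (tliftD dnb) (tliftD upb).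
  by rewrite (tlift_pure dnb) (tlift_pure upb).
have E : forall u, tlift (b : rscal f M -> rscal f A -> T) u = tlift b (tlift up u).
  apply: tensor_ext => [x y|x y|m a]; first exact: tliftD.
    by rewrite (tliftD upb) (tliftD bb).
  by rewrite (tlift_pure upb) (tlift_pure bb) (tlift_pure bb').
split=> // [u v|t]; first by rewrite !E => /bi /(can_inj K1).
by have [u <-] := bs t; exists (tlift dn u); rewrite E K2.
Qed.

End TensorTransport.

Section KernelMaps.
Variables (X : topologicalType) (O : ringSheaf X) (L M N : modSheaf O).

Fact ker_incl_linear (f : modHom M N) V : linear (val : ker_sheaf f V -> M V).
Proof. by []. Qed.
Definition ker_incl (f : modHom M N) : modHom (ker_sheaf f) M :=
  @ModHom _ _ (ker_sheaf f) M (fun V => val) (@ker_incl_linear f) (fun _ _ _ _ => erefl).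

Variables (g : modHom L M) (f : modHom M N) (fg0 : forall V s, f V (g V s) = 0).

Let lift0 V (s : L V) : ker_sheaf f V := ker_sec (fg0 s).
Fact ker_lift_linear V : linear (@lift0 V).
Proof. by move=> c s t; apply: val_inj; rewrite /= homL. Qed.
Fact ker_lift_res (V W : opn X) (h : W `<=` V) s : lift0 (mres h s) = mres h (lift0 s).
Proof. by apply: val_inj; rewrite /= hom_res. Qed.
Definition ker_lift : modHom L (ker_sheaf f) := ModHom ker_lift_linear ker_lift_res.

End KernelMaps.

(** * Flat base change for cohomology sheaves *)

Section CohomologyBaseChange.
Variables (X : topologicalType) (finX : finite_set [set: X]) (O : ringSheaf X).
Notation U_ := (umin finX).
Hypothesis flO : finite_space finX O.
Variables (p p' : X) (pp' : spec_le p p').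
Notation idA := (idfun : {linear stalk_over finX O pp' -> stalk_over finX O pp'}).
Let flA : flat_mod (stalk_over finX O pp').
Proof. exact: (@flO _ _ pp'). Qed.
Variables (K : nat -> modSheaf O) (d : forall n, modHom (K n) (K n.+1)).
Hypothesis dd0 : forall n V s, d n.+1 V (d n V s) = 0.
Let hZ : U_ p `<=` U_ p := @subset_refl _ _.
Let hZ' : U_ p' `<=` U_ p' := @subset_refl _ _.
Let h := spec_le_umin finX pp'.
Hypothesis ex : cone_exact pp' d hZ hZ' h.
(** Surjectivity on cohomology: (0, z) is a cocycle of the cone. *)
Let lift_cocycle n (z : K n (U_ p')) : d n _ z = 0 ->
  exists t, tmap idA (homp (d n) hZ) t = 0 /\ coboundaries d n _ (phi hZ' h t - z).
Proof.
move=> z0; have [|b bE] := ex.2 n ((0, z) : cone_ob pp' K (U_ p') hZ n.+1).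
  rewrite /cone_d /= tmap0 z0 subr0; congr (_, _).
  by apply: (morphD0 (@phiD _ _ _ _ _ _ _ _ hZ hZ' h (K n.+1))).
case: n z z0 b bE => [|m] z z0 b bE /=.
  by exists b; case: bE => -> ->; rewrite subrr.
exists b.1; case: bE => -> <-; split=> //; exists b.2 => //.
by rewrite opprB addrCA subrr addr0.
Qed.

(** Injectivity on cohomology. That t is a boundary is expressed by a morphism f with values in the
    coboundaries, a form that lifts to the kernel sheaf; in degree 0, where no differential comes
    in, t is zero. *)
Let cocycle_boundary n
    (t : tensor (stalk_over finX O pp') (lmodp (K n) hZ)) :
  tmap idA (homp (d n) hZ) t = 0 -> coboundaries d n _ (phi hZ' h t) ->
  t = 0 \/ exists (L : modSheaf O) (f : modHom L (K n)), [/\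
    (forall V x, d n V (f V x) = 0), (forall V x, coboundaries d n V (f V x)) &
    exists s, tmap idA (homp f hZ) s = t].
Proof.
case: n t => [|m] t t0 ct; [left | right].
  by apply: ex.1; rewrite /= t0 ct.
have [w _ wE] := ct.
have [|s sE] := ex.2 m ((t, w) : cone_ob pp' K (U_ p') hZ m.+1).
  by rewrite /cone_d /= t0 wE subrr.
exists (K m), (d m); split; [exact: dd0 | by move=> V x; exists x |].
clear t0 ct wE.
by case: m t w s sE => [|m] t w s sE; [exists s | exists s.1]; case: sE.
Qed.

Variables (i : nat) (H : modSheaf O) (pr : modHom (ker_sheaf (d i)) H).
Hypothesis pr_epi : mod_epi pr.
Hypothesis pr_ker : forall V (z : ker_sheaf (d i) V),
  pr V z = 0 <-> locally_in (coboundaries d i) (val z).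

Let inc := ker_incl (d i).

Let pr_surj x (s : H (U_ x)) : exists z, pr _ z = s.
Proof.
by have [z _ <-] := locally_in_minimal (Pr := fun V => range (pr V))
  (minimal_umin finX x) (pr_epi s); exists z.
Qed.

Let pr_eq0 x (z : ker_sheaf (d i) (U_ x)) : pr _ z = 0 <-> coboundaries d i _ (val z).
Proof.
rewrite pr_ker; split=> [|cz]; first exact: locally_in_minimal (minimal_umin finX x).
apply: (locally_inP (finX := finX)) => y xy; exact: coboundaries_res.
Qed.

Let from_ker (t : tensor (stalk_over finX O pp') (lmodp (K i) hZ)) :
  tmap idA (homp (d i) hZ) t = 0 -> exists t', tmap idA (homp inc hZ) t' = t.
Proof.
apply: (flat_exact (v := homp (d i) hZ) flA) => s s0.
by exists (ker_sec s0).
Qed.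

Let inc_inj : injective (tmap idA (homp inc hZ)).
Proof. by apply: flA => x y /val_inj. Qed.

Let boundary_eq0 (t : tensor (stalk_over finX O pp') (lmodp (K i) hZ)) :
  tmap idA (homp (d i) hZ) t = 0 -> coboundaries d i _ (phi hZ' h t) ->
  exists2 t', tmap idA (homp inc hZ) t' = t & tmap idA (homp pr hZ) t' = 0.
Proof.
move=> t0 /(cocycle_boundary t0)[->|[L [f [df0 cf [s sE]]]]].
  by exists 0; rewrite tmap0.
exists (tmap idA (homp (ker_lift df0) hZ) s).
  by rewrite -sE; apply: tmap_comp.
rewrite (tmap_comp (f2 := idA) (g2 := homp pr hZ \o homp (ker_lift df0) hZ)) //.
by apply: tmap_zero; right=> x; apply/pr_eq0/cf.
Qed.

(** O_p' being flat, its tensor product with the cocycles is the group of cocycles of the tensored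
    complex; and over minimal open sets H is cocycles modulo coboundaries. Injectivity is then
    [boundary_eq0], surjectivity [lift_cocycle]. *)
Lemma cohomology_stalk_base_change : base_change H h.
Proof.
(* [lmodp H hZ] is H(U_p) with scalars restricted along the inclusion of U_p in itself, which is the
   identity only through [rres_id]; hence the transport. *)
have E (m : rscal (rres h) (O (U_ p'))^o) (a : H (U_ p)) :
  (m : O (U_ p')) *: mres h a = @restrict_bil _ finX O p p' pp' H _ _ hZ hZ' h m (a : lmodp H hZ).
  by rewrite /restrict_bil rres_id.
have L1 : linear (id : H (U_ p) -> lmodp H hZ).
  by move=> c x y; rewrite rscalE rres_id.
have L2 : linear (id : lmodp H hZ -> H (U_ p)).
  by move=> c x y; rewrite rscalE rres_id.
apply: (istensor_iso (g1 := idA) (k1 := idA) (g2 := lin_of L1) (k2 := lin_of L2) _ _ _ _ E) => //.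
apply: istensor_intro; first exact: restrict_bil_balanced.
- move=> u u0.
  have [t' t'E] := @tmap_surj _ _ _ _ _ idA (homp pr hZ) (fun y => ex_intro _ y erefl)
    (@pr_surj p) u.
  have t0 : tmap idA (homp (d i) hZ) (tmap idA (homp inc hZ) t') = 0.
    rewrite (tmap_comp (f2 := idA) (g2 := homp (d i) hZ \o homp inc hZ)) //.
    by apply: tmap_zero; right=> a; apply: ker_secP.
  have [|t2 /inc_inj ->] := boundary_eq0 t0; last by rewrite t'E.
  rewrite phi_hom; apply/pr_eq0.
  by rewrite -phi_hom t'E.
- move=> t; have [z' z'E] := pr_surj t.
  have [s [s0 cs]] := lift_cocycle (ker_secP z').
  have [t' t'E] := from_ker s0.
  exists (tmap idA (homp pr hZ) t').
  rewrite -[LHS]/(phi hZ' h _) phi_hom -z'E; apply/subr0_eq.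
  rewrite -(morphDB (linear_morphD (homL pr _))); apply/pr_eq0.
  rewrite -[val _]/(inc _ (phi hZ' h t') - val z').
  by rewrite -phi_hom t'E.
Qed.

End CohomologyBaseChange.

(** * Quasi-coherence of the cohomology sheaves *)

Section CohomologyQuasiCoherent.
Variables (k : comPzRingType) (X : topologicalType) (finX : finite_set [set: X]).
Variables (O : ringSheaf X) (kappa : {rmorphism k -> O (opnT X)}).
Hypothesis schX : schematic finX kappa.
Notation U_ := (umin finX).
Variables (U : opn X) (M : modSheaf O) (K : nat -> modSheaf O).
Variables (aug : modHom M (K 0%N)) (d : forall n, modHom (K n) (K n.+1)).
Hypothesis flK : forall n, flasque (K n).
Hypothesis dd0 : forall n V s, d n.+1 V (d n V s) = 0.
Hypothesis srU : forall y, oset U y -> stalk_resolution finX aug d y.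
Hypothesis supU : forall n (Z Y : opn X) (h : Y `<=` Z) (s : K n Z),
  Z `&` U `<=` Y -> mres h s = 0 -> s = 0.
Hypothesis bcU : forall x y (xy : spec_le x y), oset U x ->
  base_change M (spec_le_umin finX xy).

Lemma cohomology_base_change i H (P Q : opn X) (h : Q `<=` P) p p' :
  is_cohomology_sheaf d i H -> minimal_at P p -> minimal_at Q p' -> base_change H h.
Proof.
move=> [pr [pr_epi pr_ker]] Pp Qp'.
have eP : P = U_ p by apply: opn_eq; rewrite [oset P]Pp.
have eQ : Q = U_ p' by apply: opn_eq; rewrite [oset Q]Qp'.
subst P Q.
have pp' : spec_le p p' by apply: h; apply: umin_refl.
rewrite (Prop_irrelevance h (spec_le_umin finX pp')).
have flO := schX.1.
apply: (cohomology_stalk_base_change flO dd0 _ pr_epi pr_ker).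
(* At x in U above p, schematicity is fed into the tensor computation over U_p' /\ U_x. *)
have locU x (px : spec_le p x) (Ux : oset U x) :
    istensor (@intersection_bil _ finX O p p' x pp' px (opnI (U_ p') (U_ x))
      (@opnIl _ _ _) (@opnIr _ _ _) M) /\
    forall n (c : K n.+1 (opnI (U_ p') (U_ x))), d n.+1 _ c = 0 -> exists b, d n _ b = c.
  have srx y : spec_le x y -> stalk_resolution finX aug d y.
    by move=> xy; apply: srU; apply: spec_le_open xy Ux.
  have bcx y (xy : spec_le x y) := bcU xy Ux.
  have sW := schematic_sections schX pp' px (@opnIl _ _ _) (@opnIr _ _ _) erefl.
  have aW := @schematic_acyclic _ _ _ _ _ schX _ _ _ pp' px.
  split; first exact: (intersection_istensor flO sW aW srx flK bcx).
  move=> n c c0; have [_ exW] := sections_and_exactness flO (@opnIr _ (U_ p') (U_ x))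
    aW srx flK bcx.
  exact: exW c0.
apply: (cone_exact_stalks flO flK dd0 srU supU) => [y py Uy|y Uy py].
  exact: (locU y py Uy).1.
exact: (locU y py Uy).2.
Qed.

Lemma cohomology_quasi_coherent i H : is_cohomology_sheaf d i H -> quasi_coherent H.
Proof.
move=> cH; apply: (base_change_quasi_coherent finX) => P Q h x y Px Qy.
exact: cohomology_base_change cH Px Qy.
Qed.

End CohomologyQuasiCoherent.

(** * Direct image along an open inclusion *)

Section DirectImageOpen.
Variables (X : topologicalType) (finX : finite_set [set: X]) (O : ringSheaf X).
Variables (U : opn X) (N : modSheaf (restr_ring O U)).
Notation OU := (restr_ring O U).
Notation j := (open_inclusion O U).
Let finU : finite_set [set: set_type U] := finite_subspace U finX.

(** For P inside U the ring map [rsharp j P] is bijective without being the identity. Base change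
    for N is moved along it: over P by surjectivity, over Q by the isomorphism [lin_of L1]. *)
Lemma base_change_direct_image (P Q : opn X) (h : Q `<=` P) x y :
  quasi_coherent N -> P `<=` U -> minimal_at P x -> minimal_at Q y ->
  base_change (direct_image j N) h.
Proof.
move=> qN PU Px Qy; have QU := subset_trans h PU.
have Ux : x \in (U : set X) by apply/mem_set/PU; rewrite Px; apply: umin_set_refl.
have Uy : y \in (U : set X) by apply/mem_set/QU; rewrite Qy; apply: umin_set_refl.
have bcN := quasi_coherent_base_change finU qN (opreimS (f := j) h)
  (minimal_ores (x := SigSub Ux) Px) (minimal_ores (x := SigSub Uy) Qy).
have hP : P `<=` oimg (ores U P) by rewrite oimg_ores_eq.
have hQ : Q `<=` oimg (ores U Q) by rewrite oimg_ores_eq.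
have fs (c' : OU (ores U P)) : exists c, rsharp j P c = c'.
  exists (rres hP c'); rewrite -[LHS]/(rres (@oimg_opreim _ U P) (rres hP c')).
  by rewrite (rres_comp _ _ (@subset_refl _ _)) rres_id.
have bc := istensor_rscal fs bcN.
pose A1 := rscal (@rres X O P Q h) (O Q)^o.
pose A2 := rscal (rsharp j P) (rscal (rres (opreimS (f := j) h)) (OU (ores U Q))^o).
have L1 : linear (rsharp j Q : A1 -> A2).
  move=> c s t; rewrite !rscalE rmorphD rmorphM; congr (_ * _ + _).
  exact: (rsharp_res j h (opreimS (f := j) h)).
have K1 : cancel (lin_of L1) (@rres X O _ _ hQ : A2 -> A1).
  move=> s; rewrite -[LHS]/(rres hQ (rres (@oimg_opreim _ U Q) (s : O Q))).
  by rewrite (rres_comp _ _ (@subset_refl _ _)) rres_id.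
have K2 : cancel (@rres X O _ _ hQ : A2 -> A1) (lin_of L1).
  move=> s; rewrite -[LHS]/(rres (@oimg_opreim _ U Q) (rres hQ (s : O _))).
  by rewrite (rres_comp _ _ (@subset_refl _ _)) rres_id.
have L2 : linear (@rres X O _ _ hQ : A2 -> A1).
  by move=> c s t; apply: (can_inj K1); rewrite linearP !K2.
exact: (istensor_iso (g1 := lin_of L1) (k1 := lin_of L2) (g2 := idfun) (k2 := idfun)
  K1 K2 _ _ _ bc).
Qed.

Variable I : injective_resolution N.
Let K n := direct_image j (I n).
Let d n : modHom (K n) (K n.+1) := direct_image_hom j (ires_d I n).
Let aug : modHom (direct_image j N) (K 0%N) := direct_image_hom j (ires_aug I).

Lemma direct_image_flasque n : flasque (K n).
Proof.
move=> V W h s.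
exact: (injective_flasque finU (@ires_inj _ _ _ I n) (opreimS (f := j) h) s).
Qed.

Lemma direct_image_dd n V s : d n.+1 V (d n V s) = 0.
Proof.
apply/(@ires_exact _ _ _ I n) => y Vy.
exists (opreim (rscont j) V), (@subset_refl _ _); split=> //.
by rewrite mres_id; exists s.
Qed.

(** For y in U the preimage of U_y is the minimal open set of y in U, where the resolution I is
    exact on sections. *)
Lemma direct_image_stalk y : oset U y -> stalk_resolution finX aug d y.
Proof.
move=> Uy; pose y' : set_type U := SigSub (mem_set Uy).
have My : minimal_at (ores U (umin finX y)) y' by apply: minimal_ores.
split; first exact: ires_mono.
- move=> s; have [E1 E2] := exact_at_minimal (s : I 0%N (ores U (umin finX y))) My
    (@ires_exact0 _ _ _ I).
  by split=> [/E1[t tE]|[t tE]]; [exists t | apply: E2; exists t].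
- move=> n s; have [E1 E2] := exact_at_minimal (s : I n.+1 (ores U (umin finX y))) My
    (@ires_exact _ _ _ I n).
  by split=> [/E1[t tE]|[t tE]]; [exists t | apply: E2; exists t].
Qed.

(** Preimages under j only see the trace on U. *)
Lemma direct_image_support n (Z Y : opn X) (h : Y `<=` Z) (s : K n Z) :
  Z `&` U `<=` Y -> mres h s = 0 -> s = 0.
Proof.
move=> ZY s0; have ZY' : ores U Z `<=` ores U Y.
  by move=> y Zy; apply: ZY; split=> //; apply: set_mem (valP y).
rewrite -(mres_id (@subset_refl _ (ores U Z)) (s : I n (ores U Z))).
rewrite -(mres_comp (opreimS (f := j) h) ZY').
by move: s0 => /= ->; rewrite mres0.
Qed.

(** Left exactness of j_*: a cocycle over V has a unique preimage among the sections of N over the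
    trace of V. *)
Lemma direct_image_cohomology0 : is_cohomology_sheaf d 0%N (direct_image j N).
Proof.
have augI : forall V, injective (ires_aug I V) by apply: ires_mono.
have srT y : oset (opnT (set_type U)) y -> stalk_resolution finU (ires_aug I) (ires_d I) y.
  by move=> _; apply: resolution_stalk.
have ex V (z : ker_sheaf (d 0%N) V) : exists t : direct_image j N V, aug V t = val z.
  have [t tE] := aug_exact_on srT (s := val z : I 0%N (ores U V)) (@subsetT _ _)
    (ker_secP z).
  by exists t.
pose p V z := sval (cid (ex V z)).
have pE V z : aug V (p V z) = val z by rewrite /p; case: cid.
have pL V : linear (p V).
  by move=> c s t; apply: (augI (ores U V)); rewrite -[LHS]/(aug V _) -[RHS]/(aug V _) homL !pE.
have p_res (V W : opn X) (h : W `<=` V) s : p W (mres h s) = mres h (p V s).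
  by apply: (augI (ores U W)); rewrite -[LHS]/(aug W _) -[RHS]/(aug W _) hom_res !pE.
have aug0 V t : d 0%N V (aug V t) = 0.
  apply/(@ires_exact0 _ _ _ I) => y Vy.
  exists (opreim (rscont j) V), (@subset_refl _ _); split=> //.
  by rewrite mres_id; exists t.
exists (ModHom pL p_res); split=> [V t x Vx|V z].
  exists V, (@subset_refl _ V); split=> //; rewrite mres_id.
  exists (ker_sec (aug0 V t)) => //; apply: (augI (ores U V)).
  by rewrite -[LHS]/(aug V _) pE.
split=> [/= pz x Vx|lz].
  exists V, (@subset_refl _ V); split=> //; rewrite mres_id /=.
  by rewrite -pE pz hom0.
apply: (augI (ores U V)); rewrite -[LHS]/(aug V _) pE -[RHS]/(aug V 0) hom0.
have z0 : val z = 0 :> K 0%N V; last exact: z0.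
apply: (msep_umin (finX := finX)) => y Vy.
rewrite mres0; apply: (locally_in_minimal (Pr := coboundaries d 0%N) (minimal_umin finX y)).
apply: locally_in_res lz => *; exact: coboundaries_res.
Qed.

(** The trace on U of the image of V is V, but only propositionally; the restrictions in the two
    directions are mutually inverse. *)
Lemma restr_direct_image_iso : mod_iso (restr_mod U (direct_image j N)) N.
Proof.
have h1 (V : opn (set_type U)) : V `<=` ores U (oimg V) by move=> y Vy; exists y.
have h2 (V : opn (set_type U)) : ores U (oimg V) `<=` V by apply: ores_sub.
pose f V (s : restr_mod U (direct_image j N) V) : N V := mres (h1 V) s.
pose g V (s : N V) : restr_mod U (direct_image j N) V := mres (h2 V) s.
have fK V : cancel (f V) (g V).
  by move=> s; rewrite /f /g (mres_comp _ _ (@subset_refl _ _)) mres_id.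
have gK V : cancel (g V) (f V).
  by move=> s; rewrite /f /g (mres_comp _ _ (@subset_refl _ _)) mres_id.
have fL V : linear (f V).
  move=> c s t; rewrite /f.
  rewrite -[c *: s]/(rres (@oimg_opreim _ U (oimg V)) c *: (s : N (ores U (oimg V)))).
  rewrite mresL; congr (_ *: _ + _).
  exact (etrans (rres_comp (@oimg_opreim _ U (oimg V)) (oimgS (h1 V)) (@subset_refl _ _) c)
    (@rres_id X O (oimg V) _ c)).
have gL V : linear (g V).
  by move=> c s t; apply: (can_inj (@fK V)); rewrite fL !gK.
have f_res (V W : opn (set_type U)) (h : W `<=` V) s : f W (mres h s) = mres h (f V s).
  rewrite /f -[mres h s]/(@mres _ OU N _ _ (opreimS (f := j) (oimgS h)) s).
  by rewrite !(mres_comp _ _ (subset_trans h (h1 V))).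
have g_res (V W : opn (set_type U)) (h : W `<=` V) s : g W (mres h s) = mres h (g V s).
  by apply: (can_inj (@fK W)); rewrite f_res !gK.
by exists (ModHom fL f_res), (ModHom gL g_res).
Qed.

End DirectImageOpen.

Theorem theorem4p4 (k : comPzRingType) (X : topologicalType)
    (finX : finite_set [set: X]) (O : ringSheaf X)
    (kappa : {rmorphism k -> O (opnT X)}) (schX : schematic finX kappa)
    (U : opn X) (N : modSheaf (restr_ring O U)) (qN : quasi_coherent N) :
  (forall i : nat, higher_direct_image_qcoh (open_inclusion O U) i N) /\
  (exists M : modSheaf O, quasi_coherent M /\ mod_iso (restr_mod U M) N).
Proof.
have [I] := injective_resolution_exists (finite_subspace U finX) N.
(* Stated for every copy H of the cohomology sheaf, so that it covers both the constructed R^i j_* N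
   and, in degree 0, j_* N itself. *)
have qcH i H : is_cohomology_sheaf
    (fun n => direct_image_hom (open_inclusion O U) (ires_d I n)) i H -> quasi_coherent H.
  apply: (cohomology_quasi_coherent schX (U := U)
    (aug := direct_image_hom (open_inclusion O U) (ires_aug I))).
  - exact: (@direct_image_flasque X finX O U N I).
  - exact: direct_image_dd.
  - exact: direct_image_stalk.
  - exact: direct_image_support.
  - move=> x y xy Ux.
    by apply: (@base_change_direct_image _ finX _ _ _ (umin finX x) (umin finX y) _ x y qN) => //;
      apply: umin_sub.
split=> [i|].
  have cH := cohomology_sheaf_exists finX
    (fun n => direct_image_hom (open_inclusion O U) (ires_d I n)) i.
  by eexists; [exists I; exact: cH | exact: qcH cH].
exists (direct_image (open_inclusion O U) N); split.
  exact: qcH (direct_image_cohomology0 finX I).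
exact: restr_direct_image_iso.
Qed.
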